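(* Let $\varphi(x)=-x$ on $[-1,0]$ be the conformal welding for the vertical line segment $[0,i]$, with corresponding driver $\mathbf{0}(t)\equiv0$ and hitting times $\tau_{\mathbf{0}}(x)=x^2/4$, $x\in[-1,1]$. There exist conformal weldings $\varphi_n:[-1,0]\to[0,1]$ corresponding to simple curves $\gamma_n$ with drivers $\xi_n\in S_0([0,T_n])$ and hitting times $\tau_n:[-1,1]\to\mathbb{R}$ such that $\|\varphi_n-\varphi\|_{\infty[-1,0]}\to0$ but $\xi_n\not\to\mathbf{0}$ and $\tau_n\not\to\tau_{\mathbf{0}}$ uniformly; that is, neither $\|\xi_n\|_{\infty[0,T_n]}$ nor $\|\tau_n-\tau_{\mathbf{0}}\|_{\infty[-1,1]}$ tends to $0$.
   Context: A driver is a continuous function $\xi:[0,T]\to\mathbb{R}$, $0<T<\infty$. The upwards Loewner flow of $\xi$ in the upper half plane $\mathbb{H}$ is the solution of $\partial_t h_t(z)=\frac{-2}{h_t(z)-\xi(t)}$, $h_0(z)=z$; for $z\in\mathbb{H}$ it exists on all of $[0,T]$. Hitting times: for $x\in\mathbb{R}\setminus\{\xi(0)\}$, let $x(t)=h_t(x;\xi)$ be the real solution of the same ODE started at $x$, and let $\tau(x;\xi):=\inf\{t\ge 0: \liminf_{s\nearrow t}|x(s)-\xi(s)|=0\}$ (with $t\in[0,T]$ and $\inf\emptyset=+\infty$); also $\tau(\xi(0);\xi)=0$. Simple-curve drivers: $S([0,T])$ is the set of continuous $\xi:[0,T]\to\mathbb{R}$ that generate a simple curve, i.e. there is an injective continuous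 $\gamma:[0,T]\to\mathbb{H}\cup\{\xi(T)\}$ with $\gamma(0)=\xi(T)$ and $\gamma((0,T])\subset\mathbb{H}$ such that $h_T$ maps $\mathbb{H}$ conformally onto $\mathbb{H}\setminus\gamma((0,T])$; $\xi$ is then called the (upwards) driver of $\gamma$. $S_0([0,T])$ is the set of $\xi\in S([0,T])$ with $\xi(0)=0$. Conformal welding: for $\xi\in S_0([0,T])$, the hitting time function is finite exactly on a compact interval $[-a,b]$ with $-a<0<b$, is continuous there, strictly decreasing on $[-a,0]$ and strictly increasing on $[0,b]$, with $\tau(-a)=\tau(b)=T$. With $\tau_-=\tau|_{[-a,0]}$, $\tau_+=\tau|_{[0,b]}$, the conformal welding of $\xi$ (or of its curve) is the homeomorphism $\varphi=\tau_+^{-1}\circ\tau_-:[-a,0]\to[0,b]$, i.e. $\tau(x)=\tau(\varphi(x))$. *)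

(* Defs.v *)
From Stdlib Require Import Reals.
From Coquelicot Require Import Coquelicot.

Open Scope R_scope.

Definition Icc (a b t : R) : Prop := a <= t <= b.
Definition Ico (a b t : R) : Prop := a <= t < b.

(* [is_derive] with the limit taken inside [D]: at an endpoint of an interval
   [D] this is the one-sided derivative. *)
Definition is_derive_within {V : NormedModule R_AbsRing}
    (D : R -> Prop) (f : R -> V) (t : R) (l : V) : Prop :=
  filterdiff f (within D (locally t)) (fun s : R => scal s l).

(* [u] solves  u' = -2 / (u - xi),  u(0) = z  on the time set [D].
   The condition [u t <> xi t] is needed because [Cinv] is total. *)
Definition upward_loewner_solution
    (D : R -> Prop) (xi : R -> R) (z : C) (u : R -> C) : Prop :=
  u 0 = z /\
  forall t : R, D t ->
    u t <> RtoC (xi t) /\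
    is_derive_within D u t (RtoC (-2) / (u t - RtoC (xi t)))%C.

Definition upper_half_plane (z : C) : Prop := 0 < Im z.

Definition upward_loewner_flow (T : R) (xi : R -> R) (h : R -> C -> C) : Prop :=
  forall z : C, upper_half_plane z ->
    upward_loewner_solution (Icc 0 T) xi z (fun t => h t z).

(* Meant for open [A], where the full complex derivative is the right one. *)
Definition conformal_onto (A B : C -> Prop) (f : C -> C) : Prop :=
  (forall z : C, A z -> ex_derive (K := C_AbsRing) (V := C_NormedModule) f z) /\
  (forall z w : C, A z -> A w -> f z = f w -> z = w) /\
  (forall w : C, B w <-> exists z : C, A z /\ f z = w).

Definition driver (T : R) (xi : R -> R) : Prop :=
  0 < T /\ continuous_on (Icc 0 T) xi.

Definition upward_driver_of (T : R) (xi : R -> R) (gamma : R -> C) : Prop :=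
  driver T xi /\
  continuous_on (Icc 0 T) gamma /\
  (forall s t : R, Icc 0 T s -> Icc 0 T t -> gamma s = gamma t -> s = t) /\
  gamma 0 = RtoC (xi T) /\
  (forall t : R, 0 < t <= T -> upper_half_plane (gamma t)) /\
  exists h : R -> C -> C,
    upward_loewner_flow T xi h /\
    conformal_onto upper_half_plane
      (fun w => upper_half_plane w /\
                ~ (exists t : R, 0 < t <= T /\ gamma t = w))
      (h T).

Definition simple_curve_driver (T : R) (xi : R -> R) : Prop :=
  exists gamma : R -> C, upward_driver_of T xi gamma.

Definition simple_curve_driver0 (T : R) (xi : R -> R) : Prop :=
  simple_curve_driver T xi /\ xi 0 = 0.

(* liminf of f(s) as s increases to t, in the style of [is_LimInf_seq]. *)
Definition is_liminf_left (f : R -> R) (t l : R) : Prop :=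
  forall eps : posreal,
    (forall d : posreal, exists s : R, t - d < s < t /\ f s < l + eps) /\
    (exists d : posreal, forall s : R, t - d < s < t -> l - eps < f s).

(* The real solution started at x <> xi(0) exists on [0,t) and meets the driver
   at time t.  Time 0 is excluded explicitly: there [Ico 0 t] is empty and the
   values of [u] at negative times are meaningless. *)
Definition hits_at (T : R) (xi : R -> R) (x t : R) : Prop :=
  0 < t <= T /\
  exists u : R -> R,
    upward_loewner_solution (Ico 0 t) xi (RtoC x) (fun s => RtoC (u s)) /\
    is_liminf_left (fun s => Rabs (u s - xi s)) t 0.

Definition hitting_time (T : R) (xi : R -> R) (x : R) : Rbar :=
  if Req_EM_T x (xi 0) then Finite 0 else Glb_Rbar (hits_at T xi x).

(* [real p_infty] is 0, so this is only meaningful where the hitting time is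
   finite. *)
Definition hitting_time_R (T : R) (xi : R -> R) (x : R) : R :=
  real (hitting_time T xi x).

Definition hitting_interval (T : R) (xi : R -> R) (a b : R) : Prop :=
  0 < a /\ 0 < b /\
  (forall x : R, is_finite (hitting_time T xi x) <-> - a <= x <= b) /\
  continuous_on (Icc (- a) b) (hitting_time_R T xi) /\
  (forall x y : R, - a <= x -> x < y -> y <= 0 ->
     hitting_time_R T xi y < hitting_time_R T xi x) /\
  (forall x y : R, 0 <= x -> x < y -> y <= b ->
     hitting_time_R T xi x < hitting_time_R T xi y) /\
  hitting_time_R T xi (- a) = T /\
  hitting_time_R T xi b = T.

(* phi = tau_+^{-1} o tau_- : [-a,0] -> [0,b]; the values of [phi] outside
   [-a,0] are irrelevant. *)
Definition conformal_welding
    (T : R) (xi : R -> R) (a b : R) (phi : R -> R) : Prop :=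
  hitting_interval T xi a b /\
  forall x : R, - a <= x <= 0 ->
    0 <= phi x <= b /\
    hitting_time_R T xi (phi x) = hitting_time_R T xi x.

(* Supremum norm of a function bounded on [a,b] (for an unbounded one,
   [real p_infty] gives the meaningless value 0). *)
Definition sup_norm (a b : R) (f : R -> R) : R :=
  real (Lub_Rbar (fun r => exists x : R, a <= x <= b /\ r = Rabs (f x))).

(* Main.v *)
Require Import Defs.
From Stdlib Require Import Reals Ranalysis5 Lra Psatz.
From Stdlib Require Import ClassicalEpsilon FunctionalExtensionality.
From Coquelicot Require Import Coquelicot.
Open Scope R_scope.

(** Why uniform convergence of weldings does not control drivers.

    The driver [A t sin t], with [A] large, sweeps back and forth over an interval
    that grows slowly compared with the oscillation. The right real point that meets
    a driver at time [t] lies between the running maximum of the driver and this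
    maximum plus [2 sqrt t]: solutions decrease and stay above the driver until they meet
    it ([touching_above_driver]), and while the driver stays below [B] and the solution [u]
    above [B], one has [((u - B)^2)' >= -4] ([touching_upper_bound]). The same holds on the
    left with the running minimum. The running maximum and minus the running minimum both
    equal [A t] up to the growth during one period, so the welding is close to [x |-> - x] at the
    scale of the whole interval ([oscillation_endpoints_close]), although the driver
    oscillates over this whole interval. The two sides are exactly balanced at a suitable end
    time, which the intermediate value theorem finds between a positive and a negative
    peak ([balanced_time]); scaling then makes both sides equal to 1. The scaled time is at
    most 1/16 instead of 1/4, and the scaled driver reaches at least height 1/5, so neither
    norm tends to 0.

    What remains is to show that smooth drivers generate simple curves and have a
    continuous hitting time. Both follow from one equation, [V' = 2 / V + eta] in
    [Re V > 0]. For the upward flow [h] put [V = - i (h - xi)], with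
    imaginary drift [eta = i xi']; for a real point [u] put [V = u - xi] and run
    time backwards, so that [V] is positive and the drift is real. The equation is singular
    at [V = 0], which is where tips of curves and hitting points are born. In the cone
    [|Im V| <= Re V] the flow contracts ([bessel_contraction]), and solutions started
    on the positive axis stay in this cone for a uniform time; hence they converge
    as the starting point tends to 0 ([singular_existence]), and for imaginary
    drift any solution coming from 0 is the limit ([singular_unique]).

    With [V_a] the solution born at time [a], the curve is [gamma (T - a) = xi T + i V_a T].
    Uniqueness makes it injective and disjoint from the image of
    the flow; conversely a point followed backwards either reaches time 0 or runs into
    the singularity and lies on the curve ([backward_dichotomy]). On the real line the
    solutions born at time [t] give the two points that meet the driver
    at time [t]; these move strictly monotonically and continuously, and the hitting
    time is their inverse ([smooth_driver_hitting_interval]). *)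


(** * Barriers and Gronwall estimates *)

Lemma is_derive_continuity_pt (f : R -> R) (x l : R) :
  is_derive f x l -> continuity_pt f x.
Proof.
  intros H. apply continuity_pt_filterlim.
  apply (ex_derive_continuous (K := R_AbsRing) (V := R_NormedModule)).
  now exists l.
Qed.

Lemma small_positive (a b : R) : 0 < a -> 0 < b -> exists h, 0 < h < a /\ h < b.
Proof.
  intros Ha Hb. pose proof (Rmin_l a b). pose proof (Rmin_r a b).
  assert (0 < Rmin a b) by now apply Rmin_pos. exists (Rmin a b / 2). lra.
Qed.

Lemma continuity_pt_near (f : R -> R) (t eps : R) : continuity_pt f t -> 0 < eps ->
  exists d, 0 < d /\ forall s, t - d < s < t + d -> f t - eps < f s < f t + eps.
Proof.
  intros H Heps. destruct (H eps Heps) as [d [Hd Hd']]. exists d. split; [exact Hd|].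
  intros s Hs. destruct (Req_dec t s) as [<- | Hts]; [lra|].
  assert (Habs : Rabs (f s - f t) < eps).
  { apply Hd'. split; [split; [exact I|exact Hts]|]. apply Rabs_def1; lra. }
  apply Rabs_def2 in Habs. lra.
Qed.

Lemma continuity_pt_cst (c t : R) : continuity_pt (fun _ => c) t.
Proof. apply continuity_pt_const. intros x y; reflexivity. Qed.

Lemma MVT_open (f df : R -> R) (a b : R) :
  a < b ->
  (forall x, a < x < b -> is_derive f x (df x)) ->
  (forall x, a <= x <= b -> continuity_pt f x) ->
  exists c, a < c < b /\ f b - f a = df c * (b - a).
Proof.
  intros Hab Hd Hc.
  assert (pr1 : forall c, a < c < b -> derivable_pt f c).
  { intros c Hcab. exists (df c). apply is_derive_Reals. now apply Hd. }
  assert (pr2 : forall c, a < c < b -> derivable_pt id c).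
  { intros c _. apply derivable_pt_id. }
  destruct (MVT f id a b pr1 pr2 Hab Hc) as [c [P E]].
  { intros c _. apply derivable_continuous_pt, derivable_pt_id. }
  exists c. split; [exact P|].
  replace (derive_pt f c (pr1 c P)) with (df c) in E.
  2:{ symmetry. apply derive_pt_eq_0. apply is_derive_Reals. now apply Hd. }
  replace (derive_pt id c (pr2 c P)) with 1 in E.
  2:{ symmetry. apply derive_pt_eq_0. apply derivable_pt_lim_id. }
  unfold id in E. lra.
Qed.

Lemma derive_nonneg_le (f df : R -> R) (a b : R) :
  a <= b ->
  (forall x, a < x < b -> is_derive f x (df x)) ->
  (forall x, a <= x <= b -> continuity_pt f x) ->
  (forall x, a < x < b -> 0 <= df x) ->
  f a <= f b.
Proof.
  intros [Hab | <-] Hd Hc Hpos; [|lra].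
  destruct (MVT_open f df a b Hab Hd Hc) as [c [Hcab E]].
  specialize (Hpos c Hcab). nra.
Qed.

(** Barrier principle: the last zero before a positive value would contradict
    the mean value theorem, because [f] cannot grow while it is positive. *)
Lemma nonpos_barrier (f df : R -> R) (a b : R) :
  (forall x, a < x < b -> is_derive f x (df x)) ->
  (forall x, a <= x <= b -> continuity_pt f x) ->
  (forall x, a < x < b -> 0 < f x -> df x <= 0) ->
  f a <= 0 ->
  forall x, a <= x <= b -> f x <= 0.
Proof.
  intros Hd Hc Hneg Ha x Hx.
  destruct (Rle_lt_dec (f x) 0) as [|Hfx]; [assumption|exfalso].
  set (E := fun r => a <= r <= x /\ f r <= 0).
  destruct (completeness E) as [s [Hub Hlub]].
  - exists x. intros r [Hr _]. lra.
  - exists a. unfold E. lra.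
  - assert (Has : a <= s) by (apply Hub; unfold E; lra).
    assert (Hsx : s <= x) by (apply Hlub; intros r [Hr _]; lra).
    assert (Hfs : f s <= 0).
    { destruct (Rle_lt_dec (f s) 0) as [|Hfs]; [assumption|exfalso].
      destruct (continuity_pt_near f s (f s) (Hc s ltac:(lra)) Hfs) as [d [Hd0 Hd1]].
      apply (Rlt_irrefl s). apply Rle_lt_trans with (s - d); [|lra].
      apply Hlub. intros r Hr.
      destruct (Rle_lt_dec r (s - d)) as [|Hrd]; [assumption|exfalso].
      assert (r <= s) by now apply Hub.
      specialize (Hd1 r ltac:(lra)). destruct Hr. lra. }
    assert (Hlt : s < x).
    { destruct Hsx as [H | H]; [exact H|subst; lra]. }
    destruct (MVT_open f df s x Hlt) as [c [Hc1 Hc2]].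
    + intros; apply Hd; lra.
    + intros; apply Hc; lra.
    + assert (0 < f c).
      { destruct (Rle_lt_dec (f c) 0) as [Hle|]; [|assumption].
        assert (c <= s) by (apply Hub; unfold E; lra). lra. }
      assert (df c <= 0) by (apply Hneg; lra). nra.
Qed.

Lemma is_derive_eq (f : R -> R) (x l l' : R) :
  is_derive f x l -> l = l' -> is_derive f x l'.
Proof. now intros H <-. Qed.

Lemma is_derive_Rplus (f g : R -> R) x lf lg :
  is_derive f x lf -> is_derive g x lg ->
  is_derive (fun y => f y + g y) x (lf + lg).
Proof. exact (is_derive_plus f g x lf lg). Qed.

Lemma is_derive_Ropp (f : R -> R) x l :
  is_derive f x l -> is_derive (fun y => - f y) x (- l).
Proof. exact (is_derive_opp f x l). Qed.

Lemma is_derive_Rminus (f g : R -> R) x lf lg :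
  is_derive f x lf -> is_derive g x lg ->
  is_derive (fun y => f y - g y) x (lf - lg).
Proof. exact (is_derive_minus f g x lf lg). Qed.

Lemma is_derive_Rmult (f g : R -> R) x lf lg :
  is_derive f x lf -> is_derive g x lg ->
  is_derive (fun y => f y * g y) x (lf * g x + f x * lg).
Proof. intros. apply (is_derive_mult f g); auto. intros; apply Rmult_comm. Qed.

Lemma is_derive_Rconst (c x : R) : is_derive (fun _ : R => c) x 0.
Proof. exact (is_derive_const c x). Qed.

Lemma gronwall_le (f df : R -> R) (K a b : R) :
  a <= b ->
  (forall x, a < x < b -> is_derive f x (df x)) ->
  (forall x, a <= x <= b -> continuity_pt f x) ->
  (forall x, a < x < b -> df x <= K * f x) ->
  f b <= f a * exp (K * (b - a)).
Proof.
  intros Hab Hd Hc Hle.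
  assert (He : forall x, is_derive (fun t => exp (- K * (t - a))) x
                           (- K * exp (- K * (x - a)))).
  { intros x. auto_derive; [exact I|]. unfold Rminus. ring. }
  assert (H := derive_nonneg_le (fun t => - (f t * exp (- K * (t - a))))
     (fun x => - (df x * exp (- K * (x - a)) + f x * (- K * exp (- K * (x - a))))) a b Hab).
  assert (H1 : f b * exp (- K * (b - a)) <= f a * exp (- K * (a - a))).
  { enough (- (f a * exp (- K * (a - a))) <= - (f b * exp (- K * (b - a)))) by lra.
    apply H.
    - intros x Hx.
      exact (is_derive_Ropp _ _ _ (is_derive_Rmult f _ x _ _ (Hd x Hx) (He x))).
    - intros x Hx. apply continuity_pt_opp, continuity_pt_mult; [now apply Hc|].
      eapply is_derive_continuity_pt, He.
    - intros x Hx. specialize (Hle x Hx). pose proof (exp_pos (- K * (x - a))). nra. }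
  replace (- K * (a - a)) with 0 in H1 by ring. rewrite exp_0, Rmult_1_r in H1.
  apply Rmult_le_compat_r with (r := exp (K * (b - a))) in H1;
    [|left; apply exp_pos].
  rewrite Rmult_assoc, <- exp_plus in H1.
  replace (- K * (b - a) + K * (b - a)) with 0 in H1 by ring.
  rewrite exp_0, Rmult_1_r in H1. exact H1.
Qed.

Lemma gronwall_ge (f df : R -> R) (K a b : R) :
  a <= b ->
  (forall x, a < x < b -> is_derive f x (df x)) ->
  (forall x, a <= x <= b -> continuity_pt f x) ->
  (forall x, a < x < b -> - K * f x <= df x) ->
  f a <= f b * exp (K * (b - a)).
Proof.
  intros Hab Hd Hc Hle.
  assert (H1 : - f b <= - f a * exp (- K * (b - a))).
  { apply (gronwall_le (fun x => - f x) (fun x => - df x)); auto.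
    - intros x Hx. apply is_derive_Ropp. now apply Hd.
    - intros x Hx. apply continuity_pt_opp. now apply Hc.
    - intros x Hx. specialize (Hle x Hx). lra. }
  apply Rmult_le_compat_r with (r := exp (K * (b - a))) in H1;
    [|left; apply exp_pos].
  rewrite Rmult_assoc, <- exp_plus in H1.
  replace (- K * (b - a) + K * (b - a)) with 0 in H1 by ring.
  rewrite exp_0 in H1. lra.
Qed.

(** * Complex-valued functions of a real variable *)

(** The derivative of [f : R -> C] in coordinates: in this form the product
    rule and the derivative of [|f|^2] reduce to real calculus. *)
Definition is_Cderive (f : R -> C) (t : R) (l : C) : Prop :=
  is_derive (fun s => Re (f s)) t (Re l) /\ is_derive (fun s => Im (f s)) t (Im l).

Lemma is_Cderive_eq f t l l' : is_Cderive f t l -> l = l' -> is_Cderive f t l'.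
Proof. now intros H <-. Qed.

Lemma is_Cderive_ext_loc f g t l :
  locally t (fun s => f s = g s) -> is_Cderive f t l -> is_Cderive g t l.
Proof.
  intros Hl [H1 H2]; split.
  - eapply is_derive_ext_loc; [|exact H1].
    eapply filter_imp; [|exact Hl]. simpl; intros s ->; reflexivity.
  - eapply is_derive_ext_loc; [|exact H2].
    eapply filter_imp; [|exact Hl]. simpl; intros s ->; reflexivity.
Qed.

Lemma is_Cderive_plus f g t lf lg :
  is_Cderive f t lf -> is_Cderive g t lg ->
  is_Cderive (fun s => f s + g s)%C t (lf + lg)%C.
Proof. intros [A B] [C D]. split; now apply is_derive_Rplus. Qed.

Lemma is_Cderive_minus f g t lf lg :
  is_Cderive f t lf -> is_Cderive g t lg ->
  is_Cderive (fun s => f s - g s)%C t (lf - lg)%C.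
Proof. intros [A B] [C D]. split; now apply is_derive_Rminus. Qed.

Lemma is_Cderive_const c t : is_Cderive (fun _ => c) t 0%C.
Proof. split; apply is_derive_Rconst. Qed.

Lemma is_Cderive_RtoC (f : R -> R) (t l : R) :
  is_derive f t l -> is_Cderive (fun s => RtoC (f s)) t (RtoC l).
Proof. intros H. split; [exact H|exact (is_derive_Rconst 0 t)]. Qed.

Lemma is_Cderive_mult f g t lf lg :
  is_Cderive f t lf -> is_Cderive g t lg ->
  is_Cderive (fun s => f s * g s)%C t (lf * g t + f t * lg)%C.
Proof.
  intros [A B] [C D]. split.
  - eapply is_derive_eq.
    + apply (is_derive_Rminus (fun s => Re (f s) * Re (g s)) (fun s => Im (f s) * Im (g s)));
        apply is_derive_Rmult; eassumption.
    + unfold Re, Im; simpl. ring.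
  - eapply is_derive_eq.
    + apply (is_derive_Rplus (fun s => Re (f s) * Im (g s)) (fun s => Im (f s) * Re (g s)));
        apply is_derive_Rmult; eassumption.
    + unfold Re, Im; simpl. ring.
Qed.

Lemma Cmod_sq z : Cmod z ^ 2 = Re z ^ 2 + Im z ^ 2.
Proof. unfold Cmod. rewrite pow2_sqrt; [reflexivity|]. unfold Re, Im. nra. Qed.

Lemma Cmod_sq_derive f t l :
  is_Cderive f t l ->
  is_derive (fun s => Cmod (f s) ^ 2) t (2 * Re (Cconj (f t) * l)).
Proof.
  intros [A B].
  apply (is_derive_ext (fun s => Re (f s) * Re (f s) + Im (f s) * Im (f s))).
  { intros s. rewrite Cmod_sq. simpl. ring. }
  eapply is_derive_eq.
  - apply is_derive_Rplus; apply is_derive_Rmult; eassumption.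
  - unfold Re, Im; simpl. ring.
Qed.

Lemma Re_le_Cmod z : Rabs (Re z) <= Cmod z.
Proof.
  unfold Cmod. apply Rsqr_incr_0_var; [|apply sqrt_pos].
  rewrite Rsqr_sqrt; [|unfold Re, Im; nra]. rewrite <- Rsqr_abs.
  unfold Rsqr, Re. nra.
Qed.

Lemma Im_le_Cmod z : Rabs (Im z) <= Cmod z.
Proof.
  unfold Cmod. apply Rsqr_incr_0_var; [|apply sqrt_pos].
  rewrite Rsqr_sqrt; [|unfold Re, Im; nra]. rewrite <- Rsqr_abs.
  unfold Rsqr, Im. nra.
Qed.

Lemma Cmod_le_of_sq z w : Cmod z ^ 2 <= Cmod w ^ 2 -> Cmod z <= Cmod w.
Proof.
  intros H. apply Rsqr_incr_0_var; [|apply Cmod_ge_0]. unfold Rsqr. simpl in H. lra.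
Qed.

Lemma C_eq_of_Cmod_le_0 (z w : C) : Cmod (z - w) <= 0 -> z = w.
Proof.
  intros H. pose proof (Cmod_ge_0 (z - w)).
  assert (E : (z - w)%C = 0%C) by (apply Cmod_eq_0; lra).
  replace z with ((z - w) + w)%C by ring. rewrite E. ring.
Qed.

(** Gronwall for [|f|^2]; the second bound, backwards in time, gives uniqueness from
    a final value. *)
Lemma Cderive_gronwall (f l : R -> C) (K a b : R) :
  a <= b ->
  (forall t, a <= t <= b -> is_Cderive f t (l t)) ->
  (forall t, a <= t <= b -> Cmod (l t) <= K * Cmod (f t)) ->
  Cmod (f b) <= exp (K * (b - a)) * Cmod (f a) /\
  Cmod (f a) <= exp (K * (b - a)) * Cmod (f b).
Proof.
  intros Hab Hf Hl.
  set (E := exp (K * (b - a))). assert (E0 : 0 < E) by apply exp_pos.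
  assert (HE : exp (2 * K * (b - a)) = E ^ 2).
  { replace (E ^ 2) with (E * E) by ring. unfold E. rewrite <- exp_plus. f_equal. ring. }
  assert (Hb : forall t, a <= t <= b -> Rabs (2 * Re (Cconj (f t) * l t)) <= 2 * K * Cmod (f t) ^ 2).
  { intros t Ht. rewrite Rabs_mult, (Rabs_pos_eq 2) by lra.
    pose proof (Re_le_Cmod (Cconj (f t) * l t)) as H. rewrite Cmod_mult, Cmod_conj in H.
    specialize (Hl t Ht). pose proof (Cmod_ge_0 (f t)). nra. }
  assert (Hsq : forall x y, 0 <= x -> 0 <= y -> x ^ 2 <= y ^ 2 * E ^ 2 -> x <= E * y).
  { intros x y Hx Hy H. apply Rsqr_incr_0_var; [|nra]. unfold Rsqr. nra. }
  assert (Hd : forall t, a <= t <= b ->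
     is_derive (fun s => Cmod (f s) ^ 2) t (2 * Re (Cconj (f t) * l t))).
  { intros t Ht. now apply Cmod_sq_derive, Hf. }
  split; apply Hsq; try apply Cmod_ge_0; rewrite <- HE.
  - apply (gronwall_le (fun t => Cmod (f t) ^ 2) (fun t => 2 * Re (Cconj (f t) * l t))); [exact Hab| | |].
    + intros t Ht. apply Hd. lra.
    + intros t Ht. eapply is_derive_continuity_pt, Hd, Ht.
    + intros t Ht. specialize (Hb t ltac:(lra)). apply Rabs_le_between in Hb. lra.
  - apply (gronwall_ge (fun t => Cmod (f t) ^ 2) (fun t => 2 * Re (Cconj (f t) * l t))); [exact Hab| | |].
    + intros t Ht. apply Hd. lra.
    + intros t Ht. eapply is_derive_continuity_pt, Hd, Ht.
    + intros t Ht. specialize (Hb t ltac:(lra)). apply Rabs_le_between in Hb. lra.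
Qed.

Lemma Cmod_le_Re_Im z : Cmod z <= Rabs (Re z) + Rabs (Im z).
Proof.
  unfold Cmod. apply Rsqr_incr_0_var.
  - rewrite Rsqr_sqrt; [|unfold Re, Im; nra].
    unfold Rsqr, Re, Im.
    rewrite <- (pow2_abs (fst z)), <- (pow2_abs (snd z)).
    pose proof (Rabs_pos (fst z)). pose proof (Rabs_pos (snd z)). nra.
  - pose proof (Rabs_pos (Re z)). pose proof (Rabs_pos (Im z)). lra.
Qed.

Lemma C_eq z w : Re z = Re w -> Im z = Im w -> z = w.
Proof. destruct z, w; simpl. congruence. Qed.

Lemma is_Cderive_continuity_Re f t l : is_Cderive f t l -> continuity_pt (fun s => Re (f s)) t.
Proof. intros [A _]. eapply is_derive_continuity_pt, A. Qed.
Lemma is_Cderive_continuity_Im f t l : is_Cderive f t l -> continuity_pt (fun s => Im (f s)) t.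
Proof. intros [_ A]. eapply is_derive_continuity_pt, A. Qed.

Lemma is_Cderive_Cmod_continuity f t l :
  is_Cderive f t l -> continuity_pt (fun s => Cmod (f s)) t.
Proof.
  intros H. unfold Cmod.
  apply (continuity_pt_comp (fun s => fst (f s) ^ 2 + snd (f s) ^ 2) sqrt).
  - eapply is_derive_continuity_pt.
    eapply is_derive_ext; [|apply (Cmod_sq_derive _ _ _ H)].
    intros; apply Cmod_sq.
  - apply continuity_pt_sqrt. nra.
Qed.


Lemma norm_C_R (z : C) : norm (z : C_R_NormedModule) = Cmod z.
Proof.
  change (sqrt (Rabs (fst z) ^ 2 + Rabs (snd z) ^ 2) = Cmod z).
  now rewrite !pow2_abs.
Qed.

(** Since [t] belongs to [D], it lies in every set of the filter. *)
Lemma within_filter_lim (D : R -> Prop) (t x : R) : D t ->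
  is_filter_lim (within D (locally t)) x -> x = t.
Proof.
  intros Dt Hx. destruct (Req_dec x t) as [|Hne]; [assumption|exfalso].
  assert (Hp : 0 < Rabs (t - x)) by (apply Rabs_pos_lt; lra).
  destruct (Hx (fun y => Rabs (y - x) < Rabs (t - x))) as [d Hd].
  - exists (mkposreal _ Hp). intros y Hy. exact Hy.
  - apply (Rlt_irrefl (Rabs (t - x))). apply Hd; [apply ball_center|exact Dt].
Qed.

Lemma is_Cderive_within (D : R -> Prop) f t l :
  D t -> is_Cderive f t l -> is_derive_within D f t l.
Proof.
  intros Dt [[_ H1] [_ H2]]. split.
  - apply (is_linear_scal_l (K := R_AbsRing) (V := C_R_NormedModule)).
  - intros x Hx.
    apply within_filter_lim in Hx; [|exact Dt]. subst x. intros eps.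
    assert (Ht : is_filter_lim (locally t) t) by (intros P HP; exact HP).
    specialize (H1 t Ht (pos_div_2 eps)). specialize (H2 t Ht (pos_div_2 eps)).
    unfold within. generalize (filter_and _ _ H1 H2). apply filter_imp.
    intros s [A1 A2] _.
    assert (Hn : norm (minus (minus (f s) (f t)) (scal (minus s t) l) : C_R_NormedModule)
       <= norm (minus (minus (Re (f s)) (Re (f t))) (scal (minus s t) (Re l)) : R_NormedModule)
        + norm (minus (minus (Im (f s)) (Im (f t))) (scal (minus s t) (Im l)) : R_NormedModule)).
    { rewrite norm_C_R. apply Cmod_le_Re_Im. }
    eapply Rle_trans; [exact Hn|].
    simpl in A1, A2 |- *.
    replace (pos eps) with (eps / 2 + eps / 2) by field. rewrite Rmult_plus_distr_r.
    apply Rplus_le_compat; assumption.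
Qed.

(** * Picard iteration *)

Definition Ccontinuous (f : R -> C) : Prop :=
  (forall t, continuity_pt (fun s => Re (f s)) t) /\
  (forall t, continuity_pt (fun s => Im (f s)) t).

Definition CInt (f : R -> C) (a b : R) : C :=
  (RInt (fun s => Re (f s)) a b, RInt (fun s => Im (f s)) a b).

Lemma continuity_pt_continuous (f : R -> R) t : continuity_pt f t -> continuous f t.
Proof. intros H. now apply continuity_pt_filterlim. Qed.

Lemma ex_RInt_continuity (f : R -> R) a b :
  (forall t, continuity_pt f t) -> ex_RInt f a b.
Proof.
  intros H. apply (ex_RInt_continuous (V := R_CompleteNormedModule)).
  intros z _. now apply continuity_pt_continuous.
Qed.

Lemma is_derive_RInt_continuity (f : R -> R) a t :
  (forall s, continuity_pt f s) -> is_derive (fun x => RInt f a x) t (f t).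
Proof.
  intros H. apply (is_derive_RInt (V := R_NormedModule) f _ a).
  - apply filter_forall. intros x.
    apply (RInt_correct (V := R_CompleteNormedModule)). now apply ex_RInt_continuity.
  - now apply continuity_pt_continuous.
Qed.

Lemma CInt_derive f a t : Ccontinuous f -> is_Cderive (fun x => CInt f a x) t (f t).
Proof. intros [H1 H2]. split; simpl; now apply is_derive_RInt_continuity. Qed.

Lemma CInt_minus f g a b :
  Ccontinuous f -> Ccontinuous g ->
  (CInt f a b - CInt g a b)%C = CInt (fun s => f s - g s)%C a b.
Proof.
  intros [F1 F2] [G1 G2]. apply C_eq; unfold CInt; simpl; symmetry.
  - apply (RInt_minus (V := R_CompleteNormedModule)
             (fun s => Re (f s)) (fun s => Re (g s))); now apply ex_RInt_continuity.
  - apply (RInt_minus (V := R_CompleteNormedModule)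
             (fun s => Im (f s)) (fun s => Im (g s))); now apply ex_RInt_continuity.
Qed.

Lemma Ccontinuous_minus f g :
  Ccontinuous f -> Ccontinuous g -> Ccontinuous (fun s => f s - g s)%C.
Proof.
  intros [F1 F2] [G1 G2]. split; intros t.
  - apply (continuity_pt_minus (fun s => Re (f s)) (fun s => Re (g s))); auto.
  - apply (continuity_pt_minus (fun s => Im (f s)) (fun s => Im (g s))); auto.
Qed.

(** Integration gains a factor [1 / K] in the norm with weight [exp (K |t - a|)]. *)
Lemma RInt_exp_weight (f : R -> R) (K A a b : R) :
  0 < K -> (forall t, continuity_pt f t) ->
  (forall t, Rabs (f t) <= A * exp (K * Rabs (t - a))) ->
  Rabs (RInt f a b) <= A / K * exp (K * Rabs (b - a)).
Proof.
  intros HK Hc Hb.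
  assert (HA : 0 <= A).
  { specialize (Hb a). pose proof (Rabs_pos (f a)).
    pose proof (exp_pos (K * Rabs (a - a))). nra. }
  assert (HAK : 0 <= A / K) by (apply Rmult_le_pos; [lra|left; now apply Rinv_0_lt_compat]).
  destruct (Rle_lt_dec a b) as [Hab | Hab].
  - eapply Rle_trans.
    + apply (norm_RInt_le (V := R_NormedModule) f (fun t => A * exp (K * (t - a))) a b
              (RInt f a b) (A / K * exp (K * (b - a)) - A / K * exp (K * (a - a)))); [exact Hab| | |].
      * intros x Hx. specialize (Hb x). rewrite (Rabs_pos_eq (x - a)) in Hb by lra. exact Hb.
      * apply (RInt_correct (V := R_CompleteNormedModule)). now apply ex_RInt_continuity.
      * apply (is_RInt_derive (V := R_CompleteNormedModule) (fun t => A / K * exp (K * (t - a)))).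
        -- intros x _. auto_derive; [exact I|]. unfold Rminus. field. lra.
        -- intros x _. apply continuity_pt_continuous.
           apply derivable_continuous_pt. reg.
    + rewrite (Rabs_pos_eq (b - a)) by lra.
      pose proof (exp_pos (K * (a - a))). nra.
  - rewrite <- (opp_RInt_swap (V := R_CompleteNormedModule)); [|now apply ex_RInt_continuity].
    change (Rabs (- RInt f b a) <= A / K * exp (K * Rabs (b - a))). rewrite Rabs_Ropp.
    eapply Rle_trans.
    + apply (norm_RInt_le (V := R_NormedModule) f (fun t => A * exp (K * (a - t))) b a
              (RInt f b a) (- (A / K) * exp (K * (a - a)) - (- (A / K) * exp (K * (a - b))))); [lra| | |].
      * intros x Hx. specialize (Hb x). rewrite (Rabs_left1 (x - a)) in Hb by lra.
        replace (a - x) with (- (x - a)) by ring. exact Hb.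
      * apply (RInt_correct (V := R_CompleteNormedModule)). now apply ex_RInt_continuity.
      * apply (is_RInt_derive (V := R_CompleteNormedModule) (fun t => - (A / K) * exp (K * (a - t)))).
        -- intros x _. auto_derive; [exact I|]. unfold Rminus. field. lra.
        -- intros x _. apply continuity_pt_continuous.
           apply derivable_continuous_pt. reg.
    + rewrite (Rabs_left1 (b - a)) by lra. replace (- (b - a)) with (a - b) by ring.
      pose proof (exp_pos (K * (a - a))). nra.
Qed.

Lemma CInt_exp_weight (f : R -> C) (K A a b : R) :
  0 < K -> Ccontinuous f ->
  (forall t, Cmod (f t) <= A * exp (K * Rabs (t - a))) ->
  Cmod (CInt f a b) <= 2 * (A / K * exp (K * Rabs (b - a))).
Proof.
  intros HK [H1 H2] Hb.
  eapply Rle_trans; [apply Cmod_le_Re_Im|].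
  enough (Rabs (Re (CInt f a b)) <= A / K * exp (K * Rabs (b - a)) /\
          Rabs (Im (CInt f a b)) <= A / K * exp (K * Rabs (b - a))) by lra.
  split; apply RInt_exp_weight; auto; intros t.
  - eapply Rle_trans; [apply Re_le_Cmod|apply Hb].
  - eapply Rle_trans; [apply Im_le_Cmod|apply Hb].
Qed.

(** Limits are taken along geometric sequences throughout; this is how a bound
    passes to the limit. *)
Lemma le_of_geometric_error (a b c : R) :
  (forall n : nat, a <= b + c * (1 / 2) ^ n) -> a <= b.
Proof.
  intros H.
  assert (L : is_lim_seq (fun n => b + c * (1 / 2) ^ n) (Finite (b + c * 0))).
  { apply is_lim_seq_plus'; [apply is_lim_seq_const|].
    apply (is_lim_seq_scal_l _ c (Finite 0)). apply is_lim_seq_geom.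
    rewrite Rabs_pos_eq; lra. }
  replace (b + c * 0) with b in L by ring.
  exact (is_lim_seq_le (fun _ => a) _ (Finite a) (Finite b) H (is_lim_seq_const a) L).
Qed.

Lemma Cmod_sub_comm (z w : C) : Cmod (z - w) = Cmod (w - z).
Proof. rewrite <- Cmod_opp. f_equal. ring. Qed.

Lemma Cmod_sub_triangle (x y z : C) : Cmod (x - z) <= Cmod (x - y) + Cmod (y - z).
Proof.
  replace (x - z)%C with ((x - y) + (y - z))%C by ring. apply Cmod_triangle.
Qed.

Lemma geometric_Cauchy_limit (y : nat -> C) (A : R) :
  (forall n, Cmod (y (S n) - y n) <= A * (1 / 2) ^ n) ->
  exists l : C, forall n, Cmod (l - y n) <= 4 * A * (1 / 2) ^ n.
Proof.
  intros H.
  assert (Hp : forall n, 0 < (1 / 2) ^ n) by (intros; apply pow_lt; lra).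
  assert (HA : 0 <= A).
  { specialize (H O). pose proof (Cmod_ge_0 (y 1%nat - y 0%nat)). simpl in H. lra. }
  assert (Hk : forall n k, Cmod (y (n + k)%nat - y n) <= 2 * A * ((1 / 2) ^ n - (1 / 2) ^ (n + k))).
  { intros n; induction k.
    - rewrite Nat.add_0_r. replace (y n - y n)%C with (RtoC 0) by ring.
      rewrite Cmod_0. lra.
    - rewrite Nat.add_succ_r. eapply Rle_trans; [apply Cmod_sub_triangle with (y := y (n + k)%nat)|].
      specialize (H (n + k)%nat). simpl. lra. }
  assert (Hm : forall n m, (n <= m)%nat -> Cmod (y m - y n) <= 2 * A * (1 / 2) ^ n).
  { intros n m Hnm. replace m with (n + (m - n))%nat by lia.
    eapply Rle_trans; [apply Hk|]. specialize (Hp (n + (m - n))%nat). nra. }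
  assert (Hlim : forall p : C -> R, (forall z w, Rabs (p z - p w) <= Cmod (z - w)) ->
     exists l, forall n, Rabs (l - p (y n)) <= 2 * A * (1 / 2) ^ n).
  { intros p Lp.
    destruct (proj2 (ex_lim_seq_cauchy_corr (fun n => p (y n)))) as [l Hl].
    - intros eps.
      assert (L : is_lim_seq (fun n => 2 * A * (1 / 2) ^ n) (Finite 0)).
      { replace (Finite 0) with (Rbar_mult (2 * A) (Finite 0)) by (simpl; f_equal; ring).
        apply is_lim_seq_scal_l. apply is_lim_seq_geom. rewrite Rabs_pos_eq; lra. }
      apply is_lim_seq_spec in L.
      destruct (L (pos_div_2 eps)) as [N HN]. exists N. intros n m Hn Hm'.
      specialize (HN N (Nat.le_refl N)). rewrite Rminus_0_r in HN.
      apply Rabs_def2 in HN. simpl in HN.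
      replace (p (y n) - p (y m)) with ((p (y n) - p (y N)) - (p (y m) - p (y N))) by ring.
      eapply Rle_lt_trans; [apply Rabs_triang|]. rewrite Rabs_Ropp.
      pose proof (Lp (y n) (y N)). pose proof (Lp (y m) (y N)).
      pose proof (Hm N n Hn). pose proof (Hm N m Hm'). lra.
    - exists l. intros n.
      assert (L2 : is_lim_seq (fun m => Rabs (p (y m) - p (y n))) (Finite (Rabs (l - p (y n))))).
      { apply (is_lim_seq_abs _ (Finite (l - p (y n)))).
        apply is_lim_seq_minus'; [exact Hl|apply is_lim_seq_const]. }
      apply (is_lim_seq_le_loc (fun m => Rabs (p (y m) - p (y n))) (fun _ => 2 * A * (1 / 2) ^ n)
         (Finite (Rabs (l - p (y n)))) (Finite (2 * A * (1 / 2) ^ n))).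
      + exists n. intros m Hnm. eapply Rle_trans; [apply Lp|now apply Hm].
      + exact L2.
      + apply is_lim_seq_const. }
  destruct (Hlim Re) as [l1 H1].
  { intros z w. exact (Re_le_Cmod (z - w)). }
  destruct (Hlim Im) as [l2 H2].
  { intros z w. exact (Im_le_Cmod (z - w)). }
  exists (l1, l2). intros n. eapply Rle_trans; [apply Cmod_le_Re_Im|].
  specialize (H1 n). specialize (H2 n). unfold Re, Im in *. simpl.
  unfold Rminus in H1, H2. lra.
Qed.

Lemma function_of_relation {A B : Type} (R : A -> B -> Prop) :
  (forall x, exists y, R x y) -> exists f : A -> B, forall x, R x (f x).
Proof.
  intros H.
  exists (fun x => proj1_sig (constructive_indefinite_description _ (H x))).
  intros x. apply proj2_sig.
Qed.

Lemma Lipschitz_Ccontinuous (u : R -> C) (B : R) :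
  (forall s t, Cmod (u s - u t) <= B * Rabs (s - t)) -> Ccontinuous u.
Proof.
  intros H.
  assert (G : forall p : C -> R, (forall z w, Rabs (p z - p w) <= Cmod (z - w)) ->
     forall t, continuity_pt (fun s => p (u s)) t).
  { intros p Lp t eps Heps.
    assert (HB : 0 <= B).
    { specialize (H 1 0). pose proof (Cmod_ge_0 (u 1 - u 0)).
      rewrite (Rabs_pos_eq (1 - 0)) in H by lra. lra. }
    exists (eps / (B + 1)). split; [apply Rdiv_lt_0_compat; lra|].
    intros x [_ Hx]. simpl in *. unfold R_dist in *.
    eapply Rle_lt_trans; [apply Lp|]. eapply Rle_lt_trans; [apply H|].
    apply Rle_lt_trans with ((B + 1) * Rabs (x - t)); [pose proof (Rabs_pos (x - t)); lra|].
    apply Rlt_le_trans with ((B + 1) * (eps / (B + 1))); [|right; field; lra].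
    apply Rmult_lt_compat_l; lra. }
  split; intros t; apply G; intros z w.
  - exact (Re_le_Cmod (z - w)).
  - exact (Im_le_Cmod (z - w)).
Qed.

Section Picard.

Context (F : R -> C -> C) (B L : R).
Context (HL : 0 < L).
Context (Fbound : forall t v, Cmod (F t v) <= B).
Context (Flip : forall t v w, Cmod (F t v - F t w) <= L * Cmod (v - w)).
Context (Fcont : forall u, Ccontinuous u -> Ccontinuous (fun t => F t (u t))).
Context (t0 : R) (v0 : C).

Fixpoint picard_iterate (n : nat) : R -> C :=
  match n with
  | O => fun _ => v0
  | S n => fun t => (v0 + CInt (fun s => F s (picard_iterate n s)) t0 t)%C
  end.

Lemma CInt_plus_continuous u : Ccontinuous u -> Ccontinuous (fun t => v0 + CInt u t0 t)%C.
Proof.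
  intros Hu.
  assert (H : forall t, is_Cderive (fun t => v0 + CInt u t0 t)%C t (u t)).
  { intros t. eapply is_Cderive_eq.
    - apply is_Cderive_plus; [apply is_Cderive_const|now apply CInt_derive].
    - ring. }
  split; intros t.
  - eapply is_Cderive_continuity_Re, H.
  - eapply is_Cderive_continuity_Im, H.
Qed.

Lemma picard_iterate_continuous n : Ccontinuous (picard_iterate n).
Proof.
  induction n; simpl.
  - split; intros t; apply continuity_pt_cst.
  - apply CInt_plus_continuous. now apply Fcont.
Qed.

(** Each Picard step halves the distance measured with weight
    [exp (-4 L |t - t0|)], so the iterates converge on the whole line. *)
Lemma picard_iterate_step n t :
  Cmod (picard_iterate (S n) t - picard_iterate n t)
    <= B / L * exp (4 * L * Rabs (t - t0)) * (1 / 2) ^ n.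
Proof.
  assert (HB : 0 <= B) by (eapply Rle_trans; [apply Cmod_ge_0|apply (Fbound t0 v0)]).
  assert (HBL : 0 <= B / L) by (apply Rmult_le_pos; [lra|left; now apply Rinv_0_lt_compat]).
  revert t. induction n; intros t.
  - simpl. replace (v0 + CInt (fun s => F s v0) t0 t - v0)%C with (CInt (fun s => F s v0) t0 t) by ring.
    eapply Rle_trans.
    + apply (CInt_exp_weight _ (4 * L) B); [lra|exact (Fcont _ (picard_iterate_continuous 0))|].
      intros s. eapply Rle_trans; [apply Fbound|].
      pose proof (exp_ineq1_le (4 * L * Rabs (s - t0))).
      assert (0 <= L * Rabs (s - t0)) by (apply Rmult_le_pos; [lra|apply Rabs_pos]).
      assert (1 <= exp (4 * L * Rabs (s - t0))) by lra. nra.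
    + pose proof (exp_pos (4 * L * Rabs (t - t0))).
      replace (2 * (B / (4 * L) * exp (4 * L * Rabs (t - t0)))) with
        (1 / 2 * (B / L * exp (4 * L * Rabs (t - t0)))) by (field; lra).
      assert (0 <= B / L * exp (4 * L * Rabs (t - t0))) by nra. lra.
  - change (Cmod ((v0 + CInt (fun s => F s (picard_iterate (S n) s)) t0 t)
       - (v0 + CInt (fun s => F s (picard_iterate n s)) t0 t))
       <= B / L * exp (4 * L * Rabs (t - t0)) * (1 / 2) ^ S n).
    replace ((v0 + CInt (fun s => F s (picard_iterate (S n) s)) t0 t)
       - (v0 + CInt (fun s => F s (picard_iterate n s)) t0 t))%C
      with (CInt (fun s => F s (picard_iterate (S n) s)) t0 t - CInt (fun s => F s (picard_iterate n s)) t0 t)%C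
      by ring.
    rewrite CInt_minus; try (apply Fcont; apply picard_iterate_continuous).
    eapply Rle_trans.
    + apply (CInt_exp_weight _ (4 * L) (B * (1 / 2) ^ n)); [lra| |].
      * apply Ccontinuous_minus; apply Fcont; apply picard_iterate_continuous.
      * intros s. eapply Rle_trans; [apply Flip|].
        eapply Rle_trans; [apply Rmult_le_compat_l; [lra|apply IHn]|].
        right. field. lra.
    + simpl. right. field. lra.
Qed.

Lemma picard_iterate_Lipschitz n s t :
  Cmod (picard_iterate n s - picard_iterate n t) <= 2 * B * Rabs (s - t).
Proof.
  assert (HB : 0 <= B) by (eapply Rle_trans; [apply Cmod_ge_0|apply (Fbound t0 v0)]).
  destruct n; simpl.
  - replace (v0 - v0)%C with (RtoC 0) by ring. rewrite Cmod_0.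
    pose proof (Rabs_pos (s - t)). nra.
  - set (f := fun r => F r (picard_iterate n r)).
    assert (Hf : Ccontinuous f) by (apply Fcont, picard_iterate_continuous).
    assert (G : forall p : R -> R, (forall r, continuity_pt p r) -> (forall r, Rabs (p r) <= B) ->
       Rabs (RInt p t0 s - RInt p t0 t) <= B * Rabs (s - t)).
    { intros p Hp Hb.
      destruct (MVT_gen (fun x => RInt p t0 x) t s p) as [c [_ E]].
      - intros x _. now apply is_derive_RInt_continuity.
      - intros x _. eapply is_derive_continuity_pt. now apply is_derive_RInt_continuity.
      - rewrite E, Rabs_mult. apply Rmult_le_compat_r; [apply Rabs_pos|apply Hb]. }
    eapply Rle_trans; [apply Cmod_le_Re_Im|].
    replace (v0 + CInt f t0 s - (v0 + CInt f t0 t))%C with (CInt f t0 s - CInt f t0 t)%C by ring.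
    destruct Hf as [Hf1 Hf2].
    assert (G1 := G _ Hf1 (fun r => Rle_trans _ _ _ (Re_le_Cmod _) (Fbound _ _))).
    assert (G2 := G _ Hf2 (fun r => Rle_trans _ _ _ (Im_le_Cmod _) (Fbound _ _))).
    unfold CInt, Re, Im in *. simpl in *. unfold Rminus in *. lra.
Qed.

Lemma picard_existence :
  exists u : R -> C, u t0 = v0 /\ forall t, is_Cderive u t (F t (u t)).
Proof.
  assert (HB : 0 <= B) by (eapply Rle_trans; [apply Cmod_ge_0|apply (Fbound t0 v0)]).
  set (W := fun t => B / L * exp (4 * L * Rabs (t - t0))).
  destruct (function_of_relation (fun t l => forall n,
     Cmod (l - picard_iterate n t) <= 4 * W t * (1 / 2) ^ n)) as [u Hu].
  { intros t. apply geometric_Cauchy_limit. intros n. apply picard_iterate_step. }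
  assert (Hc : Ccontinuous u).
  { apply (Lipschitz_Ccontinuous _ (2 * B)). intros s t.
    apply (le_of_geometric_error _ _ (4 * W s + 4 * W t)). intros n.
    eapply Rle_trans; [apply Cmod_sub_triangle with (y := picard_iterate n s)|].
    eapply Rle_trans; [apply Rplus_le_compat_l, Cmod_sub_triangle with (y := picard_iterate n t)|].
    pose proof (Hu s n). pose proof (Hu t n). rewrite Cmod_sub_comm in H0.
    pose proof (picard_iterate_Lipschitz n s t). lra. }
  assert (Hfix : forall t, u t = (v0 + CInt (fun s => F s (u s)) t0 t)%C).
  { intros t.
    assert (Hz : Cmod (u t - (v0 + CInt (fun s => F s (u s)) t0 t)) <= 0).
    { apply (le_of_geometric_error _ _ (4 * W t)). intros n.
      eapply Rle_trans; [apply Cmod_sub_triangle with (y := picard_iterate (S n) t)|].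
      assert (Cmod (picard_iterate (S n) t - (v0 + CInt (fun s => F s (u s)) t0 t))
               <= 2 * W t * (1 / 2) ^ n).
      { simpl.
        replace (v0 + CInt (fun s => F s (picard_iterate n s)) t0 t - (v0 + CInt (fun s => F s (u s)) t0 t))%C
          with (CInt (fun s => F s (picard_iterate n s)) t0 t - CInt (fun s => F s (u s)) t0 t)%C by ring.
        rewrite CInt_minus; [|apply Fcont; apply picard_iterate_continuous|now apply Fcont].
        eapply Rle_trans.
        - apply (CInt_exp_weight _ (4 * L) (4 * B * (1 / 2) ^ n)); [lra| |].
          + apply Ccontinuous_minus; [apply Fcont; apply picard_iterate_continuous|now apply Fcont].
          + intros s. eapply Rle_trans; [apply Flip|]. rewrite Cmod_sub_comm.
            eapply Rle_trans; [apply Rmult_le_compat_l; [lra|apply Hu]|].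
            unfold W. right. field. lra.
        - unfold W. right. field. lra. }
      pose proof (Hu t (S n)). change ((1 / 2) ^ S n) with (1 / 2 * (1 / 2) ^ n) in H0.
      lra. }
    now apply C_eq_of_Cmod_le_0. }
  exists u. split.
  - rewrite Hfix. unfold CInt. rewrite !RInt_point.
    apply C_eq; unfold Re, Im; simpl; apply Rplus_0_r.
  - intros t. apply (is_Cderive_ext_loc (fun t => v0 + CInt (fun s => F s (u s)) t0 t)%C).
    + apply filter_forall. intros s. symmetry. apply Hfix.
    + eapply is_Cderive_eq.
      * apply is_Cderive_plus; [apply is_Cderive_const|apply CInt_derive; now apply Fcont].
      * ring.
Qed.

End Picard.

(** * The equation V' = 2 / V + eta *)

Lemma Re_Im_neq_0 w : 0 < Re w -> w <> 0%C.
Proof. intros H E. rewrite E in H. simpl in H. lra. Qed.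

Lemma Re_two_div (w : C) : w <> 0%C -> Re (2 / w)%C = 2 * Re w / (Re w ^ 2 + Im w ^ 2).
Proof.
  intros H. assert (Re w ^ 2 + Im w ^ 2 <> 0).
  { rewrite <- Cmod_sq. apply pow_nonzero. intros E. now apply H, Cmod_eq_0. }
  destruct w as [p q]. unfold Re, Im in *; simpl in *. field. intros E. apply H0. rewrite <- E. ring.
Qed.

Lemma Im_two_div (w : C) : w <> 0%C -> Im (2 / w)%C = - 2 * Im w / (Re w ^ 2 + Im w ^ 2).
Proof.
  intros H. assert (Re w ^ 2 + Im w ^ 2 <> 0).
  { rewrite <- Cmod_sq. apply pow_nonzero. intros E. now apply H, Cmod_eq_0. }
  destruct w as [p q]. unfold Re, Im in *; simpl in *. field. intros E. apply H0. rewrite <- E. ring.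
Qed.

Lemma Re_conj_mult_self (a d : C) : Re (Cconj d * (a * d))%C = Re a * Cmod d ^ 2.
Proof. rewrite Cmod_sq. destruct a, d; unfold Re, Im; simpl. ring. Qed.

Lemma Ccontinuous_comp_Lipschitz (G : C -> C) (L : R) (u : R -> C) :
  (forall v w, Cmod (G v - G w) <= L * Cmod (v - w)) ->
  Ccontinuous u -> Ccontinuous (fun t => G (u t)).
Proof.
  intros HG [U1 U2].
  assert (K : forall p : C -> R, (forall z w, Rabs (p z - p w) <= Cmod (z - w)) ->
     forall t, continuity_pt (fun s => p (G (u s))) t).
  { intros p Lp t eps Heps.
    set (A := Rabs L + 1). assert (HA : 0 < A) by (unfold A; pose proof (Rabs_pos L); lra).
    assert (Hq : 0 < eps / (2 * A)) by (apply Rdiv_lt_0_compat; lra).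
    destruct (U1 t _ Hq) as [d1 [Hd1 D1]]. destruct (U2 t _ Hq) as [d2 [Hd2 D2]].
    exists (Rmin d1 d2). split; [now apply Rmin_pos|].
    intros x [Hx1 Hx2]. simpl in *. unfold R_dist in *.
    specialize (D1 x (conj Hx1 (Rlt_le_trans _ _ _ Hx2 (Rmin_l _ _)))).
    specialize (D2 x (conj Hx1 (Rlt_le_trans _ _ _ Hx2 (Rmin_r _ _)))).
    eapply Rle_lt_trans; [apply Lp|]. eapply Rle_lt_trans; [apply HG|].
    apply Rle_lt_trans with (A * Cmod (u x - u t)).
    { apply Rmult_le_compat_r; [apply Cmod_ge_0|]. unfold A. pose proof (Rle_abs L). lra. }
    pose proof (Cmod_le_Re_Im (u x - u t)).
    apply Rlt_le_trans with (A * (2 * (eps / (2 * A)))); [|right; field; lra].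
    apply Rmult_lt_compat_l; [exact HA|]. unfold Re, Im, Cminus in *. simpl in *.
    unfold Rminus in *. lra. }
  split; apply K; intros z w.
  - exact (Re_le_Cmod (z - w)).
  - exact (Im_le_Cmod (z - w)).
Qed.

(** [2 / truncate c w] agrees with [2 / w] for [Re w >= c] and is bounded and
    Lipschitz on the whole plane. *)
Definition truncate (c : R) (w : C) : C := (Rmax (Re w) c, Im w).

Lemma truncate_id c w : c <= Re w -> truncate c w = w.
Proof. intros H. apply C_eq; unfold truncate; simpl; [now apply Rmax_left|reflexivity]. Qed.

Lemma truncate_Re c w : c <= Re (truncate c w).
Proof. apply Rmax_r. Qed.

Lemma Cmod_ge_Re w : Re w <= Cmod w.
Proof. eapply Rle_trans; [apply Rle_abs|apply Re_le_Cmod]. Qed.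

Lemma Cmod_two_div_le c (w : C) : 0 < c -> c <= Re w -> Cmod (2 / w)%C <= 2 / c.
Proof.
  intros Hc Hw. rewrite Cmod_div by (apply Re_Im_neq_0; lra).
  rewrite Cmod_R, Rabs_pos_eq by lra. apply Rmult_le_compat_l; [lra|].
  apply Rinv_le_contravar; [lra|]. eapply Rle_trans; [apply Hw|apply Cmod_ge_Re].
Qed.

Lemma two_div_sub (v w : C) : v <> 0%C -> w <> 0%C ->
  (2 / v - 2 / w = - (2) / (v * w) * (v - w))%C.
Proof. intros Hv Hw. field. now split. Qed.

Lemma Cmod_minus_two_div_le c (v w : C) : 0 < c -> c <= Re v -> c <= Re w ->
  Cmod (- (2) / (v * w))%C <= 2 / c ^ 2.
Proof.
  intros Hc Hv Hw.
  assert (v <> 0%C) by (apply Re_Im_neq_0; lra).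
  assert (w <> 0%C) by (apply Re_Im_neq_0; lra).
  rewrite Cmod_div by now apply Cmult_neq_0.
  rewrite Cmod_opp. rewrite Cmod_R. rewrite Rabs_pos_eq by lra. rewrite Cmod_mult.
  apply Rmult_le_compat_l; [lra|]. apply Rinv_le_contravar; [nra|].
  pose proof (Cmod_ge_Re v). pose proof (Cmod_ge_Re w). nra.
Qed.


Lemma Rmax_Lipschitz c x y : (Rmax x c - Rmax y c) ^ 2 <= (x - y) ^ 2.
Proof.
  unfold Rmax. destruct (Rle_dec x c) as [H|H], (Rle_dec y c) as [H'|H'];
    try apply Rnot_le_lt in H; try apply Rnot_le_lt in H'.
  - pose proof (pow2_ge_0 (x - y)). nra.
  - assert (0 <= (c - x) * ((y - c) + (y - x))) by (apply Rmult_le_pos; lra). nra.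
  - assert (0 <= (c - y) * ((x - c) + (x - y))) by (apply Rmult_le_pos; lra). nra.
  - lra.
Qed.

Lemma truncate_Lipschitz c v w : Cmod (truncate c v - truncate c w) <= Cmod (v - w).
Proof.
  apply Cmod_le_of_sq. rewrite !Cmod_sq.
  pose proof (Rmax_Lipschitz c (Re v) (Re w)).
  unfold truncate, Re, Im in *; simpl in *. unfold Rminus in *. lra.
Qed.

Lemma truncated_inverse_Lipschitz c (v w : C) : 0 < c ->
  Cmod (2 / truncate c v - 2 / truncate c w)%C <= 2 / c ^ 2 * Cmod (v - w).
Proof.
  intros Hc. pose proof (truncate_Re c v). pose proof (truncate_Re c w).
  rewrite two_div_sub by (apply Re_Im_neq_0; lra). rewrite Cmod_mult.
  apply Rmult_le_compat; try apply Cmod_ge_0.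
  - now apply Cmod_minus_two_div_le.
  - apply truncate_Lipschitz.
Qed.

Lemma exp_le_mono x y : x <= y -> exp x <= exp y.
Proof. intros [H | ->]; [left; now apply exp_increasing|lra]. Qed.

Ltac bessel_restrict H :=
  let r := fresh "r" in let Hr := fresh "Hr" in
  intros r Hr; cbv beta in Hr; apply H; cbv beta; lra.

Section Bessel.

Context (eta : R -> C) (M : R).
Context (HM : 0 < M).
Context (eta_cont : Ccontinuous eta).
Context (eta_bound : forall t, Cmod (eta t) <= M).

(** The deterministic Bessel equation with drift [eta]. *)
Definition bessel_on (D : R -> Prop) (V : R -> C) : Prop :=
  forall t, D t -> 0 < Re (V t) /\ is_Cderive V t (2 / V t + eta t)%C.

Definition imaginary_drift : Prop := forall t, Re (eta t) = 0.
Definition real_drift : Prop := forall t, Im (eta t) = 0.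

(** A start from which the solution can be continued forever: either the drift
    is imaginary, so that the real part of the solution increases, or the
    solution stays on the positive real axis, where [2 / V] is repulsive. *)
Definition admissible (v : C) : Prop :=
  0 < Re v /\ (imaginary_drift \/ (real_drift /\ Im v = 0)).

Lemma truncated_existence c t0 v0 : 0 < c ->
  exists V, V t0 = v0 /\ forall t, is_Cderive V t (2 / truncate c (V t) + eta t)%C.
Proof.
  intros Hc.
  pose proof (fun v w => truncated_inverse_Lipschitz c v w Hc) as Lip.
  apply (picard_existence (fun t v => 2 / truncate c v + eta t)%C (2 / c + M) (2 / c ^ 2)).
  - apply Rdiv_lt_0_compat; [lra|now apply pow_lt].
  - intros t v. eapply Rle_trans; [apply Cmod_triangle|].
    apply Rplus_le_compat; [|apply eta_bound].
    apply Cmod_two_div_le; [exact Hc|apply truncate_Re].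
  - intros t v w.
    replace (2 / truncate c v + eta t - (2 / truncate c w + eta t))%C
      with (2 / truncate c v - 2 / truncate c w)%C by ring.
    apply Lip.
  - intros u Hu.
    destruct (Ccontinuous_comp_Lipschitz (fun v => 2 / truncate c v)%C _ u Lip Hu) as [A1 A2].
    destruct eta_cont as [B1 B2]. split; intros t.
    + apply (continuity_pt_plus (fun s => Re (2 / truncate c (u s))%C) (fun s => Re (eta s))); auto.
    + apply (continuity_pt_plus (fun s => Im (2 / truncate c (u s))%C) (fun s => Im (eta s))); auto.
Qed.

Lemma eta_Re_bound t : Rabs (Re (eta t)) <= M.
Proof. eapply Rle_trans; [apply Re_le_Cmod|apply eta_bound]. Qed.
Lemma eta_Im_bound t : Rabs (Im (eta t)) <= M.
Proof. eapply Rle_trans; [apply Im_le_Cmod|apply eta_bound]. Qed.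

Lemma real_axis_invariant (V w : R -> C) (a b : R) :
  (forall t, a <= t <= b -> is_Cderive V t (2 / w t + eta t)%C) ->
  (forall t, a <= t <= b -> 0 < Re (w t) /\ Im (w t) = Im (V t)) ->
  real_drift -> Im (V a) = 0 -> forall t, a <= t <= b -> Im (V t) = 0.
Proof.
  intros HV Hw HB Hi t Ht.
  assert (Hsq : Im (V t) * Im (V t) <= 0).
  { apply (nonpos_barrier (fun s => Im (V s) * Im (V s))
      (fun s => Im (2 / w s + eta s)%C * Im (V s) + Im (V s) * Im (2 / w s + eta s)%C) a b); [| | | |exact Ht].
    - intros s Hs. apply is_derive_Rmult; apply (HV s); lra.
    - intros s Hs. apply continuity_pt_mult; eapply is_Cderive_continuity_Im; now apply HV.
    - intros s Hs _. destruct (Hw s) as [W E]; [lra|].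
      change (Im (2 / w s + eta s)%C) with (Im (2 / w s)%C + Im (eta s)).
      rewrite Im_two_div, HB, E by now apply Re_Im_neq_0.
      assert (Hden : 0 < Re (w s) ^ 2 + Im (V s) ^ 2) by nra.
      replace (_ + _) with (- (4 * Im (V s) ^ 2 / (Re (w s) ^ 2 + Im (V s) ^ 2))) by (field; lra).
      enough (0 <= 4 * Im (V s) ^ 2 / (Re (w s) ^ 2 + Im (V s) ^ 2)) by lra.
      apply Rmult_le_pos; [nra|left; now apply Rinv_0_lt_compat].
    - rewrite Hi. lra. }
  nra.
Qed.

(** Here [w] is either [V] or its truncation, so that the floor is available before the
    truncation is known to be inactive. For imaginary drift [Re V] increases. On the real axis,
    as long as [w <= 1 / M], the repulsion [2 / w >= 2 M] beats the drift. *)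
Lemma floor_general (V w : R -> C) (a b c : R) :
  (forall t, a <= t <= b -> is_Cderive V t (2 / w t + eta t)%C) ->
  (forall t, a <= t <= b -> 0 < Re (w t) <= Rmax (Re (V t)) c /\ Im (w t) = Im (V t)) ->
  c <= 1 / M -> admissible (V a) ->
  forall t, a <= t <= b ->
    Rmin (Re (V a)) (1 / M) <= Re (V t) /\
    admissible (V t).
Proof.
  intros HV Hw Hc [Ha Hk].
  assert (HM' : 0 < 1 / M) by (apply Rdiv_lt_0_compat; lra).
  assert (HwC : forall t, a <= t <= b -> w t <> 0%C).
  { intros t Ht. apply Re_Im_neq_0. now apply Hw. }
  assert (Hden : forall t, a <= t <= b -> 0 < Re (w t) ^ 2 + Im (w t) ^ 2).
  { intros t Ht. destruct (Hw t Ht) as [[H _] _]. nra. }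
  assert (Hk' : forall t, a <= t <= b -> imaginary_drift \/ (real_drift /\ Im (V t) = 0)).
  { intros t Ht. destruct Hk as [HA | [HB Hi]]; [now left|right]. split; [exact HB|].
    apply (real_axis_invariant V w a b); auto.
    intros s Hs. split; now apply Hw. }
  assert (Hfl : forall t, a <= t <= b -> Rmin (Re (V a)) (1 / M) <= Re (V t)).
  { intros t Ht. set (m := Rmin (Re (V a)) (1 / M)).
    assert (Hm1 : m <= Re (V a)) by apply Rmin_l. assert (Hm2 : m <= 1 / M) by apply Rmin_r.
    enough (m - Re (V t) <= 0) by lra.
    apply (nonpos_barrier (fun s => m - Re (V s)) (fun s => 0 - Re (2 / w s + eta s)%C) a b); [| | | |exact Ht].
    - intros s Hs. apply is_derive_Rminus; [apply is_derive_Rconst|apply (HV s); lra].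
    - intros s Hs. apply continuity_pt_minus; [apply continuity_pt_cst|].
      eapply is_Cderive_continuity_Re; now apply HV.
    - intros s Hs Hpos. assert (Hs' : a <= s <= b) by lra.
      change (Re (2 / w s + eta s)%C) with (Re (2 / w s)%C + Re (eta s)).
      rewrite Re_two_div by auto. specialize (Hden s Hs').
      destruct (Hw s Hs') as [[W1 W2] E].
      assert (W3 : Re (w s) <= 1 / M) by (eapply Rle_trans; [exact W2|apply Rmax_lub; lra]).
      destruct (Hk' s Hs') as [HA | [HB Hi]].
      + rewrite HA.
        enough (0 <= 2 * Re (w s) / (Re (w s) ^ 2 + Im (w s) ^ 2)) by lra.
        apply Rmult_le_pos; [lra|left; now apply Rinv_0_lt_compat].
      + rewrite E, Hi.
        replace (2 * Re (w s) / (Re (w s) ^ 2 + 0 ^ 2)) with (2 * / Re (w s)) by (field; lra).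
        assert (M <= / Re (w s)).
        { rewrite <- (Rinv_inv M). apply Rinv_le_contravar; [exact W1|]. unfold Rdiv in W3. lra. }
        pose proof (eta_Re_bound s) as Hb. apply Rabs_le_between in Hb. lra.
    - lra. }
  intros t Ht. split; [now apply Hfl|]. split; [|now apply Hk'].
  eapply Rlt_le_trans; [|apply Hfl, Ht]. now apply Rmin_pos.
Qed.

Lemma bessel_floor (V : R -> C) (a b : R) :
  bessel_on (fun t => a <= t <= b) V -> admissible (V a) ->
  forall t, a <= t <= b -> Rmin (Re (V a)) (1 / M) <= Re (V t) /\ admissible (V t).
Proof.
  intros HV Ha. apply (floor_general V V a b 0); auto.
  - intros t Ht. now apply HV.
  - intros t Ht. split; [|reflexivity]. split; [now apply HV|apply Rmax_l].
  - left. apply Rdiv_lt_0_compat; lra.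
Qed.

Lemma bessel_real (V : R -> C) (a b : R) :
  bessel_on (fun t => a <= t <= b) V -> real_drift -> Im (V a) = 0 ->
  forall t, a <= t <= b -> Im (V t) = 0.
Proof.
  intros HV. apply (real_axis_invariant V V a b).
  - intros t Ht. now apply HV.
  - intros t Ht. split; [now apply HV|reflexivity].
Qed.

(** Truncated at half its floor, a solution never notices the truncation. *)
Lemma bessel_existence (t0 : R) (v0 : C) : admissible v0 ->
  exists V, V t0 = v0 /\ bessel_on (fun t => t0 <= t) V.
Proof.
  intros Hv. assert (HM' : 0 < 1 / M) by (apply Rdiv_lt_0_compat; lra).
  set (c := Rmin (Re v0) (1 / M) / 2).
  assert (Hc : 0 < 2 * c <= 1 / M).
  { unfold c. pose proof (Rmin_r (Re v0) (1 / M)).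
    assert (0 < Rmin (Re v0) (1 / M)) by (apply Rmin_pos; [apply Hv|exact HM']). lra. }
  destruct (truncated_existence c t0 v0) as [V [V0 HV]]; [lra|].
  exists V. split; [exact V0|]. intros t Ht.
  destruct (floor_general V (fun t => truncate c (V t)) t0 t c) with (t := t) as [Hf _].
  - intros s _. apply HV.
  - intros s _. pose proof (truncate_Re c (V s)). split; [|reflexivity].
    split; [lra|]. apply Rle_refl.
  - lra.
  - now rewrite V0.
  - lra.
  - rewrite V0 in Hf. fold c in Hf. assert (c <= Re (V t)) by (unfold c in *; lra).
    split; [lra|]. eapply is_Cderive_eq; [apply HV|]. now rewrite truncate_id.
Qed.

(** Identifies solutions of the original equation with truncated ones, which exist for all times. *)
Lemma truncated_unique c (V W : R -> C) (a b : R) : 0 < c -> a <= b ->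
  (forall t, a <= t <= b -> is_Cderive V t (2 / truncate c (V t) + eta t)%C) ->
  (forall t, a <= t <= b -> is_Cderive W t (2 / truncate c (W t) + eta t)%C) ->
  V b = W b -> V a = W a.
Proof.
  intros Hc Hab HV HW E.
  destruct (Cderive_gronwall (fun t => V t - W t)%C
    (fun t => 2 / truncate c (V t) - 2 / truncate c (W t))%C (2 / c ^ 2) a b Hab) as [_ H].
  - intros t Ht. eapply is_Cderive_eq; [apply is_Cderive_minus; [now apply HV|now apply HW]|]. ring.
  - intros t Ht. now apply truncated_inverse_Lipschitz.
  - apply C_eq_of_Cmod_le_0. eapply Rle_trans; [exact H|].
    rewrite E. replace (W b - W b)%C with (RtoC 0) by ring. rewrite Cmod_0. lra.
Qed.

Lemma bessel_difference_derive (V W : R -> C) (D : R -> Prop) t :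
  bessel_on D V -> bessel_on D W -> D t ->
  is_derive (fun s => Cmod (V s - W s) ^ 2) t
    (2 * (Re (- (2) / (V t * W t))%C * Cmod (V t - W t) ^ 2)).
Proof.
  intros HV HW Ht. destruct (HV t Ht) as [V1 V2]. destruct (HW t Ht) as [W1 W2].
  eapply is_derive_eq.
  - apply Cmod_sq_derive. apply is_Cderive_minus; eassumption.
  - f_equal. rewrite <- Re_conj_mult_self. f_equal. f_equal.
    rewrite <- two_div_sub by now apply Re_Im_neq_0. ring.
Qed.

Lemma bessel_difference_continuity (V W : R -> C) (D : R -> Prop) t :
  bessel_on D V -> bessel_on D W -> D t ->
  continuity_pt (fun s => Cmod (V s - W s) ^ 2) t.
Proof.
  intros HV HW Ht. eapply is_derive_continuity_pt.
  now apply (bessel_difference_derive V W D).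
Qed.

(** In the cone [|Im| <= Re] around the positive axis the flow contracts: there
    [-2 / (V W)], the logarithmic derivative of [V - W], has nonpositive real
    part. *)
Lemma bessel_contraction (V W : R -> C) (a b : R) :
  a <= b ->
  bessel_on (fun t => a <= t <= b) V -> bessel_on (fun t => a <= t <= b) W ->
  (forall t, a <= t <= b -> Rabs (Im (V t)) <= Re (V t)) ->
  (forall t, a <= t <= b -> Rabs (Im (W t)) <= Re (W t)) ->
  Cmod (V b - W b) <= Cmod (V a - W a).
Proof.
  intros Hab HV HW CV CW. apply Cmod_le_of_sq.
  enough (- Cmod (V a - W a) ^ 2 <= - Cmod (V b - W b) ^ 2) by lra.
  apply (derive_nonneg_le (fun t => - Cmod (V t - W t) ^ 2)
    (fun t => - (2 * (Re (- (2) / (V t * W t))%C * Cmod (V t - W t) ^ 2)))); [exact Hab| | |].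
  - intros t Ht. apply is_derive_Ropp.
    apply (bessel_difference_derive V W (fun t => a <= t <= b)); auto. lra.
  - intros t Ht. apply continuity_pt_opp.
    now apply (bessel_difference_continuity V W (fun t => a <= t <= b)).
  - intros t Ht. assert (Ht' : a <= t <= b) by lra.
    assert (N : (V t * W t)%C <> 0%C).
    { apply Cmult_neq_0; apply Re_Im_neq_0; [now apply HV|now apply HW]. }
    replace (- (2) / (V t * W t))%C with (- (2 / (V t * W t)))%C by (field; split; intros E; apply N; rewrite E; ring).
    change (Re (- (2 / (V t * W t)))%C) with (- Re (2 / (V t * W t))%C).
    rewrite Re_two_div by exact N.
    assert (0 <= Re (V t * W t)%C).
    { change (0 <= Re (V t) * Re (W t) - Im (V t) * Im (W t)).
      specialize (CV t Ht'). specialize (CW t Ht').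
      apply Rabs_le_between in CV. apply Rabs_le_between in CW. nra. }
    assert (0 < Re (V t * W t)%C ^ 2 + Im (V t * W t)%C ^ 2).
    { rewrite <- Cmod_sq. apply pow_lt. now apply Cmod_gt_0. }
    assert (0 <= 2 * Re (V t * W t)%C / (Re (V t * W t)%C ^ 2 + Im (V t * W t)%C ^ 2)).
    { apply Rmult_le_pos; [lra|left; now apply Rinv_0_lt_compat]. }
    pose proof (pow2_ge_0 (Cmod (V t - W t))). nra.
Qed.

Lemma bessel_Lipschitz (V W : R -> C) (a b c : R) :
  0 < c -> a <= b ->
  bessel_on (fun t => a <= t <= b) V -> bessel_on (fun t => a <= t <= b) W ->
  (forall t, a <= t <= b -> c <= Re (V t) /\ c <= Re (W t)) ->
  Cmod (V b - W b) <= exp (2 / c ^ 2 * (b - a)) * Cmod (V a - W a) /\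
  Cmod (V a - W a) <= exp (2 / c ^ 2 * (b - a)) * Cmod (V b - W b).
Proof.
  intros Hc Hab HV HW HR.
  apply (Cderive_gronwall (fun t => V t - W t)%C
    (fun t => - (2) / (V t * W t) * (V t - W t))%C); [exact Hab| |].
  - intros t Ht. destruct (HV t Ht) as [V1 V2]. destruct (HW t Ht) as [W1 W2].
    eapply is_Cderive_eq; [apply is_Cderive_minus; eassumption|].
    rewrite <- two_div_sub by now apply Re_Im_neq_0. ring.
  - intros t Ht. rewrite Cmod_mult. apply Rmult_le_compat_r; [apply Cmod_ge_0|].
    apply Cmod_minus_two_div_le; auto; now apply HR.
Qed.

Lemma bessel_Re_min (V : R -> C) (a b : R) :
  a <= b -> bessel_on (fun t => a <= t <= b) V ->
  exists c, 0 < c /\ forall t, a <= t <= b -> c <= Re (V t).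
Proof.
  intros Hab HV.
  destruct (continuity_ab_min (fun t => Re (V t)) a b Hab) as [m [Hm Hm']].
  - intros t Ht. eapply is_Cderive_continuity_Re, HV, Ht.
  - exists (Re (V m)). split; [now apply HV|exact Hm].
Qed.

Lemma bessel_unique (V W : R -> C) (a b s : R) :
  bessel_on (fun t => a <= t <= b) V -> bessel_on (fun t => a <= t <= b) W ->
  a <= s <= b -> V s = W s -> forall t, a <= t <= b -> V t = W t.
Proof.
  intros HV HW Hs E t Ht.
  assert (Hab : a <= b) by lra.
  destruct (bessel_Re_min V a b Hab HV) as [c1 [C1 D1]].
  destruct (bessel_Re_min W a b Hab HW) as [c2 [C2 D2]].
  assert (Z : Cmod (V s - W s) = 0).
  { rewrite E. replace (W s - W s)%C with (RtoC 0) by ring. apply Cmod_0. }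
  assert (Hz : Cmod (V t - W t) <= 0).
  { assert (Hc : 0 < Rmin c1 c2) by now apply Rmin_pos.
    assert (HR : forall r, a <= r <= b -> Rmin c1 c2 <= Re (V r) /\ Rmin c1 c2 <= Re (W r)).
    { intros r Hr. pose proof (Rmin_l c1 c2). pose proof (Rmin_r c1 c2).
      specialize (D1 r Hr). specialize (D2 r Hr). lra. }
    destruct (Rle_lt_dec s t) as [Hst | Hst].
    - destruct (bessel_Lipschitz V W s t _ Hc Hst) as [H _].
      + bessel_restrict HV.
      + bessel_restrict HW.
      + intros; apply HR; lra.
      + rewrite Z, Rmult_0_r in H. exact H.
    - destruct (bessel_Lipschitz V W t s _ Hc (Rlt_le _ _ Hst)) as [_ H].
      + bessel_restrict HV.
      + bessel_restrict HW.
      + intros; apply HR; lra.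
      + rewrite Z, Rmult_0_r in H. exact H. }
  now apply C_eq_of_Cmod_le_0.
Qed.

Lemma bessel_Im_bound (V : R -> C) (a b : R) :
  bessel_on (fun t => a <= t <= b) V ->
  forall t, a <= t <= b -> Rabs (Im (V t)) <= Rabs (Im (V a)) + M * (t - a).
Proof.
  intros HV t Ht.
  enough (G : forall e, Rabs e = 1 -> e * Im (V t) - (Rabs (Im (V a)) + M * (t - a)) <= 0).
  { pose proof (G 1 Rabs_R1). pose proof (G (- 1) (eq_trans (Rabs_Ropp 1) Rabs_R1)).
    apply Rabs_le. lra. }
  intros e He.
  apply (nonpos_barrier (fun s => e * Im (V s) - (Rabs (Im (V a)) + M * (s - a)))
     (fun s => 0 * Im (V s) + e * Im (2 / V s + eta s)%C - M) a b); [| | | |exact Ht].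
  - intros s Hs. apply is_derive_Rminus; [|auto_derive; [exact I|ring]].
    apply is_derive_Rmult; [apply is_derive_Rconst|apply (HV s); lra].
  - intros s Hs. apply continuity_pt_minus; [|apply derivable_continuous_pt; reg].
    apply continuity_pt_mult; [apply continuity_pt_cst|]. eapply is_Cderive_continuity_Im, HV, Hs.
  - intros s Hs Hp. destruct (HV s) as [P _]; [lra|].
    change (Im (2 / V s + eta s)%C) with (Im (2 / V s)%C + Im (eta s)).
    rewrite Im_two_div by now apply Re_Im_neq_0.
    assert (Hb : e * Im (eta s) <= M).
    { eapply Rle_trans; [apply Rle_abs|]. rewrite Rabs_mult, He, Rmult_1_l. apply eta_Im_bound. }
    pose proof (Rabs_pos (Im (V a))).
    assert (0 <= M * (s - a)) by (apply Rmult_le_pos; lra).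
    assert (0 <= / (Re (V s) ^ 2 + Im (V s) ^ 2) * (e * Im (V s))).
    { apply Rmult_le_pos; [left; apply Rinv_0_lt_compat; nra|lra]. }
    unfold Rdiv. lra.
  - assert (e * Im (V a) <= Rabs (Im (V a))); [|lra].
    eapply Rle_trans; [apply Rle_abs|]. rewrite Rabs_mult, He. lra.
Qed.

(** The derivative of [Re (V^2)] is [4 - 2 Im V Im eta], which is at least [2]
    while [|Im V| <= 1 / M]. *)
Lemma bessel_Re_square_growth (V : R -> C) (a b : R) :
  imaginary_drift -> bessel_on (fun t => a <= t <= b) V ->
  Rabs (Im (V a)) + M * (b - a) <= 1 / M ->
  forall t, a <= t <= b ->
    Re (V a) ^ 2 - Im (V a) ^ 2 + 2 * (t - a) <= Re (V t) ^ 2 - Im (V t) ^ 2.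
Proof.
  intros HA HV Hsm t Ht.
  enough (Re (V a) * Re (V a) - Im (V a) * Im (V a) - 2 * a <= Re (V t) * Re (V t) - Im (V t) * Im (V t) - 2 * t) by lra.
  apply (derive_nonneg_le (fun s => Re (V s) * Re (V s) - Im (V s) * Im (V s) - 2 * s)
    (fun s => (Re (2 / V s + eta s)%C * Re (V s) + Re (V s) * Re (2 / V s + eta s)%C)
            - (Im (2 / V s + eta s)%C * Im (V s) + Im (V s) * Im (2 / V s + eta s)%C) - 2)).
  - lra.
  - intros s Hs. destruct (HV s) as [_ [D1 D2]]; [lra|].
    apply is_derive_Rminus; [|auto_derive; [exact I|ring]].
    apply is_derive_Rminus; now apply is_derive_Rmult.
  - intros s Hs. destruct (HV s) as [_ D]; [lra|].
    pose proof (is_Cderive_continuity_Re _ _ _ D). pose proof (is_Cderive_continuity_Im _ _ _ D).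
    apply continuity_pt_minus; [apply continuity_pt_minus; now apply continuity_pt_mult|].
    apply derivable_continuous_pt. reg.
  - intros s Hs. destruct (HV s) as [P _]; [lra|].
    change (Re (2 / V s + eta s)%C) with (Re (2 / V s)%C + Re (eta s)).
    change (Im (2 / V s + eta s)%C) with (Im (2 / V s)%C + Im (eta s)).
    rewrite Re_two_div, Im_two_div, HA by now apply Re_Im_neq_0.
    assert (0 < Re (V s) ^ 2 + Im (V s) ^ 2) by nra.
    replace (_ - _ - 2) with (2 - 2 * (Im (V s) * Im (eta s))) by (field; lra).
    enough (Im (V s) * Im (eta s) <= 1) by lra.
    assert (Hq : Rabs (Im (V s)) <= 1 / M).
    { eapply Rle_trans; [apply (bessel_Im_bound V a b HV s); lra|]. nra. }
    eapply Rle_trans; [apply Rle_abs|]. rewrite Rabs_mult.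
    apply Rle_trans with (1 / M * M); [|right; field; lra].
    apply Rmult_le_compat; auto using Rabs_pos, eta_Im_bound.
Qed.

Lemma imaginary_drift_Re (V : R -> C) t : imaginary_drift -> 0 < Re (V t) ->
  Re (2 / V t + eta t)%C = 2 * Re (V t) / (Re (V t) ^ 2 + Im (V t) ^ 2).
Proof.
  intros HA HV. change (Re (2 / V t + eta t)%C) with (Re (2 / V t)%C + Re (eta t)).
  rewrite HA, Re_two_div by now apply Re_Im_neq_0. ring.
Qed.

Lemma bessel_Re_nondecreasing (V : R -> C) (a b : R) :
  imaginary_drift -> bessel_on (fun t => a <= t <= b) V ->
  forall s t, a <= s -> s <= t -> t <= b -> Re (V s) <= Re (V t).
Proof.
  intros HA HV s t Has Hst Htb.
  apply (derive_nonneg_le (fun r => Re (V r)) (fun r => Re (2 / V r + eta r)%C)); [exact Hst| | |].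
  - intros r Hr. apply (HV r). lra.
  - intros r Hr. eapply is_Cderive_continuity_Re, HV. lra.
  - intros r Hr. assert (HVr : 0 < Re (V r)) by (apply HV; lra).
    rewrite imaginary_drift_Re by assumption.
    apply Rmult_le_pos; [lra|]. left. apply Rinv_0_lt_compat. nra.
Qed.

Lemma bessel_Re_upper (V : R -> C) (a b : R) :
  imaginary_drift -> bessel_on (fun t => a <= t <= b) V ->
  forall t, a <= t <= b -> Re (V t) ^ 2 <= Re (V a) ^ 2 + 4 * (t - a).
Proof.
  intros HA HV t Ht.
  enough (4 * a - Re (V a) * Re (V a) <= 4 * t - Re (V t) * Re (V t)) by lra.
  apply (derive_nonneg_le (fun s => 4 * s - Re (V s) * Re (V s))
    (fun s => 4 - (Re (2 / V s + eta s)%C * Re (V s) + Re (V s) * Re (2 / V s + eta s)%C))).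
  - lra.
  - intros s Hs. destruct (HV s) as [_ [D1 D2]]; [lra|].
    apply is_derive_Rminus; [auto_derive; [exact I|ring]|]. now apply is_derive_Rmult.
  - intros s Hs. destruct (HV s) as [_ D]; [lra|].
    pose proof (is_Cderive_continuity_Re _ _ _ D).
    apply continuity_pt_minus; [|now apply continuity_pt_mult].
    apply derivable_continuous_pt. reg.
  - intros s Hs. destruct (HV s) as [P _]; [lra|].
    change (Re (2 / V s + eta s)%C) with (Re (2 / V s)%C + Re (eta s)).
    rewrite Re_two_div, HA by now apply Re_Im_neq_0.
    assert (0 < Re (V s) ^ 2 + Im (V s) ^ 2) by nra.
    replace (4 - _) with (4 * Im (V s) ^ 2 / (Re (V s) ^ 2 + Im (V s) ^ 2)) by (field; lra).
    apply Rmult_le_pos; [nra|left; now apply Rinv_0_lt_compat].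
Qed.

Lemma cone_of_square (v : C) : 0 < Re v -> 0 <= Re v ^ 2 - Im v ^ 2 -> Rabs (Im v) <= Re v.
Proof. intros H1 H2. apply Rabs_le. split; nra. Qed.

(** * Solutions born at the singularity *)

(** For this long, solutions started on the positive axis stay in the contracting cone and
    satisfy [Re V ^ 2 >= 2 (t - a)], however close to [0] they started. *)
Definition cone_time : R := 1 / (2 * M ^ 2).

Lemma cone_time_pos : 0 < cone_time.
Proof. unfold cone_time. apply Rdiv_lt_0_compat; [lra|]. pose proof (pow_lt M 2 HM). lra. Qed.

Lemma cone_time_M : M * cone_time = 1 / (2 * M).
Proof. unfold cone_time. field. lra. Qed.

Lemma half_inv_M : 1 / (2 * M) < 1 / M.
Proof.
  assert (0 < 1 / M) by (apply Rdiv_lt_0_compat; lra).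
  replace (1 / (2 * M)) with (1 / M / 2) by (field; lra). lra.
Qed.

Context (drift : imaginary_drift \/ real_drift).

Lemma axis_admissible (y : R) : 0 < y -> admissible (RtoC y).
Proof.
  intros Hy. split; [exact Hy|]. destruct drift as [H|H]; [now left|right].
  now split.
Qed.

Lemma axis_cone_lower (V : R -> C) (a b y : R) :
  0 < y -> V a = RtoC y -> bessel_on (fun t => a <= t <= b) V -> b <= a + cone_time ->
  forall t, a <= t <= b -> Rabs (Im (V t)) <= Re (V t) /\ 2 * (t - a) <= Re (V t) ^ 2.
Proof.
  intros Hy Va HV Hb t Ht. destruct (HV t Ht) as [P _].
  assert (Hcase : imaginary_drift \/ forall s, a <= s <= b -> Im (V s) = 0).
  { destruct drift as [H|H]; [now left|].
    right. apply (bessel_real V a b HV H). now rewrite Va. }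
  destruct Hcase as [HA | HB].
  - assert (Hg := bessel_Re_square_growth V a b HA HV). rewrite Va in Hg. simpl in Hg.
    rewrite Rabs_R0 in Hg.
    assert (Hsm : 0 + M * (b - a) <= 1 / M).
    { pose proof cone_time_M. pose proof half_inv_M. nra. }
    specialize (Hg Hsm t Ht). split.
    + apply cone_of_square; [exact P|]. simpl. nra.
    + nra.
  - rewrite (HB t Ht), Rabs_R0. split; [lra|].
    enough (2 * (t - a) - Re (V t) * Re (V t) <= 0) by lra.
    apply (nonpos_barrier (fun s => 2 * (s - a) - Re (V s) * Re (V s))
      (fun s => 2 - (Re (2 / V s + eta s)%C * Re (V s) + Re (V s) * Re (2 / V s + eta s)%C)) a b); [| | | |exact Ht].
    + intros s Hs. apply is_derive_Rminus; [auto_derive; [exact I|ring]|].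
      apply is_derive_Rmult; apply (HV s); lra.
    + intros s Hs. apply continuity_pt_minus.
      * apply derivable_continuous_pt. reg.
      * apply continuity_pt_mult; eapply is_Cderive_continuity_Re, HV, Hs.
    + intros s Hs Hp. destruct (HV s) as [Ps _]; [lra|].
      change (Re (2 / V s + eta s)%C) with (Re (2 / V s)%C + Re (eta s)).
      rewrite Re_two_div, HB by (lra || now apply Re_Im_neq_0).
      replace (2 - _) with (- 2 * (1 + Re (V s) * Re (eta s))) by (field; nra).
      enough (Rabs (Re (V s) * Re (eta s)) <= 1) by (apply Rabs_le_between in H; lra).
      rewrite Rabs_mult, (Rabs_pos_eq (Re (V s))) by lra.
      apply Rle_trans with (1 / M * M); [|right; field; lra].
      apply Rmult_le_compat; [lra|apply Rabs_pos| |apply eta_Re_bound].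
      apply Rsqr_incr_0_var; [|left; apply Rdiv_lt_0_compat; lra]. unfold Rsqr.
      assert (E : 1 / M * (1 / M) = 2 * cone_time) by (unfold cone_time; field; lra). lra.
    + rewrite Va. simpl. nra.
Qed.

(** At time [a + cone_time] one has [Re V ^ 2 >= 2 cone_time = (1 / M)^2]; then the
    floor takes over. *)
Lemma axis_far (V : R -> C) (a b y : R) :
  0 < y -> V a = RtoC y -> bessel_on (fun t => a <= t <= b) V ->
  forall t, a + cone_time <= t <= b -> 1 / M <= Re (V t).
Proof.
  intros Hy Va HV t Ht. pose proof cone_time_pos as Hd.
  assert (Hadm : admissible (V a)) by (rewrite Va; now apply axis_admissible).
  destruct (axis_cone_lower V a (a + cone_time) y Hy Va) with (t := a + cone_time) as [_ Hl]; [| lra | lra |].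
  { bessel_restrict HV. }
  destruct (bessel_floor V a b HV Hadm (a + cone_time)) as [_ Hadm']; [lra|].
  destruct (bessel_floor V (a + cone_time) b) with (t := t) as [Hf _]; [|exact Hadm'|exact Ht|].
  { bessel_restrict HV. }
  eapply Rle_trans; [|exact Hf]. apply Rmin_glb; [|lra].
  apply Rsqr_incr_0_var; [|left; apply Hadm']. unfold Rsqr.
  assert (E : 1 / M * (1 / M) = 2 * cone_time) by (unfold cone_time; field; lra).
  lra.
Qed.

(** Contraction up to [cone_time], then the Lipschitz bound for [Re V >= 1 / M]. The
    constant does not depend on [y] and [y'], so that they may tend to [0]. *)
Lemma axis_stability (V W : R -> C) (a b y y' : R) :
  0 < y -> V a = RtoC y -> bessel_on (fun t => a <= t <= b) V ->
  0 < y' -> W a = RtoC y' -> bessel_on (fun t => a <= t <= b) W ->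
  forall t, a <= t <= b -> Cmod (V t - W t) <= exp (2 * M ^ 2 * (t - a)) * Rabs (y - y').
Proof.
  intros Hy Va HV Hy' Wa HW t Ht. pose proof cone_time_pos as Hd.
  assert (E0 : Cmod (V a - W a) = Rabs (y - y')).
  { rewrite Va, Wa. rewrite <- RtoC_minus. apply Cmod_R. }
  assert (HM2 : 0 < M ^ 2) by now apply pow_lt.
  assert (Hnear : forall s, a <= s <= b -> s <= a + cone_time -> Cmod (V s - W s) <= Rabs (y - y')).
  { intros s Hs Hs'. rewrite <- E0.
    assert (HVs : bessel_on (fun t => a <= t <= s) V) by (bessel_restrict HV).
    assert (HWs : bessel_on (fun t => a <= t <= s) W) by (bessel_restrict HW).
    apply bessel_contraction; auto; [lra| |].
    - intros r Hr. now apply (axis_cone_lower V a s y).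
    - intros r Hr. now apply (axis_cone_lower W a s y'). }
  pose proof (Rabs_pos (y - y')).
  destruct (Rle_lt_dec t (a + cone_time)) as [Hle | Hlt].
  - eapply Rle_trans; [now apply Hnear|].
    pose proof (exp_ineq1_le (2 * M ^ 2 * (t - a))).
    assert (0 <= M ^ 2 * (t - a)) by (apply Rmult_le_pos; lra). nra.
  - destruct (bessel_Lipschitz V W (a + cone_time) t (1 / M)) as [H1 _].
    + apply Rdiv_lt_0_compat; lra.
    + lra.
    + bessel_restrict HV.
    + bessel_restrict HW.
    + intros s Hs. split; [apply (axis_far V a b y)|apply (axis_far W a b y')]; auto; lra.
    + replace (2 / (1 / M) ^ 2) with (2 * M ^ 2) in H1 by (field; lra).
      eapply Rle_trans; [exact H1|]. apply Rmult_le_compat; try apply Cmod_ge_0.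
      * left. apply exp_pos.
      * apply exp_le_mono. apply Rmult_le_compat_l; lra.
      * apply Hnear; lra.
Qed.

(** Keeps the limit [y -> 0] inside the domain of the equation. *)
Lemma axis_lower_bound (a t : R) : a < t ->
  exists l, 0 < l /\ forall V b y, 0 < y -> V a = RtoC y -> bessel_on (fun t => a <= t <= b) V ->
    forall s, t <= s <= b -> l <= Re (V s).
Proof.
  intros Hat. pose proof cone_time_pos as Hd.
  destruct (small_positive (t - a) cone_time) as [h Hh]; [lra|exact Hd|].
  set (t' := a + h). assert (Ht' : t' = a + h) by reflexivity.
  exists (Rmin (sqrt (2 * (t' - a))) (1 / M)). split.
  - apply Rmin_pos; [apply sqrt_lt_R0; lra|apply Rdiv_lt_0_compat; lra].
  - intros V b y Hy Va HV s Hs.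
    assert (Hadm : admissible (V a)) by (rewrite Va; now apply axis_admissible).
    destruct (axis_cone_lower V a t' y Hy Va) with (t := t') as [_ Hl]; [| lra | lra |].
    { bessel_restrict HV. }
    destruct (bessel_floor V a b HV Hadm t') as [_ Hadm']; [lra|].
    destruct (bessel_floor V t' b) with (t := s) as [Hf _]; [|exact Hadm'|lra|].
    { bessel_restrict HV. }
    eapply Rle_trans; [|exact Hf].
    apply Rle_min_compat_r. apply Rsqr_incr_0_var; [|left; apply Hadm'].
    rewrite Rsqr_sqrt by lra. unfold Rsqr. lra.
Qed.

(** The solution emanating from the singular point [0] at time [a], described
    through its distance to the solutions started at [y > 0]. *)
Definition singular_solution (a : R) (V : R -> C) : Prop :=
  bessel_on (fun t => a < t) V /\
  forall W y, 0 < y -> W a = RtoC y -> bessel_on (fun t => a <= t) W ->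
    forall t, a <= t -> Cmod (V t - W t) <= exp (2 * M ^ 2 * (t - a)) * y.

Lemma pow_half_pos n : 0 < (1 / 2) ^ n.
Proof. apply pow_lt; lra. Qed.

(** The limit of the solutions started at [(1 / 2)^n] solves the equation after any time
    [t1 > a], because there it agrees with the solution restarted from its value at [t1]. *)
Lemma singular_existence (a : R) : exists V, singular_solution a V.
Proof.
  destruct (function_of_relation (fun n W => W a = RtoC ((1 / 2) ^ n) /\ bessel_on (fun t => a <= t) W))
    as [W HW].
  { intros n. apply bessel_existence. apply axis_admissible, pow_half_pos. }
  assert (HWb : forall n b, bessel_on (fun t => a <= t <= b) (W n)).
  { intros n b. bessel_restrict HW. }
  set (E := fun t => exp (2 * M ^ 2 * (t - a))).
  destruct (function_of_relation (fun t l => a <= t -> forall n, Cmod (l - W n t) <= 4 * E t * (1 / 2) ^ n))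
    as [V HV].
  { intros t. destruct (Rle_lt_dec a t) as [Hat | Hat].
    - destruct (geometric_Cauchy_limit (fun n => W n t) (E t)) as [l Hl].
      + intros n. eapply Rle_trans.
        * apply (axis_stability (W (S n)) (W n) a t ((1 / 2) ^ S n) ((1 / 2) ^ n));
            auto using pow_half_pos; try apply HW. lra.
        * apply Rmult_le_compat_l; [left; apply exp_pos|]. pose proof (pow_half_pos n).
          simpl. rewrite Rabs_left1; lra.
      + now exists l.
    - exists 0%C. intros; lra. }
  exists V.
  assert (Hpos : forall t, a < t -> exists l, 0 < l /\ (forall s n, t <= s -> l <= Re (W n s)) /\
              forall s, t <= s -> l <= Re (V s)).
  { intros t Hat. destruct (axis_lower_bound a t Hat) as [l [Hl Hl']]. exists l. split; [exact Hl|].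
    assert (G : forall s n, t <= s -> l <= Re (W n s)).
    { intros s n Hs. apply (Hl' (W n) s ((1 / 2) ^ n)); auto using pow_half_pos; [apply HW|lra]. }
    split; [exact G|].
    intros s Hs. apply (le_of_geometric_error _ _ (4 * E s)). intros n.
    specialize (G s n Hs). assert (H := HV s ltac:(lra) n). pose proof (Re_le_Cmod (V s - W n s)).
    change (Re (V s - W n s)) with (Re (V s) - Re (W n s)) in H0.
    apply Rabs_le_between in H0. lra. }
  split.
  - intros t Hat. destruct (Hpos t Hat) as [l [Hl [_ Hl']]].
    split; [eapply Rlt_le_trans; [exact Hl|now apply Hl']|].
    set (t1 := (a + t) / 2). assert (Ht1 : a < t1 < t) by (unfold t1; lra).
    destruct (Hpos t1 ltac:(lra)) as [l1 [Hl1 [LW LV]]].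
    assert (Hadm : admissible (V t1)).
    { split; [eapply Rlt_le_trans; [exact Hl1|apply LV; lra]|].
      destruct drift as [H|H]; [now left|right]. split; [exact H|].
      assert (Hz : Rabs (Im (V t1)) <= 0).
      { apply (le_of_geometric_error _ _ (4 * E t1)). intros n.
        assert (Hi : Im (W n t1) = 0).
        { apply (bessel_real (W n) a t1 (HWb n t1) H); [|lra]. now destruct (HW n) as [-> _]. }
        assert (H1 := HV t1 ltac:(lra) n). pose proof (Im_le_Cmod (V t1 - W n t1)).
        change (Im (V t1 - W n t1)) with (Im (V t1) - Im (W n t1)) in H0.
        rewrite Hi, Rminus_0_r in H0. lra. }
      pose proof (Rabs_pos (Im (V t1))). apply Rabs_eq_0. lra. }
    destruct (bessel_existence t1 (V t1) Hadm) as [v [v1 Hv]].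
    assert (Heq : forall r, t1 <= r -> v r = V r).
    { intros r Hr. set (c := Rmin l1 (1 / M)).
      assert (Hc : 0 < c) by (apply Rmin_pos; [exact Hl1|apply Rdiv_lt_0_compat; lra]).
      assert (Hz : Cmod (v r - V r) <= 0).
      { apply (le_of_geometric_error _ _ (exp (2 / c ^ 2 * (r - t1)) * (4 * E t1) + 4 * E r)). intros n.
        destruct (bessel_Lipschitz v (W n) t1 r c Hc Hr) as [H _].
        - bessel_restrict Hv.
        - bessel_restrict (HW n).
        - intros s Hs. split.
          + destruct (bessel_floor v t1 r) with (t := s) as [Hf _].
            * bessel_restrict Hv.
            * now rewrite v1.
            * exact Hs.
            * eapply Rle_trans; [|exact Hf]. rewrite v1. apply Rle_min_compat_r. apply LV. lra.
          + eapply Rle_trans; [apply Rmin_l|]. apply LW. lra.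
        - rewrite v1 in H. assert (H1 := HV t1 ltac:(lra) n). assert (H2 := HV r ltac:(lra) n).
          eapply Rle_trans; [apply Cmod_sub_triangle with (y := W n r)|].
          rewrite (Cmod_sub_comm (W n r)).
          assert (exp (2 / c ^ 2 * (r - t1)) * Cmod (V t1 - W n t1) <=
             exp (2 / c ^ 2 * (r - t1)) * (4 * E t1 * (1 / 2) ^ n)).
          { apply Rmult_le_compat_l; [left; apply exp_pos|exact H1]. }
          lra. }
      now apply C_eq_of_Cmod_le_0. }
    rewrite <- (Heq t) by lra. apply (is_Cderive_ext_loc v).
    + exists (mkposreal (t - t1) ltac:(lra)). intros s Hs. apply Heq.
      apply Rabs_def2 in Hs. unfold minus, plus, opp in Hs. simpl in Hs. lra.
    + apply Hv. lra.
  - intros X y Hy Xa HX t Hat.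
    apply (le_of_geometric_error _ _ (5 * E t)). intros n.
    eapply Rle_trans; [apply Cmod_sub_triangle with (y := W n t)|].
    assert (H1 := HV t Hat n).
    assert (H2 : Cmod (W n t - X t) <= E t * Rabs ((1 / 2) ^ n - y)).
    { apply (axis_stability (W n) X a t); auto using pow_half_pos; [apply HW| |lra].
      bessel_restrict HX. }
    assert (Rabs ((1 / 2) ^ n - y) <= (1 / 2) ^ n + y).
    { pose proof (pow_half_pos n). apply Rabs_le. lra. }
    assert (0 < E t) by apply exp_pos.
    assert (E t * Rabs ((1 / 2) ^ n - y) <= E t * ((1 / 2) ^ n + y)) by (apply Rmult_le_compat_l; lra).
    unfold E in *. lra.
Qed.

Lemma singular_axis_solution (a : R) (V : R -> C) (n : nat) :
  singular_solution a V ->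
  exists W, W a = RtoC ((1 / 2) ^ n) /\ bessel_on (fun t => a <= t) W /\
    forall t, a <= t -> Cmod (V t - W t) <= exp (2 * M ^ 2 * (t - a)) * (1 / 2) ^ n.
Proof.
  intros [_ HV].
  destruct (bessel_existence a (RtoC ((1 / 2) ^ n))) as [W [Wa HW]].
  { apply axis_admissible, pow_half_pos. }
  exists W. split; [exact Wa|]. split; [exact HW|]. intros t Ht.
  apply HV; auto using pow_half_pos.
Qed.

Lemma Re_diff_bound (v w : C) (e : R) : Cmod (v - w) <= e -> Re w - e <= Re v <= Re w + e.
Proof.
  intros H. pose proof (Re_le_Cmod (v - w)) as H0.
  change (Re (v - w)) with (Re v - Re w) in H0. apply Rabs_le_between in H0. lra.
Qed.

Lemma Im_diff_bound (v w : C) (e : R) : Cmod (v - w) <= e -> Im w - e <= Im v <= Im w + e.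
Proof.
  intros H. pose proof (Im_le_Cmod (v - w)) as H0.
  change (Im (v - w)) with (Im v - Im w) in H0. apply Rabs_le_between in H0. lra.
Qed.

Lemma singular_cone (a : R) (V : R -> C) :
  singular_solution a V ->
  forall t, a <= t <= a + cone_time -> Rabs (Im (V t)) <= Re (V t).
Proof.
  intros HV t Ht. set (E := exp (2 * M ^ 2 * (t - a))).
  apply (le_of_geometric_error _ _ (2 * E)). intros n.
  destruct (singular_axis_solution a V n HV) as [W [Wa [HW HVW]]].
  specialize (HVW t ltac:(lra)). fold E in HVW.
  destruct (axis_cone_lower W a t ((1 / 2) ^ n) (pow_half_pos n) Wa) with (t := t) as [Hc _];
    [|lra|lra|].
  { bessel_restrict HW. }
  apply Re_diff_bound in HVW as H1. apply Im_diff_bound in HVW as H2.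
  apply Rabs_le_between in Hc. apply Rabs_le. lra.
Qed.

Lemma singular_real (a : R) (V : R -> C) :
  real_drift -> singular_solution a V -> forall t, a <= t -> Im (V t) = 0.
Proof.
  intros HB HV t Ht. set (E := exp (2 * M ^ 2 * (t - a))).
  assert (Hz : Rabs (Im (V t)) <= 0).
  { apply (le_of_geometric_error _ _ E). intros n.
    destruct (singular_axis_solution a V n HV) as [W [Wa [HW HVW]]].
    specialize (HVW t Ht). fold E in HVW. apply Im_diff_bound in HVW.
    rewrite (bessel_real W a t) in HVW; [|bessel_restrict HW|exact HB|now rewrite Wa|lra].
    apply Rabs_le. lra. }
  pose proof (Rabs_pos (Im (V t))). apply Rabs_eq_0. lra.
Qed.

Lemma singular_to_zero (a : R) (V : R -> C) :
  singular_solution a V ->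
  forall eps, 0 < eps -> exists d, 0 < d /\ forall t, a <= t < a + d -> Cmod (V t) < eps.
Proof.
  intros [_ HV] eps Heps. set (E := exp (2 * M ^ 2)).
  assert (HE : 0 < E) by apply exp_pos.
  set (y := eps / (E + 2)). assert (Hy : 0 < y) by (apply Rdiv_lt_0_compat; lra).
  destruct (bessel_existence a (RtoC y) (axis_admissible y Hy)) as [W [Wa HW]].
  destruct (continuity_pt_near (fun s => Cmod (W s)) a y) as [d [Hd Hd']]; [|exact Hy|].
  { eapply is_Cderive_Cmod_continuity, (HW a (Rle_refl a)). }
  rewrite Wa, Cmod_R, (Rabs_pos_eq y) in Hd' by lra.
  destruct (small_positive d 1 Hd Rlt_0_1) as [h Hh].
  exists h. split; [lra|]. intros t Ht.
  specialize (HV W y Hy Wa HW t ltac:(lra)). specialize (Hd' t ltac:(lra)).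
  replace (V t) with ((V t - W t) + W t)%C by ring.
  eapply Rle_lt_trans; [apply Cmod_triangle|].
  assert (exp (2 * M ^ 2 * (t - a)) * y <= E * y).
  { apply Rmult_le_compat_r; [lra|]. apply exp_le_mono.
    pose proof (pow2_ge_0 M). nra. }
  assert (Ey : eps = (E + 2) * y) by (unfold y; field; lra). lra.
Qed.

(** A solution that comes arbitrarily close to [0] at times arbitrarily close to
    [a] enters the cone almost at once, and is then attracted to the singular
    solution by contraction. *)
Lemma singular_unique (a T : R) (V : R -> C) (v : C) :
  imaginary_drift -> singular_solution a V -> a < T ->
  (forall eps, 0 < eps -> exists t W, a < t < a + eps /\
     bessel_on (fun s => t <= s <= T) W /\ W T = v /\ Cmod (W t) < eps) ->
  v = V T.
Proof.
  intros HA HV HaT Happ. pose proof cone_time_pos as Hct.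
  destruct (small_positive (cone_time / 2) ((T - a) / 2)) as [d Hd]; [lra|lra|].
  set (s1 := a + d). assert (Hs1 : s1 = a + d) by reflexivity.
  destruct (Happ d ltac:(lra)) as [t1 [W1 [Ht1 [HW1 [WT1 _]]]]].
  assert (Hclose : forall e, 0 < e -> Cmod (W1 s1 - V s1) <= (6 + M) * e).
  { intros e He. destruct (singular_to_zero a V HV e He) as [h [Hh Hh']].
    assert (HMh : 0 < 1 / (2 * M)) by (apply Rdiv_lt_0_compat; lra).
    destruct (small_positive 1 e) as [e1 He1]; [lra|exact He|].
    destruct (small_positive e1 (1 / (2 * M))) as [e2 He2]; [lra|exact HMh|].
    destruct (small_positive e2 (d / 2)) as [e3 He3]; [lra|lra|].
    destruct (small_positive e3 (h / 2)) as [eps Heps]; [lra|lra|].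
    destruct (Happ eps ltac:(lra)) as [t [W [Ht [HW [WT Wt]]]]].
    assert (Heq : W s1 = W1 s1).
    { apply (bessel_unique W W1 (Rmax t t1) T T); [| | |congruence|].
      - pose proof (Rmax_l t t1). bessel_restrict HW.
      - pose proof (Rmax_r t t1). bessel_restrict HW1.
      - split; [apply Rmax_lub; lra|lra].
      - split; [apply Rmax_lub; lra|lra]. }
    rewrite <- Heq.
    assert (Hep2 : eps ^ 2 <= eps) by nra.
    set (t' := t + eps ^ 2). assert (Ht' : t' = t + eps ^ 2) by reflexivity.
    assert (Hlt : 0 < eps ^ 2) by (apply pow_lt; lra).
    assert (HIm : Rabs (Im (W t)) <= eps) by (pose proof (Im_le_Cmod (W t)); lra).
    assert (HRe : 0 < Re (W t) <= eps).
    { split; [apply HW; lra|]. pose proof (Cmod_ge_Re (W t)). lra. }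
    assert (Hsub : forall b, t <= b <= T -> bessel_on (fun s => t <= s <= b) W).
    { intros b Hb. bessel_restrict HW. }
    assert (Hcone : forall r, t' <= r <= s1 -> Rabs (Im (W r)) <= Re (W r)).
    { intros r Hr. apply cone_of_square; [apply HW; lra|].
      assert (Hg := bessel_Re_square_growth W t r HA (Hsub r ltac:(lra))).
      assert (Hsm : Rabs (Im (W t)) + M * (r - t) <= 1 / M).
      { assert (M * (r - t) <= M * cone_time) by (apply Rmult_le_compat_l; lra).
        rewrite cone_time_M in H.
        replace (1 / M) with (1 / (2 * M) + 1 / (2 * M)) by (field; lra). lra. }
      specialize (Hg Hsm r ltac:(lra)).
      assert (Im (W t) ^ 2 <= eps ^ 2).
      { rewrite <- (pow2_abs (Im (W t))). pose proof (Rabs_pos (Im (W t))). nra. }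
      pose proof (pow2_ge_0 (Re (W t))). lra. }
    assert (Hsmall : Cmod (W t') <= (5 + M) * eps).
    { eapply Rle_trans; [apply Cmod_le_Re_Im|].
      assert (HP : 0 < Re (W t')) by (apply HW; lra). rewrite (Rabs_pos_eq (Re (W t'))) by lra.
      assert (H1 := bessel_Re_upper W t t' HA (Hsub t' ltac:(lra)) t' ltac:(lra)).
      assert (H2 := bessel_Im_bound W t t' (Hsub t' ltac:(lra)) t' ltac:(lra)).
      assert (Re (W t') <= 3 * eps).
      { apply Rsqr_incr_0_var; [|lra]. unfold Rsqr.
        assert (Re (W t) ^ 2 <= eps ^ 2) by nra. nra. }
      assert (M * (t' - t) <= M * eps) by (apply Rmult_le_compat_l; lra). lra. }
    eapply Rle_trans; [apply (bessel_contraction W V t' s1)|].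
    - lra.
    - bessel_restrict HW.
    - bessel_restrict HV.
    - exact Hcone.
    - intros r Hr. apply (singular_cone a V HV). lra.
    - assert (Cmod (V t') < e) by (apply Hh'; lra).
      unfold Cminus. eapply Rle_trans; [apply Cmod_triangle|]. rewrite Cmod_opp.
      assert ((5 + M) * eps <= (5 + M) * e) by (apply Rmult_le_compat_l; lra). lra. }
  assert (Hz : Cmod (W1 s1 - V s1) <= 0).
  { apply (le_of_geometric_error _ _ (6 + M)). intros n.
    rewrite Rplus_0_l. apply Hclose, pow_half_pos. }
  assert (E1 : W1 s1 = V s1).
  { now apply C_eq_of_Cmod_le_0. }
  rewrite <- WT1. apply (bessel_unique W1 V s1 T s1).
  - bessel_restrict HW1.
  - bessel_restrict HV.
  - lra.
  - exact E1.
  - lra.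
Qed.

Lemma bessel_speed (V : R -> C) (a b c : R) :
  0 < c -> a <= b -> bessel_on (fun t => a <= t <= b) V ->
  (forall t, a <= t <= b -> c <= Re (V t)) ->
  Cmod (V b - V a) <= 2 * (2 / c + M) * (b - a).
Proof.
  intros Hc Hab HV HR.
  assert (Hsp : forall t, a <= t <= b -> Cmod (2 / V t + eta t)%C <= 2 / c + M).
  { intros t Ht. eapply Rle_trans; [apply Cmod_triangle|].
    apply Rplus_le_compat; [|apply eta_bound]. apply Cmod_two_div_le; auto. }
  assert (G : forall (p : R -> R) (dp : R -> R), (forall t, a <= t <= b -> is_derive p t (dp t)) ->
     (forall t, a <= t <= b -> Rabs (dp t) <= 2 / c + M) -> Rabs (p b - p a) <= (2 / c + M) * (b - a)).
  { intros p dp Hp Hb. destruct (MVT_gen p a b dp) as [x [Hx E]].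
    - intros x Hx. apply Hp. rewrite Rmin_left, Rmax_right in Hx by lra. lra.
    - intros x Hx. rewrite Rmin_left, Rmax_right in Hx by lra.
      eapply is_derive_continuity_pt, Hp, Hx.
    - rewrite Rmin_left, Rmax_right in Hx by lra.
      rewrite E, Rabs_mult, (Rabs_pos_eq (b - a)) by lra.
      apply Rmult_le_compat_r; [lra|]. now apply Hb. }
  eapply Rle_trans; [apply Cmod_le_Re_Im|].
  assert (G1 := G (fun t => Re (V t)) (fun t => Re (2 / V t + eta t)%C)
    (fun t Ht => proj1 (proj2 (HV t Ht)))
    (fun t Ht => Rle_trans _ _ _ (Re_le_Cmod _) (Hsp t Ht))).
  assert (G2 := G (fun t => Im (V t)) (fun t => Im (2 / V t + eta t)%C)
    (fun t Ht => proj2 (proj2 (HV t Ht)))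
    (fun t Ht => Rle_trans _ _ _ (Im_le_Cmod _) (Hsp t Ht))).
  unfold Re, Im in *. simpl in *. unfold Rminus in *. lra.
Qed.

(** The end value of the singular solution depends continuously on its starting
    time: this holds for solutions started at a fixed [y > 0], and the error of
    replacing [0] by [y] is uniform. *)
Lemma singular_start_continuity (a0 T : R) : forall eps, 0 < eps -> exists d, 0 < d /\
  forall a1 a2 V1 V2, a0 <= a1 -> a1 <= a2 -> a2 <= T -> a2 - a1 < d ->
    singular_solution a1 V1 -> singular_solution a2 V2 -> Cmod (V1 T - V2 T) < eps.
Proof.
  intros eps Heps. set (E := exp (2 * M ^ 2 * (T - a0))).
  assert (HE : 0 < E) by apply exp_pos.
  set (y := eps / (4 * E)). assert (Hy : 0 < y) by (apply Rdiv_lt_0_compat; lra).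
  set (c := Rmin y (1 / M)).
  assert (Hc : 0 < c) by (apply Rmin_pos; [exact Hy|apply Rdiv_lt_0_compat; lra]).
  assert (Hc2 : 0 < 2 / c) by (apply Rdiv_lt_0_compat; lra).
  set (E' := exp (2 / c ^ 2 * (T - a0))). assert (HE' : 0 < E') by apply exp_pos.
  set (d := eps / (4 * (E' * (2 / c + M)))).
  assert (HK : 0 < E' * (2 / c + M)) by (apply Rmult_lt_0_compat; lra).
  exists d. split; [apply Rdiv_lt_0_compat; lra|].
  intros a1 a2 V1 V2 H0 H1 H2 Hd [_ HV1] [_ HV2].
  destruct (bessel_existence a1 (RtoC y) (axis_admissible y Hy)) as [W1 [W1a HW1]].
  destruct (bessel_existence a2 (RtoC y) (axis_admissible y Hy)) as [W2 [W2a HW2]].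
  specialize (HV1 W1 y Hy W1a HW1 T ltac:(lra)).
  specialize (HV2 W2 y Hy W2a HW2 T ltac:(lra)).
  assert (HW1b : forall b, bessel_on (fun t => a1 <= t <= b) W1).
  { intros b. bessel_restrict HW1. }
  assert (HW2b : forall b, bessel_on (fun t => a2 <= t <= b) W2).
  { intros b. bessel_restrict HW2. }
  assert (R1 : forall t, a1 <= t <= T -> c <= Re (W1 t)).
  { intros t Ht. destruct (bessel_floor W1 a1 T (HW1b T)) with (t := t) as [Hf _]; [|exact Ht|].
    - rewrite W1a. now apply axis_admissible.
    - rewrite W1a in Hf. exact Hf. }
  assert (R2 : forall t, a2 <= t <= T -> c <= Re (W2 t)).
  { intros t Ht. destruct (bessel_floor W2 a2 T (HW2b T)) with (t := t) as [Hf _]; [|exact Ht|].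
    - rewrite W2a. now apply axis_admissible.
    - rewrite W2a in Hf. exact Hf. }
  assert (S1 := bessel_speed W1 a1 a2 c Hc H1 (HW1b a2) (fun t Ht => R1 t ltac:(lra))).
  destruct (bessel_Lipschitz W1 W2 a2 T c Hc H2) as [L1 _].
  { bessel_restrict HW1. }
  { apply HW2b. }
  { intros t Ht. split; [apply R1|apply R2]; lra. }
  rewrite W2a, <- W1a in L1.
  assert (Hm : forall a, a0 <= a <= T -> exp (2 * M ^ 2 * (T - a)) * y <= eps / 4).
  { intros a Ha. replace (eps / 4) with (E * y) by (unfold y; field; lra).
    apply Rmult_le_compat_r; [lra|]. apply exp_le_mono.
    apply Rmult_le_compat_l; [|lra]. pose proof (pow2_ge_0 M). lra. }
  pose proof (Hm a1 ltac:(lra)). pose proof (Hm a2 ltac:(lra)).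
  assert (L2 : Cmod (W1 T - W2 T) <= E' * (2 * (2 / c + M) * (a2 - a1))).
  { eapply Rle_trans; [exact L1|]. apply Rmult_le_compat.
    - left. apply exp_pos.
    - apply Cmod_ge_0.
    - apply exp_le_mono. apply Rmult_le_compat_l; [|lra].
      left. apply Rdiv_lt_0_compat; [lra|now apply pow_lt].
    - exact S1. }
  assert (L3 : E' * (2 * (2 / c + M) * (a2 - a1)) < eps / 2).
  { replace (eps / 2) with (2 * (E' * (2 / c + M)) * d)
      by (unfold d; set (K := E' * (2 / c + M)) in *; field; lra).
    replace (E' * (2 * (2 / c + M) * (a2 - a1))) with (2 * (E' * (2 / c + M)) * (a2 - a1)) by ring.
    apply Rmult_lt_compat_l; lra. }
  eapply Rle_lt_trans; [apply Cmod_sub_triangle with (y := W1 T)|].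
  eapply Rle_lt_trans; [apply Rplus_le_compat_l, Cmod_sub_triangle with (y := W2 T)|].
  rewrite (Cmod_sub_comm (W2 T)). lra.
Qed.

(** * Following the flow backwards *)

(** Run the flow backwards from [v]: either it reaches time [a], or at the
    critical time [Re] tends to [0]. Since [(log Re V)' = 2 / |V|^2], the solution must
    then come close to [0], and the uniqueness of the singular solution
    identifies it. *)
Lemma backward_dichotomy (a T : R) (v : C) :
  imaginary_drift -> a < T -> 0 < Re v ->
  (exists W, bessel_on (fun t => a <= t <= T) W /\ W T = v) \/
  (exists t0, a <= t0 < T /\ forall V, singular_solution t0 V -> v = V T).
Proof.
  intros HA HaT Hv.
  destruct (function_of_relation (fun c W => 0 < c ->
      W T = v /\ forall t, is_Cderive W t (2 / truncate c (W t) + eta t)%C)) as [X HX].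
  { intros c. destruct (Rlt_dec 0 c) as [Hc | Hc].
    - destruct (truncated_existence c T v Hc) as [W HW]. now exists W.
    - exists (fun _ => 0%C). tauto. }
  (* the solution from [v], truncated at [c], is a true one back to time [t] *)
  set (good := fun c t => 0 < c /\ forall s, t <= s <= T -> c < Re (X c s)).
  assert (Hbes : forall c t, good c t -> bessel_on (fun s => t <= s <= T) (X c)).
  { intros c t [Hc Hg] s Hs. specialize (Hg s Hs). split; [lra|].
    eapply is_Cderive_eq; [now apply HX|]. rewrite truncate_id by lra. reflexivity. }
  set (E := fun r => 0 <= r <= T - a /\ exists c, good c (T - r)).
  destruct (completeness E) as [r0 [Hub Hlub]].
  { exists (T - a). intros r [Hr _]. lra. }
  { exists 0. split; [lra|]. exists (Re v / 2). split; [lra|]. intros s Hs.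
    replace s with T by lra. destruct (HX (Re v / 2)) as [-> _]; lra. }
  assert (Hr0 : 0 <= r0 <= T - a).
  { split.
    - apply Hub. split; [lra|]. exists (Re v / 2). split; [lra|]. intros s Hs.
      replace s with T by lra. destruct (HX (Re v / 2)) as [-> _]; lra.
    - apply Hlub. intros r [Hr _]. lra. }
  set (t0 := T - r0).
  destruct (excluded_middle_informative (exists c, good c t0)) as [[c Hc] | Hno].
  - left. exists (X c). split; [|now apply HX, Hc].
    destruct (Req_dec r0 (T - a)) as [Er | Er].
    { replace a with t0 by (unfold t0; lra). now apply Hbes. }
    exfalso. destruct Hc as [Hc Hg].
    assert (Hgt : c < Re (X c t0)) by (apply Hg; unfold t0; lra).
    destruct (continuity_pt_near (fun s => Re (X c s)) t0 (Re (X c t0) - c)) as [d [Hd Hd']]; [|lra|].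
    { eapply is_Cderive_continuity_Re, (HX c Hc). }
    destruct (small_positive d (T - a - r0)) as [h Hh]; [exact Hd|lra|].
    assert (HE : E (r0 + h)).
    { split; [lra|]. exists c. split; [exact Hc|]. intros s Hs.
      destruct (Rle_lt_dec t0 s) as [Hs' | Hs']; [apply Hg; lra|].
      specialize (Hd' s ltac:(unfold t0 in *; lra)). lra. }
    apply Hub in HE. lra.
  - right. exists t0.
    assert (Ht0 : a <= t0 < T).
    { unfold t0. split; [lra|]. destruct (Rle_lt_or_eq_dec 0 r0) as [|E0]; [lra|lra|exfalso].
      apply Hno. exists (Re v / 2). split; [lra|]. unfold t0. intros s Hs.
      replace s with T by lra. destruct (HX (Re v / 2)) as [-> _]; lra. }
    assert (Hex : forall t, t0 < t <= T -> exists W, bessel_on (fun s => t <= s <= T) W /\ W T = v).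
    { intros t Ht.
      destruct (excluded_middle_informative (exists r, E r /\ T - t < r)) as [[r [[Hr [c Hc]] Hrt]] | Hn].
      - exists (X c). split; [|now apply HX, Hc].
        bessel_restrict (Hbes c _ Hc).
      - exfalso. enough (r0 <= T - t) by (unfold t0 in *; lra).
        apply Hlub. intros r Hr. destruct (Rle_lt_dec r (T - t)) as [|Hlt]; [assumption|].
        exfalso. apply Hn. now exists r. }
    split; [exact Ht0|]. intros V HV. apply (singular_unique t0 T V v HA HV); [lra|].
    intros eps Heps.
    destruct (excluded_middle_informative (exists t W, t0 < t < t0 + eps /\
       bessel_on (fun s => t <= s <= T) W /\ W T = v /\ Cmod (W t) < eps)) as [|Hfar]; [assumption|exfalso].
    destruct (small_positive eps (T - t0)) as [h Hh]; [exact Heps|lra|].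
    set (t1 := t0 + h). assert (Ht1 : t1 = t0 + h) by reflexivity.
    destruct (Hex t1 ltac:(lra)) as [W1 [HW1 WT1]].
    assert (HP1 : 0 < Re (W1 t1)) by (apply HW1; lra).
    (* if [|V| >= eps] near [t0], then [Re V] decays at most like [exp (K t)] backwards *)
    set (K := 2 / eps ^ 2). assert (HK : 0 < K) by (apply Rdiv_lt_0_compat; [lra|now apply pow_lt]).
    set (c := Re (W1 t1) * exp (- K * (t1 - t0)) / 2).
    assert (Hc0 : 0 < c).
    { unfold c. assert (0 < Re (W1 t1) * exp (- K * (t1 - t0)))
        by (apply Rmult_lt_0_compat; [exact HP1|apply exp_pos]). lra. }
    assert (Hlow : forall t, t0 < t <= T -> 2 * c <= Re (X c t)).
    { intros t Ht. destruct (small_positive (t - t0) (t1 - t0)) as [h' Hh']; [lra|lra|].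
      set (t' := t0 + h'). assert (Ht' : t' = t0 + h') by reflexivity.
      destruct (Hex t' ltac:(lra)) as [W [HW WT]].
      assert (Hagree : W t1 = W1 t1).
      { apply (bessel_unique W W1 t1 T T); [|exact HW1|lra|congruence|lra].
        bessel_restrict HW. }
      assert (Hnear : forall s, t' <= s <= t1 -> 2 * c <= Re (W s)).
      { intros s Hs.
        assert (Hg : Re (W t1) <= Re (W s) * exp (K * (t1 - s))).
        { apply (gronwall_le (fun r => Re (W r)) (fun r => Re (2 / W r + eta r)%C)); [lra| | |].
          - intros r Hr. apply (HW r). lra.
          - intros r Hr. eapply is_Cderive_continuity_Re, HW. lra.
          - intros r Hr. assert (HWr : 0 < Re (W r)) by (apply HW; lra).
            rewrite imaginary_drift_Re by assumption. rewrite <- Cmod_sq.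
            assert (Hbig : eps <= Cmod (W r)).
            { destruct (Rle_lt_dec eps (Cmod (W r))) as [|Hlt]; [assumption|exfalso].
              apply Hfar. exists r, W. split; [lra|]. split; [|now split].
              bessel_restrict HW. }
            replace (2 * Re (W r) / Cmod (W r) ^ 2) with (2 / Cmod (W r) ^ 2 * Re (W r)) by (unfold Rdiv; ring).
            apply Rmult_le_compat_r; [lra|]. apply Rmult_le_compat_l; [lra|].
            apply Rinv_le_contravar; [now apply pow_lt|]. apply pow_incr. lra. }
        rewrite Hagree in Hg. unfold c.
        apply Rmult_le_compat_r with (r := exp (- K * (t1 - s))) in Hg; [|left; apply exp_pos].
        rewrite Rmult_assoc, <- exp_plus in Hg.
        replace (K * (t1 - s) + - K * (t1 - s)) with 0 in Hg by ring. rewrite exp_0, Rmult_1_r in Hg.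
        replace (2 * (Re (W1 t1) * exp (- K * (t1 - t0)) / 2)) with (Re (W1 t1) * exp (- K * (t1 - t0))) by field.
        eapply Rle_trans; [|exact Hg]. apply Rmult_le_compat_l; [lra|]. apply exp_le_mono. nra. }
      assert (Hall : forall s, t' <= s <= T -> 2 * c <= Re (W s)).
      { intros s Hs. destruct (Rle_lt_dec s t1) as [Hs1 | Hs1]; [apply Hnear; lra|].
        apply Rle_trans with (Re (W t1)); [apply Hnear; lra|].
        apply (bessel_Re_nondecreasing W t' T HA HW); lra. }
      destruct (HX c Hc0) as [XT HXd].
      rewrite (truncated_unique c (X c) W t T Hc0); [apply Hall; lra|lra| | |congruence].
      - intros s _. apply HXd.
      - intros s Hs. eapply is_Cderive_eq; [apply HW; lra|].
        rewrite truncate_id; [reflexivity|]. specialize (Hall s ltac:(lra)). lra. }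
    apply Hno. exists c. split; [exact Hc0|]. intros s Hs.
    destruct (Rle_lt_or_eq_dec t0 s) as [Hlt | Heq]; [lra| |].
    { specialize (Hlow s ltac:(lra)). lra. }
    subst s. destruct (HX c Hc0) as [_ HXd].
    destruct (continuity_pt_near (fun s => Re (X c s)) t0 c) as [d [Hd Hd']]; [|exact Hc0|].
    { eapply is_Cderive_continuity_Re, HXd. }
    destruct (small_positive d (T - t0)) as [h' Hh']; [exact Hd|lra|].
    specialize (Hlow (t0 + h') ltac:(lra)). specialize (Hd' (t0 + h') ltac:(lra)). lra.
Qed.

(** * Complex differentiability of the flow *)

Lemma Ccontinuous_mult f g : Ccontinuous f -> Ccontinuous g -> Ccontinuous (fun t => f t * g t)%C.
Proof.
  intros [F1 F2] [G1 G2]. split; intros t.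
  - apply (continuity_pt_minus (fun s => Re (f s) * Re (g s)) (fun s => Im (f s) * Im (g s)));
      apply continuity_pt_mult; auto.
  - apply (continuity_pt_plus (fun s => Re (f s) * Im (g s)) (fun s => Im (f s) * Re (g s)));
      apply continuity_pt_mult; auto.
Qed.

(** The exponential of the primitive of [g], written with real functions. *)
Lemma linear_equation_solution (g : R -> C) (a : R) : Ccontinuous g ->
  exists J : R -> C, J a = 1%C /\ forall t, is_Cderive J t (g t * J t)%C.
Proof.
  intros Hg. set (A := fun t => CInt g a t).
  assert (HA : forall t, is_Cderive A t (g t)) by (intros t; now apply CInt_derive).
  exists (fun t => (exp (Re (A t)) * cos (Im (A t)), exp (Re (A t)) * sin (Im (A t)))). split.
  - assert (Aa : A a = (0, 0)) by (unfold A, CInt; now rewrite !RInt_point).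
    rewrite Aa. simpl. rewrite exp_0, cos_0, sin_0. apply C_eq; simpl; ring.
  - intros t. destruct (HA t) as [H1 H2].
    assert (He : is_derive (fun s => exp (Re (A s))) t (Re (g t) * exp (Re (A t)))).
    { apply (is_derive_comp exp (fun s => Re (A s))); [apply is_derive_exp|exact H1]. }
    assert (Hc : is_derive (fun s => cos (Im (A s))) t (Im (g t) * - sin (Im (A t)))).
    { apply (is_derive_comp cos (fun s => Im (A s))); [apply is_derive_cos|exact H2]. }
    assert (Hs : is_derive (fun s => sin (Im (A s))) t (Im (g t) * cos (Im (A t)))).
    { apply (is_derive_comp sin (fun s => Im (A s))); [apply is_derive_sin|exact H2]. }
    split; (eapply is_derive_eq; [apply is_derive_Rmult; eassumption|]); unfold Re, Im; simpl; ring.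
Qed.

Definition clamp (a b t : R) : R := Rmax a (Rmin t b).

Lemma clamp_range a b t : a <= b -> a <= clamp a b t <= b.
Proof.
  intros H. unfold clamp. split; [apply Rmax_l|].
  apply Rmax_lub; [exact H|apply Rmin_r].
Qed.

Lemma clamp_id a b t : a <= t <= b -> clamp a b t = t.
Proof. intros H. unfold clamp. rewrite Rmin_left, Rmax_right; lra. Qed.

Lemma clamp_continuity a b t : continuity_pt (clamp a b) t.
Proof.
  intros eps Heps. exists eps. split; [exact Heps|].
  intros x [_ Hx]. simpl in *. unfold R_dist in *.
  eapply Rle_lt_trans; [|exact Hx]. unfold clamp, Rmax, Rmin.
  destruct (Rle_dec x b), (Rle_dec t b); repeat destruct (Rle_dec a _);
    unfold Rabs; repeat destruct Rcase_abs; lra.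
Qed.

Lemma continuity_pt_clamp (f : R -> R) a b : a <= b ->
  (forall t, a <= t <= b -> continuity_pt f t) ->
  forall t, continuity_pt (fun s => f (clamp a b s)) t.
Proof.
  intros Hab Hf t. apply (continuity_pt_comp (clamp a b) f); [apply clamp_continuity|].
  apply Hf. now apply clamp_range.
Qed.

(** The complex derivative of the flow is the solution [J] of the linearised
    equation; the remainder is quadratic by Gronwall's inequality. *)
Lemma bessel_flow_differentiable (a T : R) (V0 : R -> C) :
  imaginary_drift -> a <= T -> bessel_on (fun t => a <= t <= T) V0 ->
  exists (J : C) (K d : R), 0 < d /\ forall V, bessel_on (fun t => a <= t <= T) V ->
    Cmod (V a - V0 a) < d ->
    Cmod (V T - V0 T - J * (V a - V0 a)) <= K * Cmod (V a - V0 a) ^ 2.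
Proof.
  intros HA HaT HV0. set (p := Re (V0 a)). assert (Hp : 0 < p) by (apply HV0; lra).
  set (c := Rmin (p / 2) (1 / M)).
  assert (Hc : 0 < c) by (apply Rmin_pos; [lra|apply Rdiv_lt_0_compat; lra]).
  assert (Hfl : forall V, bessel_on (fun t => a <= t <= T) V -> p / 2 <= Re (V a) ->
     forall t, a <= t <= T -> c <= Re (V t)).
  { intros V HV HVa t Ht. destruct (bessel_floor V a T HV) with (t := t) as [Hf _]; [|exact Ht|].
    - split; [lra|now left].
    - eapply Rle_trans; [|exact Hf]. now apply Rle_min_compat_r. }
  assert (HV0c : forall t, a <= t <= T -> c <= Re (V0 t)).
  { apply Hfl; [exact HV0|]. fold p. lra. }
  set (w := fun s => V0 (clamp a T s)).
  assert (Hw : Ccontinuous w).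
  { split; intros t; unfold w.
    - apply (continuity_pt_clamp (fun s => Re (V0 s)) a T HaT).
      intros s Hs. eapply is_Cderive_continuity_Re, HV0, Hs.
    - apply (continuity_pt_clamp (fun s => Im (V0 s)) a T HaT).
      intros s Hs. eapply is_Cderive_continuity_Im, HV0, Hs. }
  set (k := fun s => (2 / truncate c (w s))%C).
  assert (Hk : Ccontinuous k).
  { apply (Ccontinuous_comp_Lipschitz (fun v => 2 / truncate c v)%C (2 / c ^ 2)); [|exact Hw].
    intros; now apply truncated_inverse_Lipschitz. }
  destruct (linear_equation_solution (fun s => RtoC (- (1 / 2)) * (k s * k s))%C a) as [J [Ja HJ]].
  { apply Ccontinuous_mult; [|now apply Ccontinuous_mult].
    split; intros t; apply continuity_pt_cst. }
  assert (HJ' : forall t, a <= t <= T -> is_Cderive J t (- (2) / (V0 t * V0 t) * J t)%C).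
  { intros t Ht. eapply is_Cderive_eq; [apply HJ|]. f_equal. unfold k, w.
    rewrite clamp_id by exact Ht. rewrite truncate_id by now apply HV0c.
    rewrite RtoC_opp, RtoC_div by lra. field. apply Re_Im_neq_0. now apply HV0. }
  set (E0 := exp (2 / c ^ 2 * (T - a))). assert (HE0 : 0 < E0) by apply exp_pos.
  set (K := 4 / c ^ 2 + 1). assert (HK : 1 <= K).
  { unfold K. assert (0 < 4 / c ^ 2) by (apply Rdiv_lt_0_compat; [lra|now apply pow_lt]). lra. }
  set (B := 2 * E0 ^ 2 / c ^ 3).
  assert (Hc3 : 0 < c ^ 3) by now apply pow_lt.
  assert (HB : 0 < B).
  { apply Rdiv_lt_0_compat; [|exact Hc3]. pose proof (pow_lt E0 2 HE0). lra. }
  exists (J T), (B * exp (K * (T - a))), (p / 2). split; [lra|].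
  intros V HV Hd. set (d := (V a - V0 a)%C) in *.
  assert (HVc : forall t, a <= t <= T -> c <= Re (V t)).
  { apply Hfl; [exact HV|]. assert (H := Re_diff_bound (V a) (V0 a) (p / 2)). fold d p in H.
    specialize (H ltac:(lra)). lra. }
  assert (HD : forall t, a <= t <= T -> Cmod (V t - V0 t) <= E0 * Cmod d).
  { intros t Ht. destruct (bessel_Lipschitz V V0 a t c Hc) as [H _]; [lra| | | |].
    - bessel_restrict HV.
    - bessel_restrict HV0.
    - intros s Hs. split; [apply HVc|apply HV0c]; lra.
    - eapply Rle_trans; [exact H|]. apply Rmult_le_compat_r; [apply Cmod_ge_0|].
      apply exp_le_mono. apply Rmult_le_compat_l; [|lra].
      left. apply Rdiv_lt_0_compat; [lra|now apply pow_lt]. }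
  set (e := fun t => (V t - V0 t - J t * d)%C).
  set (de := fun t => (- (2) / (V0 t * V0 t) * e t
               + 2 * ((V t - V0 t) * (V t - V0 t)) / (V0 t * V0 t * V t))%C).
  assert (He : forall t, a <= t <= T -> is_Cderive e t (de t)).
  { intros t Ht. destruct (HV t Ht) as [P1 D1]. destruct (HV0 t Ht) as [P2 D2].
    eapply is_Cderive_eq.
    - apply is_Cderive_minus; [apply is_Cderive_minus; eassumption|].
      apply is_Cderive_mult; [now apply HJ'|apply is_Cderive_const].
    - unfold de, e. field. split; now apply Re_Im_neq_0. }
  assert (Hde : forall t, a <= t <= T -> Cmod (de t) <= 2 / c ^ 2 * Cmod (e t) + B * Cmod d ^ 2).
  { intros t Ht. unfold de. eapply Rle_trans; [apply Cmod_triangle|]. rewrite Cmod_mult.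
    assert (N0 : V0 t <> 0%C) by (apply Re_Im_neq_0, HV0, Ht).
    assert (N1 : V t <> 0%C) by (apply Re_Im_neq_0, HV, Ht).
    apply Rplus_le_compat.
    - apply Rmult_le_compat_r; [apply Cmod_ge_0|]. apply Cmod_minus_two_div_le; auto.
    - rewrite Cmod_div by (repeat apply Cmult_neq_0; assumption).
      rewrite !Cmod_mult, Cmod_R, Rabs_pos_eq by lra.
      assert (C0 : c <= Cmod (V0 t)) by (eapply Rle_trans; [now apply HV0c|apply Cmod_ge_Re]).
      assert (C1 : c <= Cmod (V t)) by (eapply Rle_trans; [now apply HVc|apply Cmod_ge_Re]).
      unfold B. replace (2 * E0 ^ 2 / c ^ 3 * Cmod d ^ 2) with (2 * ((E0 * Cmod d) * (E0 * Cmod d)) * / c ^ 3) by (field; lra).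
      specialize (HD t Ht). pose proof (Cmod_ge_0 (V t - V0 t)).
      apply Rmult_le_compat.
      + nra.
      + left. apply Rinv_0_lt_compat. repeat apply Rmult_lt_0_compat; lra.
      + apply Rmult_le_compat_l; [lra|]. apply Rmult_le_compat; lra.
      + apply Rinv_le_contravar; [exact Hc3|].
        replace (c ^ 3) with (c * c * c) by ring.
        apply Rmult_le_compat; try nra. }
  set (q := (B * Cmod d ^ 2) ^ 2).
  assert (Hq : 0 <= q) by apply pow2_ge_0.
  assert (HG : Cmod (e T) ^ 2 + q <= (Cmod (e a) ^ 2 + q) * exp (K * (T - a))).
  { apply (gronwall_le (fun t => Cmod (e t) ^ 2 + q) (fun t => 2 * Re (Cconj (e t) * de t)%C + 0)); [exact HaT| | |].
    - intros t Ht. apply is_derive_Rplus; [|apply is_derive_Rconst].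
      apply Cmod_sq_derive, He. lra.
    - intros t Ht. eapply is_derive_continuity_pt.
      apply is_derive_Rplus; [apply Cmod_sq_derive, He, Ht|apply is_derive_Rconst].
    - intros t Ht. specialize (Hde t ltac:(lra)).
      assert (H1 : Re (Cconj (e t) * de t)%C <= Cmod (e t) * Cmod (de t)).
      { rewrite <- (Cmod_conj (e t)), <- Cmod_mult. apply Cmod_ge_Re. }
      pose proof (Cmod_ge_0 (e t)).
      assert (H2 : Cmod (e t) * Cmod (de t) <= Cmod (e t) * (2 / c ^ 2 * Cmod (e t) + B * Cmod d ^ 2)).
      { now apply Rmult_le_compat_l. }
      assert (H3 : 2 * (Cmod (e t) * (B * Cmod d ^ 2)) <= Cmod (e t) ^ 2 + q).
      { unfold q. pose proof (pow2_ge_0 (Cmod (e t) - B * Cmod d ^ 2)). nra. }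
      assert (H4 : q <= K * q) by nra.
      assert (H5 : K * Cmod (e t) ^ 2 = 2 * (2 / c ^ 2) * Cmod (e t) ^ 2 + Cmod (e t) ^ 2).
      { unfold K. field. lra. }
      assert (H6 : 2 * Re (Cconj (e t) * de t)%C <=
        2 * (2 / c ^ 2) * Cmod (e t) ^ 2 + 2 * (Cmod (e t) * (B * Cmod d ^ 2))).
      { replace (2 * (2 / c ^ 2) * Cmod (e t) ^ 2 + 2 * (Cmod (e t) * (B * Cmod d ^ 2)))
          with (2 * (Cmod (e t) * (2 / c ^ 2 * Cmod (e t) + B * Cmod d ^ 2))) by ring. lra. }
      rewrite Rmult_plus_distr_l, H5. lra. }
  assert (Ea : e a = 0%C) by (unfold e, d; rewrite Ja; ring).
  rewrite Ea, Cmod_0 in HG.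
  assert (HX : 1 <= exp (K * (T - a))).
  { rewrite <- exp_0. apply exp_le_mono. apply Rmult_le_pos; lra. }
  apply Rsqr_incr_0_var.
  - unfold Rsqr. fold (e T). pose proof (pow2_ge_0 (Cmod d)).
    set (X := exp (K * (T - a))) in *. assert (q * X <= q * (X * X)) by (apply Rmult_le_compat_l; nra).
    replace (B * X * Cmod d ^ 2 * (B * X * Cmod d ^ 2)) with (q * (X * X)) by (unfold q; ring).
    change (Cmod (e T) * Cmod (e T) <= q * (X * X)). nra.
  - pose proof (pow2_ge_0 (Cmod d)). pose proof (exp_pos (K * (T - a))).
    apply Rmult_le_pos; [|assumption]. apply Rmult_le_pos; lra.
Qed.

End Bessel.

(** * Curves generated by smooth drivers *)

Lemma Ci_sq : (Ci * Ci = - (1))%C.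
Proof. apply C_eq; simpl; ring. Qed.

Lemma Ci_neq_0 : Ci <> 0%C.
Proof. intros E. apply (f_equal Im) in E. simpl in E. lra. Qed.

Lemma Cmod_Ci : Cmod Ci = 1.
Proof. unfold Cmod. simpl. replace (0 * (0 * 1) + 1 * (1 * 1)) with 1 by ring. apply sqrt_1. Qed.

Lemma Im_Ci_mult z : Im (Ci * z)%C = Re z.
Proof. unfold Im, Re; simpl. ring. Qed.

Lemma continuous_on_C (D : R -> Prop) (f : R -> C) :
  (forall x, D x -> forall eps, 0 < eps -> exists d, 0 < d /\
     forall y, D y -> Rabs (y - x) < d -> Cmod (f y - f x) < eps) ->
  continuous_on (U := C_UniformSpace) D f.
Proof.
  intros H x Dx. apply filterlim_locally. intros eps.
  destruct (H x Dx eps (cond_pos eps)) as [d [Hd Hd']].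
  exists (mkposreal d Hd). intros y Hy Dy. specialize (Hd' y Dy Hy).
  split.
  - eapply Rle_lt_trans; [exact (Re_le_Cmod (f y - f x))|exact Hd'].
  - eapply Rle_lt_trans; [exact (Im_le_Cmod (f y - f x))|exact Hd'].
Qed.

Lemma ex_derive_of_quadratic_error (f : C -> C) (z J : C) (K d : R) : 0 < d ->
  (forall w, Cmod (w - z) < d -> Cmod (f w - f z - J * (w - z)) <= K * Cmod (w - z) ^ 2) ->
  ex_derive (K := C_AbsRing) (V := C_NormedModule) f z.
Proof.
  intros Hd H. exists J. split; [apply is_linear_scal_l|].
  intros x Hx.
  apply (is_filter_lim_locally_unique (K := C_AbsRing) (V := AbsRing_NormedModule C_AbsRing)) in Hx.
  subst x. intros eps.
  set (A := Rabs K + 1). assert (HA : 0 < A) by (unfold A; pose proof (Rabs_pos K); lra).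
  assert (Hm : 0 < Rmin d (eps / A)).
  { apply Rmin_pos; [exact Hd|]. apply Rdiv_lt_0_compat; [apply cond_pos|exact HA]. }
  exists (mkposreal _ Hm). intros w Hw.
  change (Cmod (w - z) < Rmin d (eps / A)) in Hw.
  change (Cmod (f w - f z - (w - z) * J) <= eps * Cmod (w - z)).
  replace ((w - z) * J)%C with (J * (w - z))%C by ring.
  pose proof (Rmin_l d (eps / A)). pose proof (Rmin_r d (eps / A)).
  eapply Rle_trans; [apply H; lra|].
  pose proof (Cmod_ge_0 (w - z)).
  assert (K <= A) by (unfold A; pose proof (Rle_abs K); lra).
  assert (A * Cmod (w - z) <= eps).
  { apply Rle_trans with (A * (eps / A)); [apply Rmult_le_compat_l; lra|right; field; lra]. }
  apply Rle_trans with (A * Cmod (w - z) * Cmod (w - z)); [nra|].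
  now apply Rmult_le_compat_r.
Qed.

Section Loewner.

Context (xi dxi : R -> R) (T M : R).
Context (HT : 0 < T) (HM : 0 < M).
Context (xi_derive : forall t, is_derive xi t (dxi t)).
Context (dxi_cont : forall t, continuity_pt dxi t).
Context (dxi_bound : forall t, - 1 <= t <= T + 1 -> Rabs (dxi t) <= M).

(** The drift of [V = - i (h - xi)]. Clamping makes it bounded on the line; the
    margin around [0, T] keeps derivatives two-sided at the ends. *)
Definition loewner_drift (t : R) : C := (0, dxi (clamp (- 1) (T + 1) t)).

Lemma loewner_drift_cont : Ccontinuous loewner_drift.
Proof.
  split; intros t; simpl.
  - apply continuity_pt_cst.
  - apply (continuity_pt_clamp dxi); [lra|auto].
Qed.

Lemma loewner_drift_bound t : Cmod (loewner_drift t) <= M.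
Proof.
  eapply Rle_trans; [apply Cmod_le_Re_Im|]. simpl. rewrite Rabs_R0, Rplus_0_l.
  apply dxi_bound. apply clamp_range. lra.
Qed.

Lemma loewner_drift_imaginary : imaginary_drift loewner_drift.
Proof. intros t. reflexivity. Qed.

Lemma loewner_of_bessel (V : R -> C) t : - 1 <= t <= T + 1 ->
  V t <> 0%C -> is_Cderive V t (2 / V t + loewner_drift t)%C ->
  is_Cderive (fun s => RtoC (xi s) + Ci * V s)%C t
    (RtoC (-2) / (RtoC (xi t) + Ci * V t - RtoC (xi t)))%C.
Proof.
  intros Ht HV D. eapply is_Cderive_eq.
  - apply is_Cderive_plus; [apply is_Cderive_RtoC, xi_derive|].
    apply is_Cderive_mult; [apply is_Cderive_const|exact D].
  - assert (E : (loewner_drift t = Ci * RtoC (dxi t))%C).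
    { unfold loewner_drift. rewrite clamp_id by exact Ht. apply C_eq; simpl; ring. }
    rewrite E.
    replace (RtoC (-2) / (RtoC (xi t) + Ci * V t - RtoC (xi t)))%C
      with (RtoC (-2) * Ci / ((Ci * Ci) * V t))%C.
    2:{ replace (RtoC (xi t) + Ci * V t - RtoC (xi t))%C with (Ci * V t)%C by ring.
        field. split; [exact HV|exact Ci_neq_0]. }
    replace (Ci * (2 / V t + Ci * RtoC (dxi t)))%C with (2 * Ci / V t + Ci * Ci * RtoC (dxi t))%C
      by (field; exact HV).
    replace (RtoC (-2)) with (- (2))%C by (rewrite <- RtoC_opp; reflexivity).
    rewrite Ci_sq. field. exact HV.
Qed.

Let HA := loewner_drift_imaginary.
Let Hdrift : imaginary_drift loewner_drift \/ real_drift loewner_drift := or_introl HA.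

(** The point [gamma (T - a)] is where the solution born at [xi a] at time [a] ends.
    Uniqueness of solutions gives injectivity, both of the curve and of the flow;
    [backward_dichotomy] shows that the flow misses nothing but the curve. *)
Lemma smooth_driver_generates_curve :
  exists gamma, upward_driver_of T xi gamma /\
    forall a V, 0 <= a <= T -> singular_solution loewner_drift M a V ->
      gamma (T - a) = (RtoC (xi T) + Ci * V T)%C.
Proof.
  destruct (function_of_relation (singular_solution loewner_drift M)) as [S HS].
  { intros a. apply singular_existence; auto using loewner_drift_cont, loewner_drift_bound. }
  destruct (function_of_relation (fun v W => 0 < Re v ->
     W 0 = v /\ bessel_on loewner_drift (fun t => 0 <= t) W)) as [Phi HPhi].
  { intros v. destruct (Rlt_dec 0 (Re v)) as [Hv | Hv].
    - destruct (bessel_existence loewner_drift M HM loewner_drift_cont loewner_drift_bound 0 v) as [W HW].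
      + split; [exact Hv|now left].
      + now exists W.
    - exists (fun _ => 0%C). tauto. }
  set (start := fun z : C => (- (Ci) * (z - RtoC (xi 0)))%C).
  assert (Hstart : forall z, upper_half_plane z -> 0 < Re (start z)).
  { intros z Hz. unfold start, upper_half_plane in *. destruct z as [x y]; unfold Re; simpl in *. lra. }
  set (h := fun t z => (RtoC (xi t) + Ci * Phi (start z) t)%C).
  assert (HPb : forall z a b, upper_half_plane z -> 0 <= a ->
     bessel_on loewner_drift (fun t => a <= t <= b) (Phi (start z))).
  { intros z a b Hz Ha. bessel_restrict (HPhi (start z) (Hstart z Hz)). }
  assert (HSb : forall a c b, a < c -> bessel_on loewner_drift (fun t => c <= t <= b) (S a)).
  { intros a c b Hac. bessel_restrict HS. }
  assert (HSuniq : forall a V, singular_solution loewner_drift M a V -> a <= T -> V T = S a T).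
  { intros a V HV HaT. apply C_eq_of_Cmod_le_0. apply (le_of_geometric_error _ _ 1). intros n.
    destruct (singular_start_continuity loewner_drift M HM loewner_drift_cont loewner_drift_bound Hdrift
       a T _ (pow_half_pos n)) as [d [Hd H]].
    specialize (H a a V (S a)). lapply H; [|lra]. clear H; intros H. lapply H; [|lra]. clear H; intros H.
    lapply H; [|lra]. clear H; intros H. lapply H; [|lra]. clear H; intros H.
    specialize (H HV (HS a)). lra. }
  assert (HSS : S T T = 0%C).
  { apply C_eq_of_Cmod_le_0. replace (S T T - 0)%C with (S T T) by ring.
    apply (le_of_geometric_error _ _ 1). intros n.
    destruct (singular_to_zero loewner_drift M HM loewner_drift_cont loewner_drift_bound Hdrift
       T (S T) (HS T) _ (pow_half_pos n)) as [d [Hd H]].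
    specialize (H T). lapply H; [|lra]. lra. }
  (* otherwise both solutions agree after time [a], where one tends to 0 while the other
     keeps a positive real part *)
  assert (Hdisj : forall a W, 0 <= a < T -> bessel_on loewner_drift (fun t => a <= t <= T) W -> W T <> S a T).
  { intros a W Ha HW E. assert (HP : 0 < Re (W a)) by (apply HW; lra).
    destruct (singular_to_zero loewner_drift M HM loewner_drift_cont loewner_drift_bound Hdrift
       a (S a) (HS a) (Re (W a)) HP) as [d [Hd H]].
    destruct (small_positive d (T - a)) as [e He]; [exact Hd|lra|].
    set (t := a + e). assert (Ht : t = a + e) by reflexivity.
    assert (Et : W t = S a t).
    { apply (bessel_unique loewner_drift W (S a) t T T); [|apply HSb; lra|lra|exact E|lra].
      bessel_restrict HW. }
    assert (Hmono := bessel_Re_nondecreasing loewner_drift W a T HA HW a t).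
    specialize (H t ltac:(lra)). rewrite <- Et in H. pose proof (Cmod_ge_Re (W t)). lra. }
  assert (HSpos : forall a, 0 <= a < T -> 0 < Re (S a T)).
  { intros a Ha. apply (HS a). lra. }
  assert (Hgi : forall z w : C, (RtoC (xi T) + Ci * z = RtoC (xi T) + Ci * w)%C -> z = w).
  { intros z w E. replace z with (- (Ci) * ((RtoC (xi T) + Ci * z) - RtoC (xi T)))%C.
    - rewrite E. replace (- (Ci) * (RtoC (xi T) + Ci * w - RtoC (xi T)))%C with (- (Ci * Ci) * w)%C by ring.
      rewrite Ci_sq. ring.
    - replace (- (Ci) * (RtoC (xi T) + Ci * z - RtoC (xi T)))%C with (- (Ci * Ci) * z)%C by ring.
      rewrite Ci_sq. ring. }
  assert (Hlt : forall a b, 0 <= a < b -> b <= T -> S a T <> S b T).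
  { intros a b Hab HbT E. destruct (Req_dec b T) as [-> | Hb].
    - rewrite HSS in E. specialize (HSpos a ltac:(lra)). rewrite E in HSpos. simpl in HSpos. lra.
    - apply (Hdisj b (S a)); [lra|apply HSb; lra|exact E]. }
  exists (fun s => (RtoC (xi T) + Ci * S (T - s)%R T)%C). split.
  2:{ intros a V Ha HV. replace (T - (T - a)) with a by ring. now rewrite (HSuniq a V HV (proj2 Ha)). }
  split; [|split; [|split; [|split; [|split]]]].
  - split; [exact HT|]. intros x _.
    apply (filterlim_filter_le_1 (F := locally x)); [apply filter_le_within|].
    apply continuity_pt_filterlim. eapply is_derive_continuity_pt, xi_derive.
  - apply continuous_on_C. intros s Hs eps Heps. unfold Icc in Hs.
    destruct (singular_start_continuity loewner_drift M HM loewner_drift_cont loewner_drift_bound Hdrift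
       0 T eps Heps) as [d [Hd H]].
    exists d. split; [exact Hd|]. unfold Icc. intros r Hr Hrs. apply Rabs_def2 in Hrs.
    replace (RtoC (xi T) + Ci * S (T - r)%R T - (RtoC (xi T) + Ci * S (T - s)%R T))%C
      with (Ci * (S (T - r)%R T - S (T - s)%R T))%C by ring.
    rewrite Cmod_mult, Cmod_Ci, Rmult_1_l.
    destruct (Rle_lt_dec s r) as [Hle | Hgt].
    + apply (H (T - r) (T - s)); auto; lra.
    + rewrite Cmod_sub_comm. apply (H (T - s) (T - r)); auto; lra.
  - unfold Icc. intros s t Hs Ht E. apply Hgi in E.
    destruct (Rtotal_order s t) as [Hlt' | [-> | Hgt]]; [|reflexivity|]; exfalso.
    + apply (Hlt (T - t) (T - s)); [lra|lra|now symmetry].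
    + apply (Hlt (T - s) (T - t)); [lra|lra|exact E].
  - rewrite Rminus_0_r, HSS. ring.
  - intros t Ht. unfold upper_half_plane.
    change (0 < 0 + Im (Ci * S (T - t)%R T)%C). rewrite Im_Ci_mult, Rplus_0_l. apply HSpos. lra.
  - exists h.
    assert (Hh0 : forall z, (RtoC (xi 0) + Ci * start z)%C = z).
    { intros z. unfold start.
      replace (RtoC (xi 0) + Ci * (- (Ci) * (z - RtoC (xi 0))))%C
        with (RtoC (xi 0) + - (Ci * Ci) * (z - RtoC (xi 0)))%C by ring.
      rewrite Ci_sq. ring. }
    assert (Hstart0 : forall v, start (RtoC (xi 0) + Ci * v)%C = v).
    { intros v. unfold start.
      replace (- (Ci) * (RtoC (xi 0) + Ci * v - RtoC (xi 0)))%C with (- (Ci * Ci) * v)%C by ring.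
      rewrite Ci_sq. ring. }
    assert (Hup : forall v, upper_half_plane (RtoC (xi 0) + Ci * v)%C <-> 0 < Re v).
    { intros v. unfold upper_half_plane.
      change (Im (RtoC (xi 0) + Ci * v)%C) with (0 + Im (Ci * v)%C). rewrite Im_Ci_mult, Rplus_0_l. tauto. }
    assert (HhT : forall z, upper_half_plane z -> upper_half_plane (h T z)).
    { intros z Hz. unfold upper_half_plane, h.
      change (0 < 0 + Im (Ci * Phi (start z) T)%C). rewrite Im_Ci_mult, Rplus_0_l.
      apply (HPhi _ (Hstart z Hz)). lra. }
    split; [|split; [|split]].
    + intros z Hz. destruct (HPhi _ (Hstart z Hz)) as [P0 PB]. split.
      * unfold h. rewrite P0. apply Hh0.
      * unfold Icc. intros t Ht. destruct (PB t (proj1 Ht)) as [PR PD]. split.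
        -- intros E. apply (f_equal Im) in E. unfold h in E.
           change (0 + Im (Ci * Phi (start z) t)%C = 0) in E. rewrite Im_Ci_mult in E. lra.
        -- apply is_Cderive_within; [exact Ht|]. unfold h.
           apply (loewner_of_bessel (Phi (start z))); [lra|now apply Re_Im_neq_0|exact PD].
    + intros z Hz.
      destruct (bessel_flow_differentiable loewner_drift M HM loewner_drift_bound 0 T (Phi (start z)) HA)
        as [J [K [d [Hd HJ]]]]; [lra|apply HPb; [exact Hz|lra]|].
      apply (ex_derive_of_quadratic_error (h T) z J K (Rmin d (Im z))); [now apply Rmin_pos|].
      intros w Hw. pose proof (Rmin_l d (Im z)). pose proof (Rmin_r d (Im z)).
      assert (Hwu : upper_half_plane w).
      { assert (HI := Im_diff_bound w z (Cmod (w - z)) (Rle_refl _)). unfold upper_half_plane. lra. }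
      destruct (HPhi _ (Hstart z Hz)) as [Pz _]. destruct (HPhi _ (Hstart w Hwu)) as [Pw _].
      specialize (HJ (Phi (start w)) (HPb w 0 T Hwu (Rle_refl 0))).
      rewrite Pz, Pw in HJ.
      assert (Es : (start w - start z)%C = (- (Ci) * (w - z))%C) by (unfold start; ring).
      assert (Em : Cmod (start w - start z) = Cmod (w - z)).
      { rewrite Es, Cmod_mult, Cmod_opp, Cmod_Ci. ring. }
      rewrite Em in HJ. specialize (HJ ltac:(lra)).
      eapply Rle_trans; [|exact HJ]. right.
      rewrite <- (Rmult_1_l (Cmod (_ - _ - J * (start w - start z)))), <- Cmod_Ci, <- Cmod_mult.
      f_equal. rewrite Es. unfold h.
      replace (Ci * (Phi (start w) T - Phi (start z) T - J * (- (Ci) * (w - z))))%C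
        with (Ci * Phi (start w) T - Ci * Phi (start z) T + (Ci * Ci) * (J * (w - z)))%C by ring.
      rewrite Ci_sq. ring.
    + intros z w Hz Hw E. unfold h in E. apply Hgi in E.
      rewrite <- (Hh0 z), <- (Hh0 w).
      destruct (HPhi _ (Hstart z Hz)) as [<- _]. destruct (HPhi _ (Hstart w Hw)) as [<- _].
      do 2 f_equal.
      apply (bessel_unique loewner_drift (Phi (start z)) (Phi (start w)) 0 T T); try apply HPb; auto; lra.
    + intros w. split.
      * intros [Hw Hn]. set (v := (- (Ci) * (w - RtoC (xi T)))%C).
        assert (Hwv : w = (RtoC (xi T) + Ci * v)%C).
        { unfold v.
          replace (RtoC (xi T) + Ci * (- (Ci) * (w - RtoC (xi T))))%C
            with (RtoC (xi T) + - (Ci * Ci) * (w - RtoC (xi T)))%C by ring.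
          rewrite Ci_sq. ring. }
        assert (Hv : 0 < Re v).
        { unfold v, upper_half_plane in *. destruct w as [x y]; unfold Re; simpl in *. lra. }
        destruct (backward_dichotomy loewner_drift M HM loewner_drift_cont loewner_drift_bound Hdrift
           0 T v HA HT Hv) as [[W [HW WT]] | [t0 [Ht0 Hsing]]].
        -- exists (RtoC (xi 0) + Ci * W 0)%C.
           assert (Hz : upper_half_plane (RtoC (xi 0) + Ci * W 0)%C).
           { apply Hup. apply HW. lra. }
           split; [exact Hz|]. unfold h. rewrite Hwv, <- WT, Hstart0. do 2 f_equal.
           assert (HP0 : 0 < Re (W 0)) by (apply HW; lra).
           destruct (HPhi _ HP0) as [P0 PB].
           apply (bessel_unique loewner_drift (Phi (W 0)) W 0 T 0); [|exact HW|lra|exact P0|lra].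
           bessel_restrict PB.
        -- exfalso. apply Hn. exists (T - t0). split; [lra|].
           replace (T - (T - t0)) with t0 by ring. rewrite Hwv. now rewrite (Hsing (S t0) (HS t0)).
      * intros [z [Hz <-]]. split; [now apply HhT|]. intros [t [Ht E]]. unfold h in E. apply Hgi in E.
        apply (Hdisj (T - t) (Phi (start z))); [lra|apply HPb; [exact Hz|lra]|now symmetry].
Qed.

End Loewner.

(** * Real points meeting the driver *)

(** At time 0 only continuity is required, because a solution that lives on nonnegative times
    is differentiable there from one side only. *)
Definition right_solution (xi : R -> R) (t : R) (u : R -> R) : Prop :=
  forall r, 0 <= r < t ->
    xi r < u r /\ continuity_pt u r /\
    (0 < r -> is_derive u r (-2 / (u r - xi r))).

(** The form in which the vanishing lower limit of the distance to the driver is used. *)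
Definition touches (xi : R -> R) (t : R) (u : R -> R) : Prop :=
  forall eps d, 0 < eps -> 0 < d -> exists s, 0 <= s < t /\ t - d < s /\ u s - xi s < eps.

Section Right.

Context (xi : R -> R) (xi_cont : forall t, continuity_pt xi t).

Lemma right_solution_sub t t' u : t' <= t -> right_solution xi t u -> right_solution xi t' u.
Proof. intros H Hu r Hr. apply Hu. lra. Qed.

Lemma right_solution_gap t u r : right_solution xi t u -> 0 <= r < t ->
  exists c, 0 < c /\ forall s, 0 <= s <= r -> c <= u s - xi s.
Proof.
  intros Hu Hr. destruct (continuity_ab_min (fun s => u s - xi s) 0 r) as [m [Hm Hm']]; [lra| |].
  - intros s Hs. apply continuity_pt_minus; [apply Hu; lra|apply xi_cont].
  - exists (u m - xi m). split; [|exact Hm]. destruct (Hu m) as [H _]; lra.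
Qed.

(** [v - u] solves [D' = 2 D / ((u - xi) (v - xi))]: it keeps its sign and its
    absolute value grows. *)
Lemma right_solution_spread t u v : right_solution xi t u -> right_solution xi t v -> u 0 <= v 0 ->
  forall s r, 0 <= s -> s <= r -> r < t -> 0 <= v s - u s <= v r - u r.
Proof.
  intros Hu Hv H0 s r Hs Hsr Hrt.
  destruct (right_solution_gap t u r Hu) as [c1 [C1 D1]]; [lra|].
  destruct (right_solution_gap t v r Hv) as [c2 [C2 D2]]; [lra|].
  set (K := 2 / (c1 * c2)).
  assert (Hcc : 0 < c1 * c2) by now apply Rmult_lt_0_compat.
  set (k := fun x => 2 / ((u x - xi x) * (v x - xi x))).
  assert (Hk : forall x, 0 < x <= r -> 0 <= k x <= K /\
     is_derive (fun y => u y - v y) x (k x * (u x - v x))).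
  { intros x Hx. unfold k. destruct (Hu x) as [U1 [_ U2]]; [lra|]. destruct (Hv x) as [V1 [_ V2]]; [lra|].
    specialize (D1 x ltac:(lra)). specialize (D2 x ltac:(lra)).
    assert (Hp : 0 < (u x - xi x) * (v x - xi x)) by (apply Rmult_lt_0_compat; lra).
    split; [split|].
    - left. apply Rdiv_lt_0_compat; lra.
    - apply Rmult_le_compat_l; [lra|]. apply Rinv_le_contravar; [exact Hcc|].
      apply Rmult_le_compat; lra.
    - eapply is_derive_eq; [apply is_derive_Rminus; [apply U2|apply V2]; lra|]. field. lra. }
  assert (Hc : forall x, 0 <= x <= r -> continuity_pt (fun y => u y - v y) x).
  { intros x Hx. apply continuity_pt_minus; [apply Hu|apply Hv]; lra. }
  assert (He : forall x, is_derive (fun y => exp (- K * y)) x (- K * exp (- K * x))).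
  { intros x. auto_derive; [exact I|ring]. }
  assert (Hle : forall x, 0 <= x <= r -> u x <= v x).
  { intros x Hx. pose proof (exp_pos (- K * x)) as Hex.
    enough ((u x - v x) * exp (- K * x) <= 0) by nra.
    apply (nonpos_barrier (fun y => (u y - v y) * exp (- K * y))
      (fun y => k y * (u y - v y) * exp (- K * y) + (u y - v y) * (- K * exp (- K * y))) 0 r); [| | | |exact Hx].
    - intros y Hy.
      exact (is_derive_Rmult (fun y => u y - v y) _ y _ _ (proj2 (Hk y ltac:(lra))) (He y)).
    - intros y Hy. apply continuity_pt_mult; [now apply Hc|eapply is_derive_continuity_pt, He].
    - intros y Hy Hpos. destruct (Hk y) as [Hky _]; [lra|].
      replace (_ + _) with ((k y - K) * ((u y - v y) * exp (- K * y))) by ring. nra.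
    - rewrite Rmult_0_r, exp_0. lra. }
  split; [specialize (Hle s ltac:(lra)); lra|].
  enough (- (u s - v s) <= - (u r - v r)) by lra.
  apply (derive_nonneg_le (fun y => - (u y - v y)) (fun y => - (k y * (u y - v y)))); [exact Hsr| | |].
  - intros y Hy. apply is_derive_Ropp. apply Hk. lra.
  - intros y Hy. apply continuity_pt_opp. apply Hc. lra.
  - intros y Hy. specialize (Hle y ltac:(lra)). destruct (Hk y) as [Hky _]; [lra|]. nra.
Qed.

(** If [v 0 <= u 0] then [v - xi <= u - xi] before time [t], where [v - xi] is bounded
    below and [u - xi] is not. *)
Lemma touching_before t t' u v :
  0 < t < t' -> right_solution xi t u -> touches xi t u -> right_solution xi t' v -> u 0 < v 0.
Proof.
  intros Ht Hu Hto Hv. destruct (Rlt_le_dec (u 0) (v 0)) as [|Hle]; [assumption|exfalso].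
  destruct (right_solution_gap t' v t Hv) as [c [Hc Hc']]; [lra|].
  destruct (Hto c 1) as [s [Hs [_ Hsmall]]]; [exact Hc|lra|].
  assert (H := right_solution_spread t v u (right_solution_sub t' t v ltac:(lra) Hv) Hu Hle s s).
  specialize (Hc' s ltac:(lra)). lra.
Qed.

Lemma touching_unique t u v : 0 < t -> right_solution xi t u -> right_solution xi t v ->
  touches xi t v -> v 0 <= u 0.
Proof.
  intros Ht Hu Hv Hto. destruct (Rle_lt_dec (v 0) (u 0)) as [|Hlt]; [assumption|exfalso].
  destruct (Hto (v 0 - u 0) 1) as [s [Hs [_ Hsmall]]]; [lra|lra|].
  assert (H := right_solution_spread t u v Hu Hv (Rlt_le _ _ Hlt) 0 s).
  destruct (Hu s Hs) as [Hp _]. lra.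
Qed.

Lemma right_solution_decreasing t u : right_solution xi t u ->
  forall s r, 0 <= s -> s <= r -> r < t -> u r <= u s.
Proof.
  intros Hu s r Hs Hsr Hr. enough (- u s <= - u r) by lra.
  apply (derive_nonneg_le (fun y => - u y) (fun y => - (-2 / (u y - xi y)))); [exact Hsr| | |].
  - intros y Hy. apply is_derive_Ropp. apply Hu; lra.
  - intros y Hy. apply continuity_pt_opp. apply Hu. lra.
  - intros y Hy. destruct (Hu y) as [H _]; [lra|].
    replace (- (-2 / (u y - xi y))) with (2 / (u y - xi y)) by (field; lra).
    left. apply Rdiv_lt_0_compat; lra.
Qed.

Lemma touching_above_driver t u : 0 < t -> right_solution xi t u -> touches xi t u ->
  forall r, 0 <= r <= t -> xi r <= u 0.
Proof.
  intros Ht Hu Hto r [Hr0 [Hr | ->]].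
  - destruct (Hu r ltac:(lra)) as [H _].
    assert (H1 := right_solution_decreasing t u Hu 0 r). lra.
  - destruct (Rle_lt_dec (xi t) (u 0)) as [|Hlt]; [assumption|exfalso].
    destruct (continuity_pt_near xi t (xi t - u 0)) as [d [Hd Hd']]; [apply xi_cont|lra|].
    destruct (small_positive d t Hd Ht) as [h Hh].
    specialize (Hd' (t - h) ltac:(lra)). destruct (Hu (t - h)) as [H _]; [lra|].
    assert (H1 := right_solution_decreasing t u Hu 0 (t - h)). lra.
Qed.

(** While [u >= B >= xi] one has [((u - B)^2)' >= -4]. *)
Lemma touching_upper_bound t u a B : 0 <= a < t -> right_solution xi t u -> touches xi t u ->
  (forall r, a <= r <= t -> xi r <= B) -> u a <= B + 2 * sqrt (t - a).
Proof.
  intros Ha Hu Hto HB. apply (le_of_geometric_error _ _ 1). intros n.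
  pose proof (pow_half_pos n) as He. set (e := (1 / 2) ^ n) in *.
  pose proof (sqrt_pos (t - a)) as Hsq.
  destruct (Rle_lt_dec (u a) (B + e)) as [|Hlt]; [lra|].
  destruct (Hto e (t - a)) as [s [Hs [Hs' Hsmall]]]; [exact He|lra|].
  assert (Has : a < s) by lra.
  assert (HBs : xi s <= B) by (apply HB; lra).
  destruct (IVT_interv (fun r => (B + e) - u r) a s) as [z [Hz Ez]]; [|exact Has|lra|lra|].
  { intros r Hr. apply continuity_pt_minus; [|apply Hu; lra].
    apply continuity_pt_cst. }
  assert (Hge : forall r, a <= r <= z -> B + e <= u r).
  { intros r Hr. assert (H := right_solution_decreasing t u Hu r z). lra. }
  assert (Hmon : (u a - (B + e)) * (u a - (B + e)) + 4 * a <= (u z - (B + e)) * (u z - (B + e)) + 4 * z).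
  { apply (derive_nonneg_le (fun r => (u r - (B + e)) * (u r - (B + e)) + 4 * r)
      (fun r => ((-2 / (u r - xi r) - 0) * (u r - (B + e)) + (u r - (B + e)) * (-2 / (u r - xi r) - 0)) + 4)).
    - lra.
    - intros r Hr. apply is_derive_Rplus; [|auto_derive; [exact I|ring]].
      assert (Hud : is_derive (fun r => u r - (B + e)) r (-2 / (u r - xi r) - 0)).
      { apply is_derive_Rminus; [apply Hu; lra|apply is_derive_Rconst]. }
      exact (is_derive_Rmult _ _ r _ _ Hud Hud).
    - intros r Hr. apply continuity_pt_plus; [|apply derivable_continuous_pt; reg].
      assert (Hcu : continuity_pt (fun r => u r - (B + e)) r).
      { apply continuity_pt_minus; [apply Hu; lra|apply continuity_pt_cst]. }
      now apply continuity_pt_mult.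
    - intros r Hr. destruct (Hu r) as [Hp _]; [lra|].
      specialize (Hge r ltac:(lra)). specialize (HB r ltac:(lra)).
      replace (_ + 4) with (4 * ((B + e) - xi r) / (u r - xi r)) by (field; lra).
      apply Rmult_le_pos; [lra|]. left. apply Rinv_0_lt_compat. lra. }
  assert (Eu : u z = B + e) by lra. rewrite Eu in Hmon.
  enough (u a - (B + e) <= 2 * sqrt (t - a)) by lra.
  apply Rsqr_incr_0_var; [|lra]. unfold Rsqr.
  replace (2 * sqrt (t - a) * (2 * sqrt (t - a))) with (4 * (sqrt (t - a) * sqrt (t - a))) by ring.
  rewrite sqrt_sqrt by lra. lra.
Qed.

End Right.

(** The solution from [x] meets the driver from the right at time [t]. Two-sided differentiability
    at time 0 and convergence at time [t] hold for the solutions constructed below; they make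
    scaling immediate and imply [hits_at]. *)
Definition right_endpoint (xi : R -> R) (t x : R) : Prop :=
  exists u, u 0 = x /\
    (forall r, 0 <= r < t -> xi r < u r /\ is_derive u r (-2 / (u r - xi r))) /\
    (forall eps, 0 < eps -> exists d, 0 < d /\ forall r, 0 <= r < t -> t - d < r -> u r - xi r < eps).

Lemma right_endpoint_solution xi t x : 0 < t -> right_endpoint xi t x ->
  exists u, u 0 = x /\ right_solution xi t u /\ touches xi t u.
Proof.
  intros Ht [u [U0 [U1 U2]]]. exists u. split; [exact U0|]. split.
  - intros r Hr. destruct (U1 r Hr) as [A B]. split; [exact A|]. split; [|now intros _].
    eapply is_derive_continuity_pt, B.
  - intros eps d Heps Hd. destruct (U2 eps Heps) as [d' [Hd' H]].
    destruct (small_positive d d' Hd Hd') as [h Hh].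
    destruct (small_positive h t) as [h' Hh']; [lra|exact Ht|].
    exists (t - h'). split; [lra|]. split; [lra|]. apply H; lra.
Qed.

Lemma right_endpoint_scale xi t x c : 0 < c -> right_endpoint xi t x ->
  right_endpoint (fun s => xi (c ^ 2 * s) / c) (t / c ^ 2) (x / c).
Proof.
  intros Hc [u [U0 [U1 U2]]]. assert (Hc2 : 0 < c ^ 2) by now apply pow_lt.
  assert (Hr' : forall r, 0 <= r < t / c ^ 2 -> 0 <= c ^ 2 * r < t).
  { intros r Hr. split; [apply Rmult_le_pos; lra|].
    apply Rlt_le_trans with (c ^ 2 * (t / c ^ 2)); [apply Rmult_lt_compat_l; lra|right; field; lra]. }
  exists (fun s => u (c ^ 2 * s) / c). split; [|split].
  - rewrite Rmult_0_r, U0. reflexivity.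
  - intros r Hr. destruct (U1 _ (Hr' r Hr)) as [A B]. split.
    + apply Rmult_lt_compat_r; [now apply Rinv_0_lt_compat|exact A].
    + assert (D : is_derive (fun s => u (c ^ 2 * s)) r (c ^ 2 * (-2 / (u (c ^ 2 * r) - xi (c ^ 2 * r))))).
      { apply (is_derive_comp u (fun s => c ^ 2 * s)); [exact B|]. auto_derive; [exact I|ring]. }
      eapply is_derive_eq.
      * apply (is_derive_Rmult (fun s => u (c ^ 2 * s)) (fun _ => / c)); [exact D|apply is_derive_Rconst].
      * cbv beta. generalize dependent (u (c ^ 2 * r)). generalize (xi (c ^ 2 * r)). intros y z Hyz _ _.
        field. lra.
  - intros eps Heps. destruct (U2 (c * eps)) as [d [Hd H]]; [now apply Rmult_lt_0_compat|].
    exists (d / c ^ 2). split; [now apply Rdiv_lt_0_compat|]. intros r Hr Hrd.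
    specialize (H (c ^ 2 * r) (Hr' r Hr)).
    assert (Hx : t - d < c ^ 2 * r).
    { replace (t - d) with (c ^ 2 * (t / c ^ 2 - d / c ^ 2)) by (field; lra).
      apply Rmult_lt_compat_l; lra. }
    specialize (H Hx). apply Rmult_lt_reg_l with c; [exact Hc|].
    replace (c * (u (c ^ 2 * r) / c - xi (c ^ 2 * r) / c)) with (u (c ^ 2 * r) - xi (c ^ 2 * r)) by (field; lra).
    exact H.
Qed.

Section SmoothRight.

Context (xi dxi : R -> R) (T M : R).
Context (HT : 0 < T) (HM : 0 < M).
Context (xi_derive : forall t, is_derive xi t (dxi t)).
Context (dxi_cont : forall t, continuity_pt dxi t).
Context (dxi_bound : forall t, - 1 <= t <= T + 1 -> Rabs (dxi t) <= M).

Lemma xi_continuity t : continuity_pt xi t.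
Proof. eapply is_derive_continuity_pt, xi_derive. Qed.

(** Run from the meeting point backwards in time, [u - xi] solves the same
    equation as before, now on the positive axis and with real drift. *)
Lemma right_endpoint_exists t : 0 < t <= T -> exists x, right_endpoint xi t x.
Proof.
  intros Ht. set (eta := fun s => RtoC (dxi (clamp (- 1) (T + 1) (- s)))).
  assert (Hc : Ccontinuous eta).
  { split; intros s; simpl.
    - apply (continuity_pt_comp Ropp (fun s => dxi (clamp (- 1) (T + 1) s))).
      + apply derivable_continuous_pt. reg.
      + apply (continuity_pt_clamp dxi); [lra|auto].
    - apply continuity_pt_cst. }
  assert (Hb : forall s, Cmod (eta s) <= M).
  { intros s. unfold eta. rewrite Cmod_R. apply dxi_bound, clamp_range. lra. }
  assert (Hreal : real_drift eta) by (intros s; reflexivity).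
  destruct (singular_existence eta M HM Hc Hb (or_intror Hreal) (- t)) as [V HV].
  assert (HVr := singular_real eta M HM Hc Hb (or_intror Hreal) (- t) V Hreal HV).
  set (u := fun r => xi r + Re (V (- r))). exists (u 0), u. split; [reflexivity|]. split.
  - intros r Hr. destruct HV as [HV _]. destruct (HV (- r)) as [P [D _]]; [lra|].
    unfold u. split; [lra|].
    change (Re (2 / V (- r)%R + eta (- r)%R)%C) with (Re (2 / V (- r)%R)%C + Re (eta (- r))) in D.
    rewrite Re_two_div, HVr in D by (lra || now apply Re_Im_neq_0).
    unfold eta in D. simpl in D. rewrite Ropp_involutive, clamp_id in D by lra.
    assert (D' : is_derive (fun s => Re (V (- s))) r
       (-1 * (2 * Re (V (- r)) / (Re (V (- r)) * (Re (V (- r)) * 1) + 0 * (0 * 1)) + dxi r))).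
    { apply (is_derive_comp (fun s => Re (V s)) Ropp); [exact D|]. auto_derive; [exact I|ring]. }
    eapply is_derive_eq; [apply is_derive_Rplus; [apply xi_derive|exact D']|].
    replace (xi r + Re (V (- r)) - xi r) with (Re (V (- r))) by ring. field. lra.
  - intros eps Heps.
    destruct (singular_to_zero eta M HM Hc Hb (or_intror Hreal) (- t) V HV eps Heps) as [d [Hd H]].
    exists d. split; [exact Hd|]. intros r Hr Hrd. unfold u.
    specialize (H (- r) ltac:(lra)). pose proof (Cmod_ge_Re (V (- r))). lra.
Qed.

Lemma driver_oscillation s t : 0 <= s -> s <= t -> t <= T -> xi t <= xi s + M * (t - s).
Proof.
  intros Hs Hst Ht. enough (M * s - xi s <= M * t - xi t) by lra.
  apply (derive_nonneg_le (fun r => M * r - xi r) (fun r => M - dxi r)); [exact Hst| | |].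
  - intros r Hr. apply is_derive_Rminus; [auto_derive; [exact I|ring]|apply xi_derive].
  - intros r Hr. apply continuity_pt_minus; [apply derivable_continuous_pt; reg|apply xi_continuity].
  - intros r Hr. specialize (dxi_bound r ltac:(lra)). apply Rabs_le_between in dxi_bound. lra.
Qed.

(** Monotonicity is the order of meeting. For the modulus of continuity, the solution that meets the
    driver at time [t] is at time [s] within [M (t - s) + 2 sqrt (t - s)] of the driver, and distances
    between solutions only shrink backwards in time. *)
Lemma right_endpoint_function : exists p : R -> R, p 0 = xi 0 /\
  (forall t, 0 < t <= T -> right_endpoint xi t (p t)) /\
  (forall s t, 0 <= s -> s < t -> t <= T -> p s < p t) /\
  (forall s t, 0 <= s -> s <= t -> t <= T -> p t <= p s + M * (t - s) + 2 * sqrt (t - s)).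
Proof.
  destruct (function_of_relation (fun t x => (t = 0 -> x = xi 0) /\ (0 < t <= T -> right_endpoint xi t x)))
    as [p Hp].
  { intros t. destruct (excluded_middle_informative (0 < t <= T)) as [Ht | Ht].
    - destruct (right_endpoint_exists t Ht) as [x Hx]. exists x. split; [lra|now intros _].
    - exists (xi 0). split; [reflexivity|tauto]. }
  assert (Hp0 : p 0 = xi 0) by (apply Hp; reflexivity).
  assert (Hpt : forall t, 0 < t <= T -> exists u, u 0 = p t /\ right_solution xi t u /\ touches xi t u).
  { intros t Ht. apply right_endpoint_solution; [lra|]. now apply Hp. }
  exists p. split; [exact Hp0|]. split; [|split].
  - intros t Ht. now apply Hp.
  - intros s t Hs Hst HtT. destruct (Hpt t) as [v [V0 [V1 V2]]]; [lra|]. rewrite <- V0.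
    destruct (Req_dec s 0) as [-> | Hs0].
    + rewrite Hp0. destruct (V1 0) as [H _]; [lra|exact H].
    + destruct (Hpt s) as [u [U0 [U1 U2]]]; [lra|]. rewrite <- U0.
      apply (touching_before xi xi_continuity s t); auto; lra.
  - intros s t Hs [Hst | ->] HtT.
    2:{ replace (t - t) with 0 by ring. rewrite sqrt_0. lra. }
    destruct (Hpt t) as [v [V0 [V1 V2]]]; [lra|].
    assert (Hv : v s <= xi s + M * (t - s) + 2 * sqrt (t - s)).
    { apply (touching_upper_bound xi t v s (xi s + M * (t - s))); auto.
      intros r Hr. pose proof (driver_oscillation s r Hs ltac:(lra) ltac:(lra)).
      assert (M * (r - s) <= M * (t - s)) by (apply Rmult_le_compat_l; lra). lra. }
    destruct (Req_dec s 0) as [-> | Hs0].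
    + rewrite <- V0, Hp0. exact Hv.
    + destruct (Hpt s) as [u [U0 [U1 U2]]]; [lra|]. rewrite <- U0, <- V0.
      assert (Huv : u 0 < v 0) by (apply (touching_before xi xi_continuity s t); auto; lra).
      enough (v 0 - u 0 <= v s - xi s) by lra.
      apply (le_of_geometric_error _ _ 1). intros n. pose proof (pow_half_pos n) as He.
      assert (Hcv : continuity_pt (fun r => v r - xi r) s).
      { apply continuity_pt_minus; [apply V1; lra|apply xi_continuity]. }
      destruct (continuity_pt_near _ s ((1 / 2) ^ n) Hcv He) as [d [Hd Hd']].
      destruct (U2 1 d) as [r [Hr [Hrd _]]]; [lra|exact Hd|]. specialize (Hd' r ltac:(lra)).
      assert (Hsp := right_solution_spread xi xi_continuity s u v U1
        (right_solution_sub xi t s v ltac:(lra) V1) (Rlt_le _ _ Huv) 0 r).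
      destruct (U1 r Hr) as [Hur _]. lra.
Qed.

End SmoothRight.

(** * Hitting times *)

(** The real form of [is_derive_within], in which the symmetry [x |-> - x] is a change of sign;
    it reduces points on the left of the driver to points on the right. *)
Definition derive_within_R (D : R -> Prop) (u : R -> R) (t l : R) : Prop :=
  forall eps, 0 < eps -> exists d, 0 < d /\
    forall s, D s -> Rabs (s - t) < d -> Rabs (u s - u t - (s - t) * l) <= eps * Rabs (s - t).

Lemma Cmod_RtoC_error (u : R -> R) (s t l : R) :
  Cmod (RtoC (u s) - RtoC (u t) - RtoC (s - t) * RtoC l) = Rabs (u s - u t - (s - t) * l).
Proof. now rewrite <- RtoC_minus, <- RtoC_mult, <- RtoC_minus, Cmod_R. Qed.

Lemma derive_within_R_iff (D : R -> Prop) (u : R -> R) (t l : R) : D t ->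
  (is_derive_within D (fun s => RtoC (u s)) t (RtoC l) <-> derive_within_R D u t l).
Proof.
  intros Dt.
  assert (HN : forall s, norm (minus (minus (RtoC (u s)) (RtoC (u t))) (scal (minus s t) (RtoC l))
       : C_R_NormedModule) = Rabs (u s - u t - (s - t) * l)).
  { intros s. rewrite norm_C_R, <- Cmod_RtoC_error. f_equal.
    apply C_eq; simpl; unfold minus, plus, opp, scal; simpl; unfold mult; simpl; ring. }
  split.
  - intros [_ H] eps Heps.
    assert (Ht : is_filter_lim (within D (locally t)) t).
    { intros P HP. unfold within. eapply filter_imp; [|exact HP]. auto. }
    destruct (H t Ht (mkposreal eps Heps)) as [d Hd].
    exists d. split; [apply cond_pos|]. intros s Ds Hs.
    rewrite <- HN. exact (Hd s Hs Ds).
  - intros H. split; [apply (is_linear_scal_l (K := R_AbsRing) (V := C_R_NormedModule))|].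
    intros x Hx.
    apply within_filter_lim in Hx; [|exact Dt]. subst x. intros eps. destruct (H eps (cond_pos eps)) as [d [Hd Hd']].
    exists (mkposreal d Hd). intros s Hs Ds.
    change (norm (minus (minus (RtoC (u s)) (RtoC (u t))) (scal (minus s t) (RtoC l)) : C_R_NormedModule)
      <= eps * Rabs (s - t)).
    rewrite HN. now apply Hd'.
Qed.

Lemma hits_at_real (T : R) (xi : R -> R) (x t : R) :
  hits_at T xi x t <->
  0 < t <= T /\ exists u : R -> R, u 0 = x /\
    (forall r, 0 <= r < t -> u r <> xi r /\ derive_within_R (Ico 0 t) u r (-2 / (u r - xi r))) /\
    is_liminf_left (fun s => Rabs (u s - xi s)) t 0.
Proof.
  assert (Hv : forall (u : R -> R) r, u r <> xi r ->
    (RtoC (-2) / (RtoC (u r) - RtoC (xi r)))%C = RtoC (-2 / (u r - xi r))).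
  { intros u r Hne. rewrite RtoC_div, RtoC_minus; [reflexivity|lra]. }
  split; intros [Ht [u H]]; (split; [exact Ht|]); exists u.
  - destruct H as [[U0 U1] Hl]. split; [now apply RtoC_inj|]. split; [|exact Hl].
    intros r Hr. destruct (U1 r Hr) as [A B].
    assert (Hne : u r <> xi r) by congruence. split; [exact Hne|].
    apply derive_within_R_iff; [exact Hr|]. rewrite <- Hv by exact Hne. exact B.
  - destruct H as [U0 [U1 Hl]]. split; [|exact Hl]. split; [now rewrite U0|].
    intros r Hr. destruct (U1 r Hr) as [A B]. split; [intros E; now apply A, RtoC_inj|].
    rewrite Hv by exact A. now apply derive_within_R_iff.
Qed.

Lemma is_liminf_left_ext f g t l : (forall s, f s = g s) -> is_liminf_left f t l -> is_liminf_left g t l.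
Proof.
  intros E H eps. destruct (H eps) as [H1 [d H2]]. split.
  - intros d'. destruct (H1 d') as [s Hs]. exists s. now rewrite <- E.
  - exists d. intros s Hs. rewrite <- E. now apply H2.
Qed.

Lemma hits_at_opp T xi x t : hits_at T xi x t -> hits_at T (fun s => - xi s) (- x) t.
Proof.
  rewrite !hits_at_real. intros [Ht [u [U0 [U1 Hl]]]]. split; [exact Ht|].
  exists (fun s => - u s). split; [now rewrite U0|]. split.
  - intros r Hr. destruct (U1 r Hr) as [A B]. split; [lra|].
    intros eps Heps. destruct (B eps Heps) as [d [Hd Hd']]. exists d. split; [exact Hd|].
    intros s Ds Hs. specialize (Hd' s Ds Hs).
    replace (-2 / (- u r - - xi r)) with (- (-2 / (u r - xi r))) by (field; lra).
    replace (- u s - - u r - (s - r) * - (-2 / (u r - xi r)))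
      with (- (u s - u r - (s - r) * (-2 / (u r - xi r)))) by ring.
    now rewrite Rabs_Ropp.
  - apply (is_liminf_left_ext (fun s => Rabs (u s - xi s))); [|exact Hl].
    intros s. rewrite <- Rabs_Ropp. f_equal. ring.
Qed.

Lemma hits_at_opp_iff T xi x t : hits_at T (fun s => - xi s) (- x) t <-> hits_at T xi x t.
Proof.
  split; [|apply hits_at_opp]. intros H. apply hits_at_opp in H.
  rewrite hits_at_real in H |- *. destruct H as [Ht [u [U0 [U1 Hl]]]].
  split; [exact Ht|]. exists u. split; [lra|]. split.
  - intros r Hr. specialize (U1 r Hr). now rewrite Ropp_involutive in U1.
  - eapply is_liminf_left_ext; [|exact Hl]. intros s; simpl. now rewrite Ropp_involutive.
Qed.

Lemma derive_within_R_interior (a b : R) u t l : a < t < b ->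
  derive_within_R (Ico a b) u t l -> is_derive u t l.
Proof.
  intros Ht H. apply is_derive_Reals. intros eps Heps.
  destruct (H (eps / 2)) as [d [Hd Hd']]; [lra|].
  assert (Hm : 0 < Rmin d (Rmin (t - a) (b - t))) by (repeat apply Rmin_pos; lra).
  exists (mkposreal _ Hm). intros h Hh0 Hh. simpl in Hh.
  pose proof (Rmin_l d (Rmin (t - a) (b - t))). pose proof (Rmin_r d (Rmin (t - a) (b - t))).
  pose proof (Rmin_l (t - a) (b - t)). pose proof (Rmin_r (t - a) (b - t)).
  assert (Hab : - h <= Rabs h /\ h <= Rabs h).
  { split; [rewrite <- Rabs_Ropp|]; apply Rle_abs. }
  specialize (Hd' (t + h)). replace (t + h - t) with h in Hd' by ring.
  specialize (Hd' ltac:(unfold Ico; lra) ltac:(lra)).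
  replace ((u (t + h) - u t) / h - l) with ((u (t + h) - u t - h * l) / h) by (field; exact Hh0).
  unfold Rdiv at 1. rewrite Rabs_mult, Rabs_inv.
  assert (Hpos : 0 < Rabs h) by now apply Rabs_pos_lt.
  apply Rle_lt_trans with (eps / 2 * Rabs h * / Rabs h).
  - apply Rmult_le_compat_r; [left; now apply Rinv_0_lt_compat|exact Hd'].
  - rewrite Rmult_assoc, Rinv_r by lra. lra.
Qed.

Lemma hits_at_right_solution (T : R) (xi : R -> R) (x t : R) :
  (forall s, continuity_pt xi s) -> xi 0 < x -> hits_at T xi x t ->
  0 < t <= T /\ exists u, u 0 = x /\ right_solution xi t u /\ touches xi t u.
Proof.
  intros Hxi Hx H. apply hits_at_real in H. destruct H as [Ht [u [U0 [U1 Hl]]]].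
  split; [exact Ht|].
  assert (Hd : forall r, 0 < r < t -> is_derive u r (-2 / (u r - xi r))).
  { intros r Hr. apply (derive_within_R_interior 0 t); [exact Hr|]. apply U1. lra. }
  (* [u] is only differentiable from the right at time 0: continue it by a constant *)
  set (v := fun s => u (Rmax 0 s)).
  assert (Ev : forall r, 0 <= r -> v r = u r) by (intros r Hr; unfold v; now rewrite Rmax_right).
  assert (Hdv : forall r, 0 < r < t -> is_derive v r (-2 / (v r - xi r))).
  { intros r Hr. rewrite Ev by lra. apply (is_derive_ext_loc u); [|now apply Hd].
    exists (mkposreal r (proj1 Hr)). intros s Hs. change (Rabs (s - r) < r) in Hs.
    apply Rabs_def2 in Hs. symmetry. apply Ev. lra. }
  assert (Hcv : forall r, 0 <= r < t -> continuity_pt v r).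
  { intros r Hr. destruct (Req_dec r 0) as [-> | Hr0].
    2:{ eapply is_derive_continuity_pt, Hdv. lra. }
    destruct (U1 0) as [_ D]; [lra|]. set (l := -2 / (u 0 - xi 0)) in D.
    intros eps Heps. destruct (D 1) as [d [Hd0 Hd1]]; [lra|].
    set (K := 1 + Rabs l). assert (HK : 0 < K) by (unfold K; pose proof (Rabs_pos l); lra).
    assert (HeK : 0 < eps / K) by now apply Rdiv_lt_0_compat.
    destruct (small_positive d t Hd0) as [h1 Hh1]; [lra|].
    destruct (small_positive h1 (eps / K)) as [h Hh]; [lra|exact HeK|].
    exists h. split; [lra|]. intros s [_ Hs]. simpl in *. unfold R_dist in *.
    destruct (Rle_lt_dec 0 s) as [Hs0 | Hs0].
    - rewrite !Ev by lra. pose proof (Rle_abs (s - 0)).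
      specialize (Hd1 s ltac:(unfold Ico; lra) ltac:(lra)).
      apply Rle_lt_trans with (K * Rabs (s - 0)).
      + replace (u s - u 0) with ((u s - u 0 - (s - 0) * l) + (s - 0) * l) by ring.
        eapply Rle_trans; [apply Rabs_triang|]. rewrite Rabs_mult. unfold K. lra.
      + apply Rlt_le_trans with (K * (eps / K)); [apply Rmult_lt_compat_l; lra|right; field; lra].
    - unfold v. rewrite Rmax_left, Rmax_left by lra. rewrite Rminus_diag, Rabs_R0. exact Heps. }
  assert (Hne : forall r, 0 <= r < t -> v r <> xi r).
  { intros r Hr. rewrite Ev by lra. apply U1, Hr. }
  assert (Hpos : forall r, 0 <= r < t -> xi r < v r).
  { intros r Hr. destruct (Rtotal_order (v r) (xi r)) as [Hlt | [E | Hgt]]; [|now apply Hne in E|exact Hgt].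
    exfalso. assert (v 0 = x) by (rewrite Ev by lra; exact U0).
    assert (Hr0 : 0 < r) by (destruct (Req_dec r 0) as [-> |]; lra).
    destruct (IVT_interv (fun s => xi s - v s) 0 r) as [z [Hz Ez]]; [|exact Hr0|lra|lra|].
    - intros s Hs. apply continuity_pt_minus; [apply Hxi|apply Hcv; lra].
    - apply (Hne z); lra. }
  exists v. split; [rewrite Ev by lra; exact U0|]. split.
  - intros r Hr. split; [now apply Hpos|]. split; [now apply Hcv|]. intros Hr0. apply Hdv. lra.
  - intros eps d Heps Hd0. destruct (Hl (mkposreal eps Heps)) as [H1 _].
    assert (Hm : 0 < Rmin d t) by (apply Rmin_pos; lra).
    pose proof (Rmin_l d t). pose proof (Rmin_r d t).
    destruct (H1 (mkposreal _ Hm)) as [s [Hs Hs']]. simpl in Hs, Hs'.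
    exists s. split; [lra|]. split; [lra|]. rewrite Ev by lra.
    pose proof (Rle_abs (u s - xi s)). lra.
Qed.

Lemma right_endpoint_hits_at (T : R) (xi : R -> R) (x t : R) :
  0 < t <= T -> right_endpoint xi t x -> hits_at T xi x t.
Proof.
  intros Ht [u [U0 [U1 U2]]]. split; [exact Ht|]. exists u. split; [split|].
  - now rewrite U0.
  - intros r Hr. destruct (U1 r Hr) as [A B]. split.
    + intros E. apply RtoC_inj in E. lra.
    + apply is_Cderive_within; [exact Hr|]. eapply is_Cderive_eq.
      * apply is_Cderive_RtoC, B.
      * rewrite RtoC_div, RtoC_minus; [reflexivity|lra].
  - assert (Hsmall : forall eps, 0 < eps -> exists d, 0 < d <= t /\
      forall r, t - d < r < t -> Rabs (u r - xi r) < eps).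
    { intros eps Heps. destruct (U2 eps Heps) as [d [Hd H]]. exists (Rmin d t).
      pose proof (Rmin_l d t). pose proof (Rmin_r d t).
      assert (0 < Rmin d t) by (apply Rmin_pos; lra). split; [lra|]. intros r Hr.
      destruct (U1 r ltac:(lra)) as [A _]. rewrite Rabs_pos_eq by lra. apply H; lra. }
    intros eps. split.
    + intros d. destruct (Hsmall eps (cond_pos eps)) as [d' [Hd' H]].
      destruct (small_positive d d') as [h Hh]; [apply cond_pos|lra|].
      exists (t - h). split; [lra|]. rewrite Rplus_0_l. apply H. lra.
    + exists (mkposreal 1 Rlt_0_1). intros s _. pose proof (cond_pos eps).
      pose proof (Rabs_pos (u s - xi s)). lra.
Qed.

Lemma hits_at_right_endpoint_iff (T : R) (xi : R -> R) (x t : R) :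
  (forall s, continuity_pt xi s) -> 0 < t <= T -> right_endpoint xi t x ->
  forall s, hits_at T xi x s <-> s = t.
Proof.
  intros Hxi Ht He s. split; [|intros ->; now apply right_endpoint_hits_at].
  intros Hs. destruct (right_endpoint_solution xi t x (proj1 Ht) He) as [u [U0 [U1 U2]]].
  assert (Hx : xi 0 < x) by (destruct (U1 0) as [H _]; [lra|now rewrite <- U0]).
  destruct (hits_at_right_solution T xi x s Hxi Hx Hs) as [Hs' [v [V0 [V1 V2]]]].
  destruct (Rtotal_order s t) as [Hlt | [-> | Hgt]]; [exfalso| reflexivity | exfalso].
  - assert (v 0 < u 0) by (apply (touching_before xi Hxi s t); auto; lra). lra.
  - assert (u 0 < v 0) by (apply (touching_before xi Hxi t s); auto; lra). lra.
Qed.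

Lemma no_hit_beyond (T : R) (xi : R -> R) (b x t : R) :
  (forall s, continuity_pt xi s) -> 0 < T -> right_endpoint xi T b -> b < x -> ~ hits_at T xi x t.
Proof.
  intros Hxi HT He Hx H. destruct (right_endpoint_solution xi T b HT He) as [u [U0 [U1 U2]]].
  assert (Hb : xi 0 < b) by (destruct (U1 0) as [H0 _]; [lra|now rewrite <- U0]).
  destruct (hits_at_right_solution T xi x t Hxi ltac:(lra) H) as [Ht [v [V0 [V1 V2]]]].
  assert (v 0 <= u 0); [|lra].
  apply (touching_unique xi Hxi t); auto; [lra|]. now apply (right_solution_sub xi T t).
Qed.

Lemma Glb_Rbar_singleton (E : R -> Prop) t : (forall s, E s <-> s = t) -> Glb_Rbar E = Finite t.
Proof.
  intros H. apply is_glb_Rbar_unique. split.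
  - intros s Hs. apply H in Hs. subst. apply Rle_refl.
  - intros b Hb. apply Hb. now apply H.
Qed.

Lemma Glb_Rbar_empty (E : R -> Prop) : (forall s, ~ E s) -> Glb_Rbar E = p_infty.
Proof.
  intros H. apply is_glb_Rbar_unique. split.
  - intros s Hs. now apply H in Hs.
  - intros b _. now destruct b.
Qed.

(** * The hitting interval *)

Lemma modulus_continuity (p : R -> R) (T M : R) : 0 < T -> 0 < M ->
  (forall s t, 0 <= s -> s < t -> t <= T -> p s < p t) ->
  (forall s t, 0 <= s -> s <= t -> t <= T -> p t <= p s + M * (t - s) + 2 * sqrt (t - s)) ->
  forall t, continuity_pt (fun s => p (clamp 0 T s)) t.
Proof.
  intros HT HM Hmon Hcont.
  assert (Hc : forall t, 0 <= t <= T -> forall eps, 0 < eps -> exists d, 0 < d /\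
     forall s, 0 <= s <= T -> Rabs (s - t) < d -> Rabs (p s - p t) < eps).
  { intros t Ht eps Heps.
    assert (HMe : 0 < eps / (2 * M)) by (apply Rdiv_lt_0_compat; lra).
    set (d := Rmin (eps / (2 * M)) ((eps / 4) ^ 2)).
    assert (Hd : 0 < d) by (apply Rmin_pos; [exact HMe|apply pow_lt; lra]).
    assert (Hmod : forall h, 0 <= h < d -> M * h + 2 * sqrt h < eps).
    { intros h Hh. unfold d in Hh.
      pose proof (Rmin_l (eps / (2 * M)) ((eps / 4) ^ 2)). pose proof (Rmin_r (eps / (2 * M)) ((eps / 4) ^ 2)).
      assert (M * h < eps / 2).
      { apply Rlt_le_trans with (M * (eps / (2 * M))); [apply Rmult_lt_compat_l; lra|right; field; lra]. }
      assert (sqrt h <= eps / 4).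
      { rewrite <- (sqrt_pow2 (eps / 4)) by lra. apply sqrt_le_1_alt. lra. }
      lra. }
    exists d. split; [exact Hd|]. intros s Hs Hst. apply Rabs_def2 in Hst.
    assert (Hle : forall a b, 0 <= a -> a <= b -> b <= T -> p a <= p b).
    { intros a b Ha [Hab | ->] Hb; [left; now apply Hmon|lra]. }
    destruct (Rle_lt_dec s t) as [H | H].
    - specialize (Hcont s t ltac:(lra) H ltac:(lra)). specialize (Hmod (t - s) ltac:(lra)).
      specialize (Hle s t ltac:(lra) H ltac:(lra)). apply Rabs_def1; lra.
    - specialize (Hcont t s ltac:(lra) ltac:(lra) ltac:(lra)). specialize (Hmod (s - t) ltac:(lra)).
      specialize (Hle t s ltac:(lra) ltac:(lra) ltac:(lra)). apply Rabs_def1; lra. }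
  intros a eps Heps.
  destruct (Hc (clamp 0 T a) (clamp_range 0 T a ltac:(lra)) eps Heps) as [d [Hd H]].
  destruct (clamp_continuity 0 T a d Hd) as [d' [Hd' H']].
  exists d'. split; [exact Hd'|]. intros s Hs. specialize (H' s Hs). simpl in *. unfold R_dist in *.
  apply H; [apply clamp_range; lra|exact H'].
Qed.

Lemma monotone_onto (p : R -> R) (T M x : R) : 0 < T -> 0 < M ->
  (forall s t, 0 <= s -> s < t -> t <= T -> p s < p t) ->
  (forall s t, 0 <= s -> s <= t -> t <= T -> p t <= p s + M * (t - s) + 2 * sqrt (t - s)) ->
  p 0 <= x <= p T -> exists t, 0 <= t <= T /\ p t = x.
Proof.
  intros HT HM Hmon Hcont Hx.
  destruct (Req_dec x (p 0)) as [-> | H0]; [exists 0; split; [lra|reflexivity]|].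
  destruct (Req_dec x (p T)) as [-> | H1]; [exists T; split; [lra|reflexivity]|].
  destruct (IVT_interv (fun s => p (clamp 0 T s) - x) 0 T) as [z [Hz Ez]].
  - intros a Ha. apply continuity_pt_minus; [|apply continuity_pt_cst].
    now apply (modulus_continuity p T M).
  - exact HT.
  - rewrite clamp_id by lra. lra.
  - rewrite clamp_id by lra. lra.
  - rewrite clamp_id in Ez by exact Hz. exists z. split; [exact Hz|lra].
Qed.

Section HittingInterval.

Context (xi dxi : R -> R) (T M : R).
Context (HT : 0 < T) (HM : 0 < M) (xi0 : xi 0 = 0).
Context (xi_derive : forall t, is_derive xi t (dxi t)).
Context (dxi_cont : forall t, continuity_pt dxi t).
Context (dxi_bound : forall t, - 1 <= t <= T + 1 -> Rabs (dxi t) <= M).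

Let xi_cont : forall t, continuity_pt xi t := fun t => is_derive_continuity_pt _ _ _ (xi_derive t).

Lemma opp_driver_continuity t : continuity_pt (fun s => - xi s) t.
Proof. apply continuity_pt_opp, xi_cont. Qed.

Lemma hitting_time_right_endpoint x t : 0 < t <= T -> right_endpoint xi t x ->
  hitting_time T xi x = Finite t.
Proof.
  intros Ht He. unfold hitting_time.
  destruct (right_endpoint_solution xi t x (proj1 Ht) He) as [u [U0 [U1 _]]].
  destruct (U1 0) as [Hx _]; [lra|]. rewrite U0 in Hx.
  destruct (Req_EM_T x (xi 0)) as [E | _]; [lra|].
  apply Glb_Rbar_singleton. now apply hits_at_right_endpoint_iff.
Qed.

Lemma hitting_time_left_endpoint x t : 0 < t <= T -> right_endpoint (fun s => - xi s) t x ->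
  hitting_time T xi (- x) = Finite t.
Proof.
  intros Ht He. unfold hitting_time.
  destruct (right_endpoint_solution _ t x (proj1 Ht) He) as [u [U0 [U1 _]]].
  destruct (U1 0) as [Hx _]; [lra|]. rewrite U0 in Hx.
  destruct (Req_EM_T (- x) (xi 0)) as [E | _]; [lra|].
  apply Glb_Rbar_singleton. intros s. rewrite <- hits_at_opp_iff, Ropp_involutive.
  apply (hits_at_right_endpoint_iff T (fun s => - xi s)); auto using opp_driver_continuity.
Qed.

(** The hitting times are the inverses of the two endpoint functions. *)
Theorem smooth_driver_hitting_interval (a b : R) :
  right_endpoint xi T b -> right_endpoint (fun s => - xi s) T a ->
  exists p q : R -> R, p 0 = 0 /\ q 0 = 0 /\
    (forall t, 0 < t <= T -> right_endpoint xi t (p t) /\ right_endpoint (fun s => - xi s) t (q t)) /\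
    hitting_interval T xi a b /\
    (forall t, 0 <= t <= T -> 0 <= p t <= b /\
       hitting_time T xi (p t) = Finite t /\ hitting_time T xi (- q t) = Finite t) /\
    (forall x, - a <= x <= 0 -> exists t, 0 <= t <= T /\ x = - q t).
Proof.
  intros Hb Ha.
  destruct (right_endpoint_function xi dxi T M HT HM xi_derive dxi_cont dxi_bound) as [p [P0 [P1 [P2 P3]]]].
  destruct (right_endpoint_function (fun s => - xi s) (fun s => - dxi s) T M HT HM) as [q [Q0 [Q1 [Q2 Q3]]]].
  { intros t. apply is_derive_Ropp, xi_derive. }
  { intros t. apply continuity_pt_opp, dxi_cont. }
  { intros t Ht. rewrite Rabs_Ropp. now apply dxi_bound. }
  rewrite xi0 in P0, Q0. rewrite Ropp_0 in Q0.
  assert (Huniq : forall f y z, (forall s, continuity_pt f s) -> right_endpoint f T y -> right_endpoint f T z -> y = z).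
  { intros f y z Hf Hy Hz.
    destruct (right_endpoint_solution f T y HT Hy) as [u [U0 [U1 U2]]].
    destruct (right_endpoint_solution f T z HT Hz) as [v [V0 [V1 V2]]].
    pose proof (touching_unique f Hf T u v HT U1 V1 V2).
    pose proof (touching_unique f Hf T v u HT V1 U1 U2). lra. }
  assert (PT : p T = b) by (apply (Huniq xi); auto; apply P1; lra).
  assert (QT : q T = a) by (apply (Huniq (fun s => - xi s)); auto using opp_driver_continuity; apply Q1; lra).
  assert (Hp : forall t, 0 <= t <= T -> hitting_time T xi (p t) = Finite t).
  { intros t Ht. destruct (Req_dec t 0) as [-> | Ht0].
    - rewrite P0. unfold hitting_time. destruct (Req_EM_T 0 (xi 0)); [reflexivity|lra].
    - apply hitting_time_right_endpoint; [lra|]. apply P1. lra. }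
  assert (Hq : forall t, 0 <= t <= T -> hitting_time T xi (- q t) = Finite t).
  { intros t Ht. destruct (Req_dec t 0) as [-> | Ht0].
    - rewrite Q0, Ropp_0. unfold hitting_time. destruct (Req_EM_T 0 (xi 0)); [reflexivity|lra].
    - apply hitting_time_left_endpoint; [lra|]. apply Q1. lra. }
  assert (Ponto : forall x, 0 <= x <= b -> exists t, 0 <= t <= T /\ p t = x).
  { intros x Hx. apply (monotone_onto p T M x HT HM P2 P3). lra. }
  assert (Qonto : forall x, 0 <= x <= a -> exists t, 0 <= t <= T /\ q t = x).
  { intros x Hx. apply (monotone_onto q T M x HT HM Q2 Q3). lra. }
  assert (Hpos : 0 < a /\ 0 < b).
  { assert (p 0 < p T) by (apply P2; lra). assert (q 0 < q T) by (apply Q2; lra). lra. }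
  assert (Hple : forall s t, 0 <= s -> s <= t -> t <= T -> p s <= p t).
  { intros s t Hs [Hst | ->] Ht; [left; now apply P2|lra]. }
  assert (Hqle : forall s t, 0 <= s -> s <= t -> t <= T -> q s <= q t).
  { intros s t Hs [Hst | ->] Ht; [left; now apply Q2|lra]. }
  assert (Hall : forall x, - a <= x <= b -> exists t, 0 <= t <= T /\ hitting_time T xi x = Finite t /\
     (x = p t \/ x = - q t)).
  { intros x Hx. destruct (Rle_lt_dec 0 x) as [H | H].
    - destruct (Ponto x) as [t [Ht <-]]; [lra|]. exists t. auto.
    - destruct (Qonto (- x)) as [t [Ht E]]; [lra|]. exists t. split; [exact Ht|].
      replace x with (- q t) by lra. auto. }
  assert (Hlow : forall x s, - a <= x <= b -> 0 <= s <= T -> - q s < x < p s -> hitting_time_R T xi x < s).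
  { intros x s Hx Hs Hxs. destruct (Hall x Hx) as [t [Ht [E Hcase]]].
    unfold hitting_time_R. rewrite E. simpl. destruct (Rlt_le_dec t s) as [|Hst]; [assumption|exfalso].
    pose proof (Hple s t ltac:(lra) Hst ltac:(lra)). pose proof (Hqle s t ltac:(lra) Hst ltac:(lra)).
    assert (0 <= p s) by (rewrite <- P0; apply Hple; lra).
    assert (0 <= q s) by (rewrite <- Q0; apply Hqle; lra).
    destruct Hcase; lra. }
  assert (Hhigh : forall x s, - a <= x <= b -> 0 <= s <= T -> x < - q s \/ p s < x -> s < hitting_time_R T xi x).
  { intros x s Hx Hs Hxs. destruct (Hall x Hx) as [t [Ht [E Hcase]]].
    unfold hitting_time_R. rewrite E. simpl. destruct (Rlt_le_dec s t) as [|Hst]; [assumption|exfalso].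
    pose proof (Hple t s ltac:(lra) Hst ltac:(lra)). pose proof (Hqle t s ltac:(lra) Hst ltac:(lra)).
    assert (0 <= p t) by (rewrite <- P0; apply Hple; lra).
    assert (0 <= q t) by (rewrite <- Q0; apply Hqle; lra).
    destruct Hcase, Hxs; lra. }
  assert (HpR : forall t, 0 <= t <= T -> hitting_time_R T xi (p t) = t).
  { intros t Ht. unfold hitting_time_R. now rewrite Hp. }
  assert (HqR : forall t, 0 <= t <= T -> hitting_time_R T xi (- q t) = t).
  { intros t Ht. unfold hitting_time_R. now rewrite Hq. }
  exists p, q. split; [exact P0|]. split; [exact Q0|]. split; [|split; [|split]].
  - intros t Ht. split; [now apply P1|now apply Q1].
  - split; [apply Hpos|]. split; [apply Hpos|]. split; [|split; [|split; [|split; [|split]]]].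
    + intros x. split.
      * intros Hf. destruct (Rle_lt_dec x b) as [Hxb | Hxb]; [destruct (Rle_lt_dec (- a) x) as [Hxa | Hxa]; [lra|]|]; exfalso.
        -- revert Hf. unfold hitting_time. destruct (Req_EM_T x (xi 0)) as [E | _]; [lra|].
           rewrite Glb_Rbar_empty; [discriminate|]. intros s Hs. apply hits_at_opp in Hs.
           apply (no_hit_beyond T (fun s => - xi s) a (- x) s); auto using opp_driver_continuity. lra.
        -- revert Hf. unfold hitting_time. destruct (Req_EM_T x (xi 0)) as [E | _]; [lra|].
           rewrite Glb_Rbar_empty; [discriminate|]. intros s Hs.
           apply (no_hit_beyond T xi b x s); auto.
      * intros Hx. destruct (Hall x Hx) as [t [_ [-> _]]]. reflexivity.
    + intros x Hx. unfold Icc in Hx. destruct (Hall x Hx) as [t [Ht [E Hcase]]].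
      apply filterlim_locally. intros eps.
      assert (Hval : hitting_time_R T xi x = t) by (unfold hitting_time_R; now rewrite E).
      pose proof (cond_pos eps) as Heps.
      assert (Hup : exists d, 0 < d /\ forall y, - a <= y <= b -> Rabs (y - x) < d -> hitting_time_R T xi y < t + eps).
      { destruct (Rle_lt_dec (t + eps) T) as [HtT | HtT].
        - pose proof (P2 t (t + eps) ltac:(lra) ltac:(lra) ltac:(lra)).
          pose proof (Q2 t (t + eps) ltac:(lra) ltac:(lra) ltac:(lra)).
          assert (0 <= p t) by (rewrite <- P0; apply Hple; lra).
          assert (0 <= q t) by (rewrite <- Q0; apply Hqle; lra).
          exists (Rmin (p (t + eps) - x) (x + q (t + eps))).
          pose proof (Rmin_l (p (t + eps) - x) (x + q (t + eps))).
          pose proof (Rmin_r (p (t + eps) - x) (x + q (t + eps))).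
          split; [apply Rmin_pos; destruct Hcase; lra|]. intros y Hy Hyx. apply Rabs_def2 in Hyx.
          apply Hlow; [exact Hy|lra|lra].
        - exists 1. split; [lra|]. intros y Hy _. destruct (Hall y Hy) as [s [Hs [Es Hsc]]].
          unfold hitting_time_R. rewrite Es. simpl.
          destruct (Rlt_le_dec s (t + eps)) as [|Hge]; [assumption|exfalso]. lra. }
      assert (Hdn : exists d, 0 < d /\ forall y, - a <= y <= b -> Rabs (y - x) < d -> t - eps < hitting_time_R T xi y).
      { destruct (Rle_lt_dec 0 (t - eps)) as [Ht0 | Ht0].
        - pose proof (P2 (t - eps) t ltac:(lra) ltac:(lra) ltac:(lra)).
          pose proof (Q2 (t - eps) t ltac:(lra) ltac:(lra) ltac:(lra)).
          destruct Hcase as [-> | ->].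
          + exists (p t - p (t - eps)). split; [lra|]. intros y Hy Hyx. apply Rabs_def2 in Hyx.
            apply Hhigh; [exact Hy|lra|right; lra].
          + exists (q t - q (t - eps)). split; [lra|]. intros y Hy Hyx. apply Rabs_def2 in Hyx.
            apply Hhigh; [exact Hy|lra|left; lra].
        - exists 1. split; [lra|]. intros y Hy _. destruct (Hall y Hy) as [s [Hs [Es Hsc]]].
          unfold hitting_time_R. rewrite Es. simpl. lra. }
      destruct Hup as [d1 [Hd1 H1]]. destruct Hdn as [d2 [Hd2 H2]].
      assert (Hm : 0 < Rmin d1 d2) by now apply Rmin_pos.
      exists (mkposreal _ Hm). intros y Hy Hyab. unfold Icc in Hyab.
      change (Rabs (y - x) < Rmin d1 d2) in Hy.
      pose proof (Rmin_l d1 d2). pose proof (Rmin_r d1 d2).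
      specialize (H1 y Hyab ltac:(lra)). specialize (H2 y Hyab ltac:(lra)).
      change (Rabs (hitting_time_R T xi y - hitting_time_R T xi x) < eps).
      rewrite Hval. apply Rabs_def1; lra.
    + intros x y Hx Hxy Hy. destruct (Qonto (- y)) as [t [Ht E]]; [lra|].
      replace y with (- q t) by lra. rewrite HqR by exact Ht. apply Hhigh; [lra|exact Ht|left; lra].
    + intros x y Hx Hxy Hy. destruct (Ponto x) as [t [Ht E]]; [lra|].
      rewrite <- E at 1. rewrite HpR by exact Ht. apply Hhigh; [lra|exact Ht|right; lra].
    + rewrite <- QT. apply HqR. lra.
    + rewrite <- PT. apply HpR. lra.
  - intros t Ht. split; [|split; [now apply Hp|now apply Hq]].
    rewrite <- PT, <- P0. split; apply Hple; lra.
  - intros x Hx. destruct (Qonto (- x)) as [t [Ht E]]; [lra|]. exists t. split; [exact Ht|lra].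
Qed.

End HittingInterval.

(** * Oscillating drivers *)

Definition oscillation (k w s : R) : R := k * s * sin (w * s).
Definition oscillation' (k w s : R) : R := k * sin (w * s) + k * s * (w * cos (w * s)).

Lemma oscillation_derive k w s : is_derive (oscillation k w) s (oscillation' k w s).
Proof. unfold oscillation, oscillation'. auto_derive; [exact I|ring]. Qed.

Lemma oscillation'_continuity k w s : continuity_pt (oscillation' k w) s.
Proof. apply derivable_continuous_pt. unfold oscillation'. reg. Qed.

Lemma oscillation'_bound k w T s : 0 < k -> 0 < w -> 0 < T -> - 1 <= s <= T + 1 ->
  Rabs (oscillation' k w s) <= k + k * (T + 1) * w.
Proof.
  intros Hk Hw HT Hs. unfold oscillation'. eapply Rle_trans; [apply Rabs_triang|].
  rewrite !Rabs_mult, (Rabs_pos_eq k), (Rabs_pos_eq w) by lra.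
  assert (Rabs (sin (w * s)) <= 1) by (apply Rabs_le, SIN_bound).
  assert (Rabs (cos (w * s)) <= 1) by (apply Rabs_le, COS_bound).
  assert (Rabs s <= T + 1) by (apply Rabs_le; lra).
  pose proof (Rabs_pos (cos (w * s))). pose proof (Rabs_pos s). pose proof (Rabs_pos (sin (w * s))).
  apply Rplus_le_compat; [nra|].
  apply Rmult_le_compat; [nra|nra| |nra]. apply Rmult_le_compat_l; lra.
Qed.

Lemma oscillation_upper k w s t : 0 < k -> 0 <= s <= t -> Rabs (oscillation k w s) <= k * t.
Proof.
  intros Hk Hs. unfold oscillation. rewrite !Rabs_mult, (Rabs_pos_eq k), (Rabs_pos_eq s) by lra.
  assert (Rabs (sin (w * s)) <= 1) by (apply Rabs_le, SIN_bound).
  pose proof (Rabs_pos (sin (w * s))).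
  apply Rle_trans with (k * s * 1); [apply Rmult_le_compat_l; [nra|lra]|nra].
Qed.

(** The last peak before [t] is at most one period old. Here [v] is the sign of the peak and [e]
    its phase; before the first peak the bound is nonpositive and [s = 0] serves. *)
Lemma oscillation_peak k w t e v : 0 < k -> 0 < w -> 0 <= t ->
  0 <= e <= 2 * PI -> v * sin e = 1 ->
  exists s, 0 <= s <= t /\ k * (t - 2 * PI / w) <= v * oscillation k w s.
Proof.
  intros Hk Hw Ht He Hv. pose proof PI_RGT_0 as HPI.
  destruct (Rlt_le_dec (w * t) e) as [Hlt | Hge].
  - exists 0. split; [lra|]. unfold oscillation. rewrite Rmult_0_r, Rmult_0_l, Rmult_0_r.
    assert (t <= 2 * PI / w).
    { apply Rmult_le_reg_l with w; [exact Hw|]. replace (w * (2 * PI / w)) with (2 * PI) by (field; lra). lra. }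
    assert (0 <= k * (2 * PI / w - t)) by (apply Rmult_le_pos; lra). lra.
  - destruct (nfloor_ex ((w * t - e) / (2 * PI))) as [m [Hm1 Hm2]].
    { apply Rmult_le_pos; [lra|]. left. apply Rinv_0_lt_compat. lra. }
    assert (Hm3 : e + 2 * INR m * PI <= w * t).
    { apply Rmult_le_compat_r with (r := 2 * PI) in Hm1; [|lra].
      replace ((w * t - e) / (2 * PI) * (2 * PI)) with (w * t - e) in Hm1 by (field; lra). lra. }
    assert (Hm4 : w * t < e + 2 * INR m * PI + 2 * PI).
    { apply Rmult_lt_compat_r with (r := 2 * PI) in Hm2; [|lra].
      replace ((w * t - e) / (2 * PI) * (2 * PI)) with (w * t - e) in Hm2 by (field; lra). lra. }
    pose proof (pos_INR m).
    set (s := (e + 2 * INR m * PI) / w).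
    assert (Hs : w * s = e + 2 * INR m * PI) by (unfold s; field; lra).
    assert (Hs0 : 0 <= s).
    { unfold s. apply Rmult_le_pos; [nra|]. left. now apply Rinv_0_lt_compat. }
    exists s. split; [split; [exact Hs0|apply Rmult_le_reg_l with w; lra]|].
    unfold oscillation. rewrite Hs, sin_period.
    replace (v * (k * s * sin e)) with (k * s * (v * sin e)) by ring. rewrite Hv, Rmult_1_r.
    apply Rmult_le_compat_l; [lra|]. apply Rmult_le_reg_l with w; [exact Hw|].
    replace (w * (t - 2 * PI / w)) with (w * t - 2 * PI) by (field; lra). lra.
Qed.

Lemma right_endpoint_bounds (f : R -> R) (t x m B : R) :
  (forall s, continuity_pt f s) -> 0 < t -> right_endpoint f t x ->
  (exists s, 0 <= s <= t /\ m <= f s) -> (forall s, 0 <= s <= t -> f s <= B) ->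
  m <= x <= B + 2 * sqrt t.
Proof.
  intros Hf Ht He [s [Hs Hms]] HB.
  destruct (right_endpoint_solution f t x Ht He) as [u [U0 [U1 U2]]]. rewrite <- U0. split.
  - pose proof (touching_above_driver f Hf t u Ht U1 U2 s Hs). lra.
  - replace t with (t - 0) at 1 by ring.
    apply (touching_upper_bound f t u 0 B); auto. lra.
Qed.

(** Both endpoints lie between [k (t - 2 PI / w)] and [k t + 2 sqrt t]. *)
Lemma oscillation_endpoints_close k w t x y : 0 < k -> 0 < w -> 0 < t ->
  right_endpoint (oscillation k w) t x -> right_endpoint (fun s => - oscillation k w s) t y ->
  Rabs (x - y) <= 2 * PI * k / w + 2 * sqrt t.
Proof.
  intros Hk Hw Ht Hx Hy. pose proof PI_RGT_0 as HPI.
  assert (Hc : forall s, continuity_pt (oscillation k w) s).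
  { intros s. eapply is_derive_continuity_pt, oscillation_derive. }
  destruct (right_endpoint_bounds (oscillation k w) t x (k * (t - 2 * PI / w)) (k * t)) as [X1 X2]; auto.
  { destruct (oscillation_peak k w t (PI / 2) 1) as [s [Hs Hps]]; auto; [lra|lra|rewrite sin_PI2; ring|].
    exists s. split; [exact Hs|]. lra. }
  { intros s Hs. eapply Rle_trans; [apply Rle_abs|]. now apply oscillation_upper. }
  destruct (right_endpoint_bounds (fun s => - oscillation k w s) t y (k * (t - 2 * PI / w)) (k * t)) as [Y1 Y2]; auto.
  { intros s. now apply continuity_pt_opp. }
  { destruct (oscillation_peak k w t (3 * (PI / 2)) (-1)) as [s [Hs Hps]]; auto; [lra|lra|rewrite sin_3PI2; ring|].
    exists s. split; [exact Hs|]. lra. }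
  { intros s Hs. eapply Rle_trans; [apply Rle_abs|]. rewrite Rabs_Ropp. now apply oscillation_upper. }
  replace (2 * PI * k / w) with (k * t - k * (t - 2 * PI / w)) by (field; lra).
  apply Rabs_le. lra.
Qed.

Lemma oscillation_scale k w c : 0 < c ->
  (fun s => oscillation k w (c ^ 2 * s) / c) = oscillation (k * c) (w * c ^ 2).
Proof.
  intros Hc. apply functional_extensionality. intros s. unfold oscillation.
  replace (w * c ^ 2 * s) with (w * (c ^ 2 * s)) by ring. field. lra.
Qed.

Lemma oscillation_scale_opp k w c : 0 < c ->
  (fun s => - oscillation k w (c ^ 2 * s) / c) = (fun s => - oscillation (k * c) (w * c ^ 2) s).
Proof.
  intros Hc. apply functional_extensionality. intros s. rewrite <- oscillation_scale by exact Hc.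
  field. lra.
Qed.

(** At the positive peak [t1] the right endpoint is ahead by [A PI / 2] up to [2 sqrt t1], and at the
    next negative peak [t1 + PI] the left one is. The choice of [A] makes [A PI / 2 >= 12 N] exceed
    [2 sqrt t <= 6 N], so that the two endpoints are equal at some time in between. *)
Lemma balanced_time (n : nat) :
  let N := INR n + 1 in
  let A := 8 * N in
  let t1 := PI / 2 + 2 * INR n * PI in
  exists T c, t1 <= T <= t1 + PI /\ A * t1 <= c <= A * T + 6 * N /\ 2 * sqrt T <= 6 * N /\
    right_endpoint (oscillation A 1) T c /\ right_endpoint (fun s => - oscillation A 1 s) T c.
Proof.
  intros N A t1. pose proof (pos_INR n) as Hn. pose proof PI_4 as HP4. pose proof PI2_3_2 as HP3.
  set (t2 := t1 + PI).
  assert (HN : 1 <= N) by (unfold N; lra).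
  assert (HA : 0 < A) by (unfold A; lra).
  assert (Ht1 : 0 < t1) by (unfold t1; nra).
  assert (Ht2 : t2 <= 8 * N) by (unfold t2, t1, N; nra).
  assert (Ht2' : 0 < t2) by (unfold t2; lra).
  assert (Hsq : forall t, 0 <= t <= t2 -> sqrt t <= 3 * N).
  { intros t Ht. rewrite <- (sqrt_pow2 (3 * N)) by lra. apply sqrt_le_1_alt. nra. }
  assert (Hc : forall s, continuity_pt (oscillation A 1) s).
  { intros s. eapply is_derive_continuity_pt, oscillation_derive. }
  assert (Hb : forall s, - 1 <= s <= t2 + 1 -> Rabs (oscillation' A 1 s) <= A + A * (t2 + 1) * 1).
  { intros s Hs. apply oscillation'_bound; lra. }
  assert (HM : 0 < A + A * (t2 + 1) * 1) by nra.
  destruct (right_endpoint_function (oscillation A 1) (oscillation' A 1) t2 _ Ht2' HM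
    (oscillation_derive A 1) (oscillation'_continuity A 1) Hb) as [p [P0 [P1 [P2 P3]]]].
  destruct (right_endpoint_function (fun s => - oscillation A 1 s) (fun s => - oscillation' A 1 s) t2 _ Ht2' HM)
    as [q [Q0 [Q1 [Q2 Q3]]]].
  { intros t. apply is_derive_Ropp, oscillation_derive. }
  { intros t. apply continuity_pt_opp, oscillation'_continuity. }
  { intros t Ht. rewrite Rabs_Ropp. now apply Hb. }
  assert (Habs : forall s t, 0 <= s <= t -> - (A * t) <= oscillation A 1 s <= A * t).
  { intros s t Hs. pose proof (oscillation_upper A 1 s t HA Hs) as H. now apply Rabs_le_between in H. }
  assert (Hsin : forall r, sin (1 * r) = sin (r - 2 * INR n * PI)).
  { intros r. rewrite <- (sin_period (r - 2 * INR n * PI) n). f_equal. ring. }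
  assert (B1 : A * t1 <= p t1).
  { apply (right_endpoint_bounds (oscillation A 1) t1 (p t1) _ (A * t1)); auto.
    - apply P1. unfold t2. lra.
    - exists t1. split; [lra|]. unfold oscillation. rewrite Hsin.
      replace (t1 - 2 * INR n * PI) with (PI / 2) by (unfold t1; ring). rewrite sin_PI2. lra.
    - intros s Hs. now apply Habs. }
  assert (B2 : q t1 <= A * (2 * INR n * PI) + 2 * sqrt t1).
  { apply (right_endpoint_bounds (fun s => - oscillation A 1 s) t1 (q t1) 0); auto.
    - intros s. apply continuity_pt_opp, Hc.
    - apply Q1. unfold t2. lra.
    - exists 0. split; [lra|]. unfold oscillation. rewrite !Rmult_0_r, sin_0. lra.
    - intros s Hs. destruct (Rle_lt_dec s (2 * INR n * PI)) as [H | H].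
      + pose proof (Habs s (2 * INR n * PI)). lra.
      + assert (0 <= sin (1 * s)) by (rewrite Hsin; apply sin_ge_0; unfold t1 in Hs; lra).
        unfold oscillation. assert (0 <= A * s * sin (1 * s)) by (apply Rmult_le_pos; [nra|assumption]).
        assert (0 <= A * (2 * INR n * PI)) by (apply Rmult_le_pos; nra). lra. }
  assert (B3 : p t2 <= A * (2 * INR n * PI + PI) + 2 * sqrt t2).
  { apply (right_endpoint_bounds (oscillation A 1) t2 (p t2) 0); auto.
    - apply P1. lra.
    - exists 0. split; [lra|]. unfold oscillation. rewrite !Rmult_0_r, sin_0. lra.
    - intros s Hs. destruct (Rle_lt_dec s (2 * INR n * PI + PI)) as [H | H].
      + pose proof (Habs s (2 * INR n * PI + PI)). lra.
      + assert (sin (1 * s) <= 0) by (rewrite Hsin; apply sin_le_0; unfold t2, t1 in Hs; lra).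
        unfold oscillation. assert (0 <= A * s * - sin (1 * s)) by (apply Rmult_le_pos; [nra|lra]).
        assert (0 <= A * (2 * INR n * PI + PI)) by (apply Rmult_le_pos; nra). lra. }
  assert (B4 : A * t2 <= q t2).
  { apply (right_endpoint_bounds (fun s => - oscillation A 1 s) t2 (q t2) _ (A * t2)); auto.
    - intros s. apply continuity_pt_opp, Hc.
    - apply Q1. lra.
    - exists t2. split; [lra|]. unfold oscillation. rewrite Hsin.
      replace (t2 - 2 * INR n * PI) with (3 * (PI / 2)) by (unfold t2, t1; field). rewrite sin_3PI2. lra.
    - intros s Hs. pose proof (Habs s t2 Hs). lra. }
  pose proof (Hsq t1 ltac:(unfold t2; lra)) as S1. pose proof (Hsq t2 ltac:(lra)) as S2.
  assert (HAP : 12 * N <= A * (PI / 2)) by (unfold A; nra).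
  destruct (IVT_interv (fun s => q (clamp 0 t2 s) - p (clamp 0 t2 s)) t1 t2) as [T [HT ET]].
  - intros s Hs. apply continuity_pt_minus.
    + now apply (modulus_continuity q t2 _ Ht2' HM).
    + now apply (modulus_continuity p t2 _ Ht2' HM).
  - unfold t2. lra.
  - rewrite clamp_id by (unfold t2; lra).
    assert (A * t1 = A * (PI / 2) + A * (2 * INR n * PI)) by (unfold t1; ring). lra.
  - rewrite clamp_id by lra.
    assert (A * t2 = A * (PI / 2) + A * (2 * INR n * PI + PI)) by (unfold t2, t1; ring). lra.
  - rewrite clamp_id in ET by lra. exists T, (p T).
    assert (HTT : 0 < T <= t2) by lra. pose proof (Hsq T ltac:(lra)).
    split; [unfold t2 in HT; lra|]. split; [|split; [lra|split]].
    + split.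
      * eapply Rle_trans; [exact B1|]. destruct (Req_dec t1 T) as [-> |]; [lra|left; apply P2; lra].
      * destruct (right_endpoint_bounds (oscillation A 1) T (p T) 0 (A * T)) as [_ H']; auto; [lra| | |lra].
        -- exists 0. split; [lra|]. unfold oscillation. rewrite !Rmult_0_r, sin_0. lra.
        -- intros s Hs. now apply Habs.
    + now apply P1.
    + replace (p T) with (q T) by lra. now apply Q1.
Qed.

(** The balanced driver, scaled by its common endpoint [c]. Since [c >= A t1 >= 12 N^2], the
    error [2 PI A + 2 sqrt T0 <= 70 N] of the welding becomes [6 / N]; the peak [A t1] is a fixed fraction
    of [c], and the time becomes [T0 / c^2]. *)
Lemma oscillating_example (n : nat) :
  exists (T : R) (xi : R -> R) (gamma : R -> C) (phi : R -> R),
    (simple_curve_driver0 T xi /\ upward_driver_of T xi gamma /\ conformal_welding T xi 1 1 phi) /\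
    (forall x, - 1 <= x <= 0 -> Rabs (phi x + x) <= 6 / (INR n + 1)) /\
    (exists s, 0 <= s <= T /\ 1 / 5 <= Rabs (xi s)) /\
    (exists B, forall s, 0 <= s <= T -> Rabs (xi s) <= B) /\
    0 < T <= 1 / 16 /\
    (forall x, - 1 <= x <= 1 -> 0 <= hitting_time_R T xi x <= T).
Proof.
  destruct (balanced_time n) as [T0 [c [HT0 [Hc [Hsq [Hp Hq]]]]]].
  set (N := INR n + 1) in *. set (A := 8 * N) in *. set (t1 := PI / 2 + 2 * INR n * PI) in *.
  pose proof (pos_INR n) as Hn. pose proof PI_4 as HP4. pose proof PI2_3_2 as HP3.
  assert (HN : 1 <= N) by (unfold N; lra).
  assert (HA : 8 <= A) by (unfold A; lra).
  assert (Ht1 : 3 / 2 * N <= t1) by (unfold t1, N; nra).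
  assert (Ht1' : 3 / 2 <= t1) by lra.
  assert (HAt : 12 * N ^ 2 <= A * t1) by (unfold A; nra).
  assert (Hc0 : 12 <= c) by nra.
  assert (Hcp : 0 < c) by lra.
  assert (Hc2 : 0 < c ^ 2) by now apply pow_lt.
  apply (right_endpoint_scale _ T0 c c Hcp) in Hp. apply (right_endpoint_scale _ T0 c c Hcp) in Hq.
  rewrite oscillation_scale in Hp by exact Hcp. cbv beta in Hq. rewrite oscillation_scale_opp in Hq by exact Hcp.
  replace (c / c) with 1 in Hp, Hq by (field; lra). rewrite Rmult_1_l in Hp, Hq.
  set (T := T0 / c ^ 2) in *. set (k := A * c) in *. set (xi := oscillation k (c ^ 2)) in *.
  assert (HT : 0 < T) by (apply Rdiv_lt_0_compat; lra).
  assert (Hk : 0 < k) by (apply Rmult_lt_0_compat; lra).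
  set (M := k + k * (T + 1) * c ^ 2).
  assert (HM : 0 < M) by (unfold M; assert (0 < k * (T + 1) * c ^ 2) by (repeat apply Rmult_lt_0_compat; lra); lra).
  assert (Hb : forall s, - 1 <= s <= T + 1 -> Rabs (oscillation' k (c ^ 2) s) <= M).
  { intros s Hs. now apply oscillation'_bound. }
  assert (xi0 : xi 0 = 0) by (unfold xi, oscillation; ring).
  destruct (smooth_driver_generates_curve xi (oscillation' k (c ^ 2)) T M HT HM
    (oscillation_derive k (c ^ 2)) (oscillation'_continuity k (c ^ 2)) Hb) as [gamma [Hgamma _]].
  destruct (smooth_driver_hitting_interval xi (oscillation' k (c ^ 2)) T M HT HM xi0
    (oscillation_derive k (c ^ 2)) (oscillation'_continuity k (c ^ 2)) Hb 1 1 Hp Hq)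
    as [p [q [P0 [Q0 [Hpq [Hint [Hhit Honto]]]]]]].
  exists T, xi, gamma, (fun x => p (hitting_time_R T xi x)).
  assert (Hval : forall x, - 1 <= x <= 0 -> exists t, 0 <= t <= T /\ x = - q t /\ hitting_time_R T xi x = t).
  { intros x Hx. destruct (Honto x Hx) as [t [Ht ->]]. exists t. split; [exact Ht|]. split; [reflexivity|].
    unfold hitting_time_R. now destruct (Hhit t Ht) as [_ [_ ->]]. }
  split; [|split; [|split; [|split; [|split]]]].
  - split; [|split].
    + split; [now exists gamma|exact xi0].
    + exact Hgamma.
    + split; [exact Hint|]. intros x Hx. destruct (Hval x Hx) as [t [Ht [_ ->]]].
      destruct (Hhit t Ht) as [H1 [H2 _]]. split; [exact H1|]. unfold hitting_time_R. now rewrite H2.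
  - intros x Hx. destruct (Hval x Hx) as [t [Ht [-> ->]]].
    destruct (Req_dec t 0) as [-> | Ht0].
    { rewrite P0, Q0, Ropp_0, Rplus_0_l, Rabs_R0. left. apply Rdiv_lt_0_compat; lra. }
    destruct (Hpq t) as [E1 E2]; [lra|].
    assert (HC := oscillation_endpoints_close k (c ^ 2) t (p t) (q t) Hk Hc2 ltac:(lra) E1 E2).
    eapply Rle_trans; [exact HC|].
    assert (Hst : sqrt t <= sqrt T0 / c).
    { replace (sqrt T0 / c) with (sqrt T).
      - apply sqrt_le_1_alt. lra.
      - unfold T. rewrite sqrt_div by lra. now rewrite sqrt_pow2 by lra. }
    replace (2 * PI * k / c ^ 2) with (2 * PI * A / c) by (unfold k; field; lra).
    apply Rle_trans with ((2 * PI * A + 2 * sqrt T0) / c).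
    { replace ((2 * PI * A + 2 * sqrt T0) / c) with (2 * PI * A / c + 2 * (sqrt T0 / c)) by (field; lra). lra. }
    apply Rle_trans with (70 * N / c).
    { apply Rmult_le_compat_r; [left; now apply Rinv_0_lt_compat|]. unfold A in *. nra. }
    apply Rmult_le_reg_r with (c * N); [nra|].
    replace (70 * N / c * (c * N)) with (70 * N ^ 2) by (field; lra).
    replace (6 / N * (c * N)) with (6 * c) by (field; lra). nra.
  - exists (t1 / c ^ 2). split.
    { split; [left; apply Rdiv_lt_0_compat; lra|]. apply Rmult_le_compat_r; [left; now apply Rinv_0_lt_compat|lra]. }
    unfold xi, oscillation. replace (c ^ 2 * (t1 / c ^ 2)) with t1 by (field; lra).
    unfold t1 at 2. rewrite sin_period, sin_PI2.
    replace (k * (t1 / c ^ 2) * 1) with (A * t1 / c) by (unfold k; field; lra).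
    eapply Rle_trans; [|apply Rle_abs].
    apply Rmult_le_reg_r with (5 * c); [lra|].
    replace (A * t1 / c * (5 * c)) with (5 * (A * t1)) by (field; lra).
    assert (A * T0 <= A * t1 + A * 4) by nra. unfold A in *. nra.
  - exists (k * T). intros s Hs. now apply oscillation_upper.
  - split; [exact HT|]. unfold T. apply Rmult_le_reg_r with (c ^ 2); [exact Hc2|].
    replace (T0 / c ^ 2 * c ^ 2) with T0 by (field; lra).
    assert (8 * t1 <= c) by nra. nra.
  - intros x Hx. destruct (Rle_lt_dec x 0) as [H | H].
    + destruct (Hval x) as [t [Ht [_ ->]]]; lra.
    + destruct (Hval 0) as [t [Ht [_ E0]]]; [lra|].
      destruct Hint as [_ [_ [_ [_ [_ [Hinc [_ HT1]]]]]]].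
      pose proof (Hinc 0 x ltac:(lra) H ltac:(lra)).
      destruct (Req_dec x 1) as [-> | Hx1]; [lra|].
      pose proof (Hinc x 1 ltac:(lra) ltac:(lra) ltac:(lra)). lra.
Qed.

Lemma sup_norm_bounds (a b B : R) (f : R -> R) (x0 : R) :
  (forall x, a <= x <= b -> Rabs (f x) <= B) -> a <= x0 <= b ->
  Rabs (f x0) <= sup_norm a b f <= B.
Proof.
  intros HB Hx0. unfold sup_norm.
  set (E := fun r => exists x, a <= x <= b /\ r = Rabs (f x)).
  destruct (Lub_Rbar_correct E) as [H1 H2].
  assert (Hx : Rbar_le (Rabs (f x0)) (Lub_Rbar E)) by (apply H1; now exists x0).
  assert (Hub : Rbar_le (Lub_Rbar E) B).
  { apply H2. intros r [x [Hx' ->]]. now apply HB. }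
  destruct (Lub_Rbar E); simpl in *; [lra|contradiction|contradiction].
Qed.

Lemma not_lim_0 (u : nat -> R) (c : R) : 0 < c -> (forall n, c <= u n) -> ~ is_lim_seq u (Finite 0).
Proof.
  intros Hc Hu H.
  assert (Hle : Rbar_le (Finite c) (Finite 0)).
  { apply (is_lim_seq_le (fun _ => c) u); [exact Hu|apply is_lim_seq_const|exact H]. }
  simpl in Hle. lra.
Qed.

Lemma lim_0_of_bound (u : nat -> R) (K : R) :
  (forall n, 0 <= u n <= K / (INR n + 1)) -> is_lim_seq u (Finite 0).
Proof.
  intros Hu.
  apply (is_lim_seq_le_le (fun _ => 0) u (fun n => K * / INR (S n))).
  - intros n. rewrite S_INR. apply Hu.
  - apply is_lim_seq_const.
  - replace (Finite 0) with (Rbar_mult K (Finite 0)) by (simpl; f_equal; ring).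
    apply is_lim_seq_scal_l. apply (is_lim_seq_incr_1 (fun n => / INR n)).
    apply (is_lim_seq_inv INR p_infty); [apply is_lim_seq_INR|discriminate].
Qed.

(** * The zero driver *)

Lemma sqrt_derive_down t s : s < t -> is_derive (fun r => 2 * sqrt (t - r)) s (-2 / (2 * sqrt (t - s))).
Proof.
  intros Hs. assert (0 < sqrt (t - s)) by (apply sqrt_lt_R0; lra).
  auto_derive; [lra|]. unfold Rminus in *. field. lra.
Qed.

Lemma zero_driver_endpoint (xi : R -> R) (t : R) : (forall s, xi s = 0) -> 0 < t ->
  right_endpoint xi t (2 * sqrt t).
Proof.
  intros H0 Ht. exists (fun r => 2 * sqrt (t - r)). split; [now rewrite Rminus_0_r|]. split.
  - intros r Hr. rewrite H0, Rminus_0_r. split; [|apply sqrt_derive_down; lra].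
    assert (0 < sqrt (t - r)) by (apply sqrt_lt_R0; lra). lra.
  - intros eps Heps. exists ((eps / 2) ^ 2). split; [apply pow_lt; lra|].
    intros r Hr Hrd. rewrite H0, Rminus_0_r.
    assert (sqrt (t - r) < eps / 2); [|lra].
    rewrite <- (sqrt_pow2 (eps / 2)) by lra. apply sqrt_lt_1_alt. lra.
Qed.

Lemma sqrt_quarter : 2 * sqrt (1 / 4) = 1.
Proof. replace (1 / 4) with ((1 / 2) ^ 2) by field. rewrite sqrt_pow2 by lra. field. Qed.

(** The solution born at [0] at time [a] is [2 sqrt (t - a)], by uniqueness. *)
Lemma zero_driver_curve : exists gamma0 : R -> C,
  upward_driver_of (1 / 4) (fun _ : R => 0) gamma0 /\
  forall t, 0 <= t <= 1 / 4 -> gamma0 t = (RtoC (2 * sqrt t) * Ci)%C.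
Proof.
  set (eta := loewner_drift (fun _ => 0) (1 / 4)).
  assert (Hd : forall t, is_derive (fun _ : R => 0) t ((fun _ : R => 0) t)) by (intros t; apply is_derive_Rconst).
  assert (Hc : forall t, continuity_pt (fun _ : R => 0) t).
  { intros t. apply continuity_pt_cst. }
  assert (Hb : forall t, - 1 <= t <= 1 / 4 + 1 -> Rabs ((fun _ : R => 0) t) <= 1).
  { intros t _. rewrite Rabs_R0. lra. }
  assert (H4 : 0 < 1 / 4) by lra.
  destruct (smooth_driver_generates_curve (fun _ => 0) (fun _ => 0) (1 / 4) 1 H4 Rlt_0_1 Hd Hc Hb)
    as [gamma0 [Hg Hend]].
  exists gamma0. split; [exact Hg|]. intros t Ht.
  destruct (Req_dec t 0) as [-> | Ht0].
  { destruct Hg as [_ [_ [_ [-> _]]]]. rewrite sqrt_0, Rmult_0_r. ring. }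
  assert (Econt := loewner_drift_cont (fun _ => 0) (1 / 4) H4 Hc).
  assert (Ebd := loewner_drift_bound (fun _ => 0) (1 / 4) 1 H4 Hb).
  assert (EA := loewner_drift_imaginary (fun _ => 0) (1 / 4)).
  fold eta in Econt, Ebd, EA, Hend.
  destruct (singular_existence eta 1 Rlt_0_1 Econt Ebd (or_introl EA) (1 / 4 - t)) as [V HV].
  replace t with (1 / 4 - (1 / 4 - t)) at 1 by ring.
  rewrite (Hend (1 / 4 - t) V); [|lra|exact HV].
  rewrite <- (singular_unique eta 1 Rlt_0_1 Econt Ebd (or_introl EA) (1 / 4 - t) (1 / 4) V (RtoC (2 * sqrt t)));
    [ring|exact EA|exact HV|lra|].
  intros eps Heps. set (a := 1 / 4 - t).
  destruct (small_positive ((eps / 4) ^ 2) (eps / 2)) as [h1 Hh1]; [apply pow_lt; lra|lra|].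
  destruct (small_positive h1 t) as [h Hh]; [lra|lra|].
  set (r := a + h). assert (Hr : r = a + h /\ a = 1 / 4 - t) by now split.
  exists r, (fun s => RtoC (2 * sqrt (s - a))). split; [lra|]. split; [|split].
  - intros s Hs. assert (Hp : 0 < sqrt (s - a)) by (apply sqrt_lt_R0; lra). split; [simpl; lra|].
    eapply is_Cderive_eq.
    + apply is_Cderive_RtoC. instantiate (1 := 2 / (2 * sqrt (s - a))).
      auto_derive; [lra|]. unfold Rminus in *. field. lra.
    + unfold eta, loewner_drift. rewrite RtoC_div by lra. apply C_eq; simpl; ring.
  - f_equal. f_equal. f_equal. unfold a. ring.
  - rewrite Cmod_R. pose proof (sqrt_pos (r - a)). rewrite Rabs_pos_eq by lra.
    assert (sqrt (r - a) <= eps / 4); [|lra].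
    rewrite <- (sqrt_pow2 (eps / 4)) by lra. apply sqrt_le_1_alt. lra.
Qed.

Lemma zero_driver_welding :
  conformal_welding (1 / 4) (fun _ : R => 0) 1 1 (fun x : R => - x) /\
  (forall x : R, -1 <= x <= 1 -> hitting_time (1 / 4) (fun _ : R => 0) x = Finite (x ^ 2 / 4)).
Proof.
  assert (Hd : forall t, is_derive (fun _ : R => 0) t ((fun _ : R => 0) t)) by (intros t; apply is_derive_Rconst).
  assert (Hc : forall t, continuity_pt (fun _ : R => 0) t).
  { intros t. apply continuity_pt_cst. }
  assert (Hb : forall t, - 1 <= t <= 1 / 4 + 1 -> Rabs ((fun _ : R => 0) t) <= 1).
  { intros t _. rewrite Rabs_R0. lra. }
  assert (H4 : 0 < 1 / 4) by lra.
  assert (Ep : right_endpoint (fun _ => 0) (1 / 4) 1).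
  { pose proof (zero_driver_endpoint (fun _ => 0) (1 / 4) (fun _ => eq_refl) H4) as H.
    now rewrite sqrt_quarter in H. }
  assert (Eq : right_endpoint (fun _ => - 0) (1 / 4) 1).
  { pose proof (zero_driver_endpoint (fun _ => - 0) (1 / 4) (fun _ => Ropp_0) H4) as H.
    now rewrite sqrt_quarter in H. }
  assert (Htime : forall x : R, -1 <= x <= 1 -> hitting_time (1 / 4) (fun _ : R => 0) x = Finite (x ^ 2 / 4)).
  { intros x Hx. destruct (Req_dec x 0) as [-> | Hx0].
    { unfold hitting_time. destruct (Req_EM_T 0 0); [|lra]. f_equal. field. }
    assert (Hpos : 0 < x ^ 2 / 4 <= 1 / 4) by nra.
    assert (Hs : 2 * sqrt (x ^ 2 / 4) = Rabs x).
    { replace (x ^ 2 / 4) with ((Rabs x / 2) ^ 2).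
      - rewrite sqrt_pow2; [field|]. pose proof (Rabs_pos x). lra.
      - unfold Rdiv. rewrite Rpow_mult_distr, pow2_abs. field. }
    destruct (Rle_lt_dec 0 x) as [H | H].
    - apply (hitting_time_right_endpoint _ (fun _ => 0)); auto.
      rewrite <- (Rabs_pos_eq x) at 2 by exact H. rewrite <- Hs.
      apply zero_driver_endpoint; [reflexivity|lra].
    - rewrite <- (Ropp_involutive x) at 1.
      apply (hitting_time_left_endpoint _ (fun _ => 0)); auto.
      rewrite <- (Rabs_left x) by exact H. rewrite <- Hs.
      apply zero_driver_endpoint; [intros; apply Ropp_0|lra]. }
  split; [|exact Htime].
  destruct (smooth_driver_hitting_interval (fun _ => 0) (fun _ => 0) (1 / 4) 1 H4 Rlt_0_1 eq_refl Hd Hc Hb 1 1 Ep Eq)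
    as [p [q [_ [_ [_ [Hint _]]]]]].
  split; [exact Hint|]. intros x Hx. split; [lra|].
  unfold hitting_time_R. rewrite !Htime by lra. simpl. field.
Qed.

(** * The counterexample *)

Theorem theorem4p7 :
  (exists gamma0 : R -> C,
     upward_driver_of (1 / 4) (fun _ : R => 0) gamma0 /\
     (forall w : C,
        (exists t : R, 0 <= t <= 1 / 4 /\ gamma0 t = w) <->
        (exists y : R, 0 <= y <= 1 /\ w = (RtoC y * Ci)%C))) /\
  conformal_welding (1 / 4) (fun _ : R => 0) 1 1 (fun x : R => - x) /\
  (forall x : R, -1 <= x <= 1 ->
     hitting_time (1 / 4) (fun _ : R => 0) x = Finite (x ^ 2 / 4)) /\
  exists (T : nat -> R) (xi : nat -> R -> R)
         (gamma : nat -> R -> C) (phi : nat -> R -> R),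
    (forall n : nat,
       simple_curve_driver0 (T n) (xi n) /\
       upward_driver_of (T n) (xi n) (gamma n) /\
       conformal_welding (T n) (xi n) 1 1 (phi n)) /\
    is_lim_seq (fun n => sup_norm (-1) 0 (fun x => phi n x - - x)) (Finite 0) /\
    ~ is_lim_seq (fun n => sup_norm 0 (T n) (xi n)) (Finite 0) /\
    ~ is_lim_seq
        (fun n => sup_norm (-1) 1
           (fun x => hitting_time_R (T n) (xi n) x - x ^ 2 / 4)) (Finite 0).
Proof.
  split; [|split; [apply zero_driver_welding|split; [apply zero_driver_welding|]]].
  - destruct zero_driver_curve as [gamma0 [Hg Htr]]. exists gamma0. split; [exact Hg|].
    intros w. split.
    + intros [t [Ht <-]]. exists (2 * sqrt t). split; [|now apply Htr].
      pose proof (sqrt_pos t). split; [lra|]. rewrite <- sqrt_quarter.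
      apply Rmult_le_compat_l; [lra|]. apply sqrt_le_1_alt. lra.
    + intros [y [Hy ->]]. assert (Ht : 0 <= (y / 2) ^ 2 <= 1 / 4) by nra.
      exists ((y / 2) ^ 2). split; [exact Ht|]. rewrite Htr by exact Ht.
      rewrite sqrt_pow2 by lra. do 2 f_equal. field.
  - destruct (function_of_relation (fun n (z : R * (R -> R) * (R -> C) * (R -> R)) =>
      let '(T, xi, gamma, phi) := z in
      (simple_curve_driver0 T xi /\ upward_driver_of T xi gamma /\ conformal_welding T xi 1 1 phi) /\
      (forall x, - 1 <= x <= 0 -> Rabs (phi x + x) <= 6 / (INR n + 1)) /\
      (exists s, 0 <= s <= T /\ 1 / 5 <= Rabs (xi s)) /\
      (exists B, forall s, 0 <= s <= T -> Rabs (xi s) <= B) /\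
      0 < T <= 1 / 16 /\
      (forall x, - 1 <= x <= 1 -> 0 <= hitting_time_R T xi x <= T))) as [f Hf].
    { intros n. destruct (oscillating_example n) as [T [xi [gamma [phi H]]]].
      now exists (T, xi, gamma, phi). }
    exists (fun n => fst (fst (fst (f n)))), (fun n => snd (fst (fst (f n)))),
      (fun n => snd (fst (f n))), (fun n => snd (f n)).
    split; [|split; [|split]].
    + intros n. specialize (Hf n). destruct (f n) as [[[T xi] gamma] phi]. apply Hf.
    + apply (lim_0_of_bound _ 6). intros n. specialize (Hf n).
      destruct (f n) as [[[T xi] gamma] phi]. simpl. destruct Hf as [_ [Hphi _]].
      destruct (sup_norm_bounds (-1) 0 (6 / (INR n + 1)) (fun x => phi x - - x) 0) as [H1 H2].
      * intros x Hx. unfold Rminus. rewrite Ropp_involutive. now apply Hphi.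
      * lra.
      * split; [|exact H2]. eapply Rle_trans; [apply Rabs_pos|exact H1].
    + apply (not_lim_0 _ (1 / 5)); [lra|]. intros n. specialize (Hf n).
      destruct (f n) as [[[T xi] gamma] phi]. simpl.
      destruct Hf as [_ [_ [[s [Hs Hxs]] [[B HB] _]]]].
      eapply Rle_trans; [exact Hxs|]. now apply (sup_norm_bounds 0 T B xi s).
    + apply (not_lim_0 _ (1 / 8)); [lra|]. intros n. specialize (Hf n).
      destruct (f n) as [[[T xi] gamma] phi]. simpl.
      destruct Hf as [_ [_ [_ [_ [HT Htau]]]]].
      assert (H1 : 1 / 8 <= Rabs (hitting_time_R T xi 1 - 1 ^ 2 / 4)).
      { specialize (Htau 1 ltac:(lra)). rewrite Rabs_left1; lra. }
      eapply Rle_trans; [exact H1|].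
      apply (sup_norm_bounds (-1) 1 1 (fun x => hitting_time_R T xi x - x ^ 2 / 4) 1); [|lra].
      intros x Hx. specialize (Htau x Hx). apply Rabs_le. nra.
Qed.
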